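(* Let $m>1$, let $N\geq1$ be an integer and let $\sigma\in(-2,0)$ be such that $\sigma>-N$. Then, for any $p\in(m,p_s(\sigma))$, there exists at least one self-similar solution to the equation $u_t=\Delta u^m+|x|^{\sigma}u^p$ of the form $u(x,t)=(T-t)^{-\alpha}f(\xi)$, $\xi=|x|(T-t)^{-\beta}$, whose profile $f$ has the local behavior $$f(\xi)\sim\left[K+\frac{p-m}{m(N+\sigma)(\sigma+2)}\xi^{\sigma+2}\right]^{-1/(p-m)}\qquad\text{as }\xi\to0,$$ for some $K>0$, and $$f(\xi)\sim C\xi^{-(\sigma+2)/(p-m)}\qquad\text{as }\xi\to\infty,$$ for some $C>0$.
   Context: The Sobolev critical exponent is $p_s(\sigma)=\frac{m(N+2\sigma+2)}{N-2}$ if $N\geq3$ and $p_s(\sigma)=+\infty$ if $N\in\{1,2\}$. The equation is posed for $x\in\mathbb{R}^N$, $t\in(0,T)$, $T>0$, and $$\alpha=\frac{\sigma+2}{L},\quad \beta=\frac{p-m}{L},\quad L=\sigma(m-1)+2(p-1)>0.$$ The profile $f$ is nonnegative and solves, wherever it is positive on $(0,\infty)$, $$(f^m)''(\xi)+\frac{N-1}{\xi}(f^m)'(\xi)-\alpha f(\xi)-\beta\xi f'(\xi)+\xi^{\sigma}f(\xi)^p=0.$$ The local behavior as $\xi\to0$ is meant up to second order, i.e. $f(\xi)^{-(p-m)}=K+\frac{p-m}{m(N+\sigma)(\sigma+2)}\xi^{\sigma+2}+o(\xi^{\sigma+2})$. For $\sigma\in(-1,0)$ this implies $f(0)>0$,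 $f'(0)=0$ and $u$ is a weak solution. For $\sigma\in(-2,-1]$ the condition $f'(0)=0$ fails, and by convention (abuse of language) functions $u$ of the form $u(x,t)=(T-t)^{-\alpha}f(\xi)$, $\xi=|x|(T-t)^{-\beta}$, with such profiles, which are supersolutions at $x=0$, are still called self-similar solutions. *)

(* Defs.v *)
From HB Require Import structures.
From mathcomp Require Import all_boot all_order all_algebra.
From mathcomp Require Import all_classical all_reals all_analysis.

Set Implicit Arguments.
Unset Strict Implicit.
Unset Printing Implicit Defensive.

Import Order.TTheory GRing.Theory Num.Theory.
Import numFieldNormedType.Exports.

Local Open Scope classical_set_scope.
Local Open Scope ring_scope.

Section LebesgueRn.
Context {R : realType}.
Local Notation RM := (measurableTypeR R).

Definition tcons n (z : RM * n.-tuple RM) : n.+1.-tuple RM :=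
  [the n.+1.-tuple RM of z.1 :: z.2].

Lemma measurable_tcons n : measurable_fun [set: RM * n.-tuple RM] (@tcons n).
Proof. exact: measurable_cons. Qed.

Definition lebesgue_cons n (mu : {sigma_finite_measure set (n.-tuple RM) -> \bar R}) :
    set (n.+1.-tuple RM) -> \bar R :=
  pushforward (@lebesgue_measure R \x mu)%E (@tcons n).

Section lebesgue_cons_measure.
Variables (n : nat) (mu : {sigma_finite_measure set (n.-tuple RM) -> \bar R}).

Let cons0 : lebesgue_cons mu set0 = 0%E.
Proof. by rewrite /lebesgue_cons /pushforward preimage_set0 measure0. Qed.

Let cons_ge0 A : (0 <= lebesgue_cons mu A)%E.
Proof. by rewrite /lebesgue_cons /pushforward; exact: measure_ge0. Qed.

Let cons_sigma_additive : semi_sigma_additive (lebesgue_cons mu).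
Proof.
have mt := @measurable_tcons n.
move=> F mF tF mUF; rewrite /lebesgue_cons /pushforward preimage_bigcup.
apply: measure_semi_sigma_additive.
- by move=> k; rewrite -[X in measurable X]setTI; exact: mt.
- apply/trivIsetP => /= i j _ _ ij; rewrite -preimage_setI.
  by move/trivIsetP : tF => /(_ _ _ _ _ ij) ->//; rewrite preimage_set0.
- by rewrite -preimage_bigcup -[X in measurable X]setTI; exact: mt.
Qed.

HB.instance Definition _ := isMeasure.Build _ _ _ (lebesgue_cons mu)
  cons0 cons_ge0 cons_sigma_additive.

Let cons_sigma_finite : sigma_finite setT (lebesgue_cons mu).
Proof.
have /sigma_finiteP[F [FT ndF Foo]] := sigma_finiteT (@lebesgue_measure R).
have /sigma_finiteP[G [GT ndG Goo]] := sigma_finiteT mu.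
pose g (t : n.+1.-tuple RM) : RM * n.-tuple RM := (thead t, [tuple of behead t]).
have mg : measurable_fun [set: n.+1.-tuple RM] g.
  apply/measurable_fun_pairP; split; first exact: measurable_tnth.
  exact: measurable_behead.
have tK : cancel (@tcons n) g.
  by move=> [x t]; congr pair; apply/val_inj.
exists (fun k => g @^-1` (F k `*` G k)).
  apply/esym/seteqP; split => // t _.
  have [k _ Fk] : (\bigcup_k F k) (thead t) by rewrite -FT.
  have [l _ Gl] : (\bigcup_k G k) [tuple of behead t] by rewrite -GT.
  exists (maxn k l) => //; split => /=.
    by move: Fk; exact/subsetPset/ndF/leq_maxl.
  by move: Gl; exact/subsetPset/ndG/leq_maxr.
move=> k; have [mFk Fkoo] := Foo k; have [mGk Gkoo] := Goo k; split.
  by rewrite -[X in measurable X]setTI; apply: mg => //; exact: measurableX.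
rewrite /lebesgue_cons /pushforward -comp_preimage.
rewrite (_ : g \o _ = id) ?preimage_id; last exact/funext.
by rewrite product_measure1E// lte_mul_pinfty// ge0_fin_numE.
Qed.

HB.instance Definition _ := Measure_isSigmaFinite.Build _ _ _
  (lebesgue_cons mu) cons_sigma_finite.

End lebesgue_cons_measure.

(* n-dimensional Lebesgue measure, by iterated products; lebesgue_tuple_box
   below characterizes it. *)
Fixpoint lebesgue_tuple n : {sigma_finite_measure set (n.-tuple RM) -> \bar R} :=
  match n with
  | 0 => dirac ([tuple] : 0.-tuple RM)
  | n'.+1 => lebesgue_cons (lebesgue_tuple n')
  end.

Lemma measurable_box n (A : 'I_n -> set RM) : (forall i, measurable (A i)) ->
  measurable [set t : n.-tuple RM | forall i, A i (tnth t i)].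
Proof.
move=> mA.
rewrite (_ : [set _ | _] = \bigcap_(i in [set: 'I_n]) ((@tnth n RM ^~ i) @^-1` A i)).
  apply: fin_bigcap_measurable => [|i _]; first exact: finite_finset.
  rewrite -[X in measurable X]setTI.
  exact: (@measurable_tnth _ RM n i measurableT (A i) (mA i)).
by apply/seteqP; split => [t At i _|t At i]; [exact: At|exact: (At i Logic.I)].
Qed.

Lemma lebesgue_tuple_box n (A : 'I_n -> set RM) : (forall i, measurable (A i)) ->
  lebesgue_tuple n [set t | forall i, A i (tnth t i)] =
  (\prod_(i < n) lebesgue_measure (A i))%E.
Proof.
elim: n A => [|n IHn] A mA /=.
  rewrite big_ord0 diracE mem_set//=; by case.
rewrite /lebesgue_cons /pushforward big_ord_recl -IHn//.
rewrite (_ : _ @^-1` _ = A ord0 `*` [set t | forall i, A (lift ord0 i) (tnth t i)]).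
  rewrite product_measure1E//.
  exact: (@measurable_box n (fun i => A (lift ord0 i))).
apply/seteqP; split => [[x t] /= H|[x t] [/= Ax At] i].
  split => [|i]; first by have := H ord0.
  by have := H (lift ord0 i); rewrite tnthS.
by case: (unliftP ord0 i) => [j|] ->; rewrite ?tnthS//.
Qed.

End LebesgueRn.

Section WeakSolution.
Context {R : realType}.
Variable N : nat.
Local Notation RM := (measurableTypeR R).
Local Notation spacetime := ('rV[R]_N * R)%type.
Implicit Types (u phi : spacetime -> R) (Q : set spacetime).

(* The library's norm on 'rV[R]_N is the sup norm, hence this one. *)
Definition enorm (x : 'rV[R]_N) : R := Num.sqrt (\sum_i x ord0 i ^+ 2).

(* Topology and derivatives live on 'rV[R]_N * R, the sigma-algebra and the
   measure on N.-tuple R * R. *)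
Definition spacetime_of (w : N.-tuple RM * RM) : spacetime :=
  (\row_i tnth w.1 i, w.2).

Definition spacetime_measure : set (N.-tuple RM * RM) -> \bar R :=
  (lebesgue_tuple N \x @lebesgue_measure R)%E.

Definition locally_L1 Q u := forall K : set spacetime, compact K -> K `<=` Q ->
  spacetime_measure.-integrable (spacetime_of @^-1` K)
    (EFin \o (u \o spacetime_of)).

Definition iter_derive phi (s : seq spacetime) : spacetime -> R :=
  foldr (fun v g z => 'D_v g z) phi s.

(* C^infinity: all iterated directional derivatives exist and are continuous. *)
Definition smooth phi := forall s : seq spacetime,
  continuous (iter_derive phi s) /\
  forall v z, derivable (iter_derive phi s) z v.

Definition test_function Q phi :=
  let supp := closure [set z | phi z != 0] in
  [/\ smooth phi, compact supp & supp `<=` Q].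

Definition dt phi : spacetime -> R := fun z => 'D_(0, 1) phi z.

Definition dx (i : 'I_N) phi : spacetime -> R :=
  fun z => 'D_(delta_mx ord0 i, 0) phi z.

Definition laplacian phi : spacetime -> R :=
  fun z => \sum_(i < N) dx i (dx i phi) z.

Variables m p sigma : R.

(* u_t = Delta u^m + |x|^sigma u^p tested against phi, with all derivatives
   moved to phi. *)
Definition weak_form u phi : \bar R :=
  (\int[spacetime_measure]_w
    let z := spacetime_of w in
    (u z * dt phi z + u z `^ m * laplacian phi z
     + enorm z.1 `^ sigma * u z `^ p * phi z)%:E)%E.

Definition weak_admissible Q u :=
  [/\ forall z, Q z -> 0 <= u z,
      locally_L1 Q u,
      locally_L1 Q (fun z => u z `^ m) &
      locally_L1 Q (fun z => enorm z.1 `^ sigma * u z `^ p)].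

Definition weak_solution Q u := weak_admissible Q u /\
  forall phi, test_function Q phi -> weak_form u phi = 0%E.

Definition weak_supersolution Q u := weak_admissible Q u /\
  forall phi, test_function Q phi -> (forall z, 0 <= phi z) ->
    (weak_form u phi <= 0)%E.

End WeakSolution.

Section SelfSimilar.
Context {R : realType}.
Variables (N : nat) (m p sigma : R).

Definition sobolev_exponent : \bar R :=
  if (3 <= N)%N then (m * (N%:R + 2 * sigma + 2) / (N%:R - 2))%:E else +oo%E.

Definition ss_L : R := sigma * (m - 1) + 2 * (p - 1).
Definition ss_alpha : R := (sigma + 2) / ss_L.
Definition ss_beta : R := (p - m) / ss_L.

Definition self_similar (T : R) (f : R -> R) (z : 'rV[R]_N * R) : R :=
  (T - z.2) `^ (- ss_alpha) * f (enorm z.1 * (T - z.2) `^ (- ss_beta)).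

Definition profile_equation (f : R -> R) (xi : R) :=
  let fm := fun x => f x `^ m in
  [/\ derivable f xi 1, derivable fm xi 1, derivable (derive1 fm) xi 1 &
      derive1 (derive1 fm) xi + (N%:R - 1) / xi * derive1 fm xi - ss_alpha * f xi
        - ss_beta * xi * derive1 f xi + xi `^ sigma * f xi `^ p = 0].

Definition profile (f : R -> R) :=
  [/\ {within `[0, +oo[, continuous f},
      forall xi, 0 <= xi -> 0 <= f xi &
      forall xi, 0 < xi -> 0 < f xi -> profile_equation f xi].

Definition strip (T : R) : set ('rV[R]_N * R) := [set z | 0 < z.2 < T].

Definition punctured_strip (T : R) : set ('rV[R]_N * R) :=
  [set z | z.1 != 0 /\ 0 < z.2 < T].

(* For sigma <= -1 the convention is that u need only be a supersolution at
   x = 0; it is still a solution away from x = 0. *)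
Definition self_similar_solution (T : R) (f : R -> R) :=
  let u := self_similar T f in
  [/\ profile f,
      -1 < sigma -> weak_solution m p sigma (strip T) u &
      sigma <= -1 -> weak_solution m p sigma (punctured_strip T) u /\
                     weak_supersolution m p sigma (strip T) u].

(* f ~ [K + c xi^(sigma+2)]^(-1/(p-m)) as xi -> 0, up to second order. *)
Definition behavior_at_0 (K : R) (f : R -> R) :=
  (f xi `^ (- (p - m)) -
    (K + (p - m) / (m * (N%:R + sigma) * (sigma + 2)) * xi `^ (sigma + 2)))
  / xi `^ (sigma + 2) @[xi --> 0^'+] --> (0 : R).

Definition behavior_at_infty (C : R) (f : R -> R) :=
  f xi / (C * xi `^ (- (sigma + 2) / (p - m))) @[xi --> +oo] --> (1 : R).

End SelfSimilar.

(* Main.v *)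
From HB Require Import structures.
Require Import Defs.
From mathcomp Require Import all_boot all_order all_algebra.
From mathcomp Require Import all_classical all_reals all_analysis.
From mathcomp Require Import measurable_realfun ring lra.

Set Implicit Arguments.
Unset Strict Implicit.
Unset Printing Implicit Defensive.

Import Order.TTheory GRing.Theory Num.Theory.
Import numFieldNormedType.Exports.

Local Open Scope classical_set_scope.
Local Open Scope ring_scope.

(* In logarithmic time t = ln xi, with u = ln f and w = u', the profile equation
   becomes a first-order system in which kap = sigma + 2 > 0 makes t = -oo a
   regular starting point: for each f(0) there is an orbit leaving with
   w ~ - e^(kap t) / (m (N + sigma)), found by a contraction weighted by
   e^(kap t), and this orbit carries the second-order expansion at xi = 0.
   Scaling turns f(0) into the coefficient eps >= 0 of the term
   X = eps e^(2 t - (m - 1) phi) / m. For eps large the orbit reaches w > 0; for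
   eps = 0 a Pohozaev identity (subcriticality) makes it fall below -M; both
   events are open and irreversible, so at a separating eps the orbit stays in
   [-M, 0] forever. Since X grows exponentially, this forces al + be w to decay
   exponentially, that is f ~ C xi^(- al / be).

   For the weak formulation, the integrand is the sum of the t-derivative of
   U phi and of the x_i-derivatives of U^m d_i phi - d_i(U^m) phi. By Fubini each
   is integrated first along its own line. The spatial flux is singular only on
   lines through x = 0; these form a null set unless N = 1, and for N = 1 one has
   sigma > -1, so d_i(U^m) vanishes continuously at 0. Everything is dominated by
   1 + |x|^sigma, integrable since sigma > -N. Hence the weak form vanishes also
   for sigma <= -1, which a fortiori gives a supersolution. *)

(** * Calculus and comparison from -oo *)

(** The parameter eps is a negative power of f(0), so eps = 0 stands for f(0) = +oo: there the terms
    coming from u_t drop out and the stationary equation for f^m, of Lane-Emden type, remains. This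
    is where the Sobolev exponent enters.

    Irreversibility of the two exits rests on a one-sided truncation of w in the nonlinear terms, to
    0 where w > 0 and to - M where w < - M. Above 0 the forcing is then al X - Z, which changes sign
    at most once because X / Z increases; below - M, both X (al + be w) and the remaining terms push
    down. Truncated orbits exist for all t and depend on eps in a Lipschitz way, so the separating
    eps can be a plain supremum; its orbit stays in [- M, 0], where the truncation does nothing.
    Near -oo the level M is replaced by a multiple of e^(kap t), as the contraction requires, and a
    barrier - B e^(kap t) shows that the orbit does not notice this either. *)

Section Calculus.
Context {R : realType}.
Implicit Types (f g : R -> R) (n : nat) (x d e : R).

(** One head symbol, with rules stated for explicit lambdas, so that [derive] below can proceed by
    syntactic matching; [ctsat] serves [continuity] in the same way. *)
Definition hasD f x d := is_derive x (1 : R) f d.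

Lemma hasD_eq f x d e : hasD f x d -> d = e -> hasD f x e.
Proof. by move=> + <-. Qed.

Lemma hasD_ext f g x d : f =1 g -> hasD f x d -> hasD g x d.
Proof. by move=> /funext ->. Qed.

Lemma hasD_near f g x d : (\forall z \near x, f z = g z) -> hasD f x d -> hasD g x d.
Proof. by move=> fg; apply: near_eq_is_derive => //; rewrite oner_neq0. Qed.

Lemma hasD_cst c x : hasD (fun=> c) x 0.
Proof. exact: is_derive_cst. Qed.

Lemma hasD_id x : hasD (fun t => t) x 1.
Proof. exact: is_derive_id. Qed.

Lemma hasDD f g x d e : hasD f x d -> hasD g x e -> hasD (fun t => f t + g t) x (d + e).
Proof. by move=> hf hg; exact: is_deriveD. Qed.

Lemma hasDN f x d : hasD f x d -> hasD (fun t => - f t) x (- d).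
Proof. by move=> hf; exact: is_deriveN. Qed.

Lemma hasDM f g x d e : hasD f x d -> hasD g x e ->
  hasD (fun t => f t * g t) x (f x * e + g x * d).
Proof. by move=> hf hg; exact: is_deriveM. Qed.

Lemma hasDX f n x d : hasD f x d -> hasD (fun t => f t ^+ n) x (n%:R * f x ^+ n.-1 * d).
Proof. by move=> hf; have := @is_deriveX _ _ f n x (1 : R) d hf; rewrite fctE. Qed.

Lemma hasD_comp f g x d e : hasD f (g x) d -> hasD g x e ->
  hasD (fun t => f (g t)) x (d * e).
Proof. by move=> hf hg; exact: is_derive1_comp. Qed.

Lemma hasD_exp g x e : hasD g x e -> hasD (fun t => expR (g t)) x (expR (g x) * e).
Proof. by move=> hg; apply: (hasD_comp _ hg); exact: is_derive_expR. Qed.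

Lemma hasD_ln g x e : 0 < g x -> hasD g x e -> hasD (fun t => ln (g t)) x ((g x)^-1 * e).
Proof. by move=> g0 hg; apply: (hasD_comp _ hg); exact: is_derive1_ln. Qed.

Lemma hasDV g x e : g x != 0 -> hasD g x e -> hasD (fun t => (g t)^-1) x (- (g x) ^- 2 * e).
Proof. by move=> g0 hg; exact: is_deriveV. Qed.

Lemma hasD_continuous f x d : hasD f x d -> {for x, continuous f}.
Proof. by case=> df _; apply: differentiable_continuous; exact/derivable1_diffP. Qed.

Definition ctsat f x := {for x, continuous f}.

Lemma ctsat_cst c x : ctsat (fun=> c) x.
Proof. exact: cst_continuous. Qed.

Lemma ctsat_id x : ctsat (fun t => t) x.
Proof. exact: cvg_id. Qed.

Lemma ctsatD f g x : ctsat f x -> ctsat g x -> ctsat (fun t => f t + g t) x.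
Proof. by move=> hf hg; exact: continuousD. Qed.

Lemma ctsatN f x : ctsat f x -> ctsat (fun t => - f t) x.
Proof. by move=> hf; exact: continuousN. Qed.

Lemma ctsatM f g x : ctsat f x -> ctsat g x -> ctsat (fun t => f t * g t) x.
Proof. by move=> hf hg; exact: continuousM. Qed.

Lemma ctsatX f n x : ctsat f x -> ctsat (fun t => f t ^+ n) x.
Proof.
move=> hf; elim: n => [|n IH]; first exact: ctsat_cst.
by have := ctsatM hf IH; under eq_fun do rewrite -exprS.
Qed.

Lemma ctsat_comp f g x : ctsat f (g x) -> ctsat g x -> ctsat (fun t => f (g t)) x.
Proof. by move=> hf hg; exact: continuous_comp hg hf. Qed.

Lemma ctsat_exp g x : ctsat g x -> ctsat (fun t => expR (g t)) x.
Proof. by move=> hg; apply: (@ctsat_comp (@expR R) g) => //; exact: continuous_expR. Qed.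

Lemma ctsatV g x : g x != 0 -> ctsat g x -> ctsat (fun t => (g t)^-1) x.
Proof. by move=> g0 hg; exact: continuousV. Qed.

Lemma ctsat_ln g x : 0 < g x -> ctsat g x -> ctsat (fun t => ln (g t)) x.
Proof. by move=> g0 hg; apply: (@ctsat_comp (@ln R) g) => //; exact: continuous_ln. Qed.

Lemma hasD_derive f x d : hasD f x d -> derivable f x 1 /\ derive1 f x = d.
Proof. by case=> df fd; split => //; rewrite derive1E. Qed.

Lemma hasD_MVT f f' a b : a <= b -> (forall t, a <= t <= b -> hasD f t (f' t)) ->
  exists2 c, a <= c <= b & f b - f a = f' c * (b - a).
Proof.
move=> ab hf; have [||c] := @MVT_segment R f f' a b ab.
- move=> t; rewrite in_itv/= => /andP[at_ tb]; apply: hf; lra.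
- apply: continuous_in_subspaceT => t; rewrite inE/= in_itv/= => tab.
  by apply: hasD_continuous; exact: hf.
- by rewrite in_itv/= => cab E; exists c.
Qed.

Lemma hasD_ge0 f f' a b : a <= b -> (forall t, a <= t <= b -> hasD f t (f' t)) ->
  (forall t, a <= t <= b -> 0 <= f' t) -> f a <= f b.
Proof.
move=> ab hf f0; have [c cab E] := hasD_MVT ab hf.
by rewrite -subr_ge0 E mulr_ge0 ?f0// subr_ge0.
Qed.

Lemma hasD_le f g f' g' a b : a <= b ->
  (forall t, a <= t <= b -> hasD f t (f' t)) ->
  (forall t, a <= t <= b -> hasD g t (g' t)) ->
  (forall t, a <= t <= b -> f' t <= g' t) -> f b - f a <= g b - g a.
Proof.
move=> ab hf hg fg.
have := @hasD_ge0 (fun t => g t + - f t) (fun t => g' t + - f' t) a b ab.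
move=> H; suff : g a - f a <= g b - f b by lra.
apply: H => t tab; first by apply: hasDD; [exact: hg|apply: hasDN; exact: hf].
by have := fg _ tab; lra.
Qed.

(** The integral is differentiable at points interior to its range, so its base point has to lie to
    the left of both [x] and 0. It is made to depend on [x]; normalizing at 0 makes this harmless,
    since differences of [P a] do not depend on [a]. *)
Lemma continuous_primitive f : continuous f -> exists F, forall x, hasD F x (f x).
Proof.
move=> cf.
pose P a x := (\int[@lebesgue_measure R]_(t in `[a, x]) f t)%R.
have P1 a x : a < x -> hasD (P a) x (f x).
  move=> ax; have xu : x < x + 1 by lra.
  have iF : (@lebesgue_measure R).-integrable `[a, x + 1] (EFin \o f).
    apply: continuous_compact_integrable; first exact: segment_compact.
    by apply: continuous_subspaceT.
  have [d1 d2] := continuous_FTC1_closed xu iF ax (cf x).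
  by apply: DeriveDef; [exact: d1|rewrite -derive1E].
have Pc a b x z : a < x -> a < z -> b < x -> b < z -> P a x - P a z = P b x - P b z.
  wlog xz : x z / x <= z => [H|] ax az bx bz.
    by case: (lerP x z) => [|/ltW] xz; [exact: H|have := H _ _ xz az ax bz bx; lra].
  have D c t : c < x -> x <= t <= z -> hasD (P c) t (f t).
    by move=> cx /andP[xt _]; apply: P1; lra.
  have h1 := @hasD_le (P a) (P b) f f x z xz (D a ^~ ax) (D b ^~ bx) (fun t _ => lexx _).
  have h2 := @hasD_le (P b) (P a) f f x z xz (D b ^~ bx) (D a ^~ ax) (fun t _ => lexx _).
  lra.
pose F x := P (Num.min x 0 - 1) x - P (Num.min x 0 - 1) 0.
exists F => x.
pose a := Num.min x 0 - 2.
apply: (@hasD_near (fun z => P a z + - P a 0)).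
  have : \forall z \near x, a + 1 < z.
    by apply: lt_nbhsr; rewrite /a; case: (leP x 0); lra.
  apply: filterS => z az; rewrite /F.
  by apply: Pc; rewrite /a in az *; move: az; case: (leP x 0); case: (leP z 0); lra.
rewrite -[f x]addr0; apply: hasDD; last exact: hasD_cst.
by apply: P1; rewrite /a; case: (leP x 0); lra.
Qed.

End Calculus.

Ltac derive_step :=
  match goal with
  | |- hasD (fun _ => ?c) _ _ => exact: hasD_cst
  | |- hasD (fun x => x) _ _ => exact: hasD_id
  | H : forall t, hasD ?f t _ |- hasD ?f _ _ => exact: H
  | H : forall t, hasD ?f t _ |- hasD (fun t => ?f t) _ _ => exact: H
  | H : hasD _ _ _ |- hasD _ _ _ => exact: H
  | |- hasD (fun t => @?f t + @?g t) _ _ => apply: (@hasDD _ f g)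
  | |- hasD (fun t => - @?f t) _ _ => apply: (@hasDN _ f)
  | |- hasD (fun t => @?f t * @?g t) _ _ => apply: (@hasDM _ f g)
  | |- hasD (fun t => @?f t ^+ ?n) _ _ => apply: (@hasDX _ f n)
  | |- hasD (fun t => expR (@?f t)) _ _ => apply: (@hasD_exp _ f)
  end.
(* Leaves the equation between the computed and the stated derivative. *)
Ltac derive := eapply hasD_eq; [repeat derive_step | cbn beta].

Ltac continuity_step :=
  match goal with
  | |- ctsat (fun _ => ?c) _ => exact: ctsat_cst
  | |- ctsat (fun x => x) _ => exact: ctsat_id
  | H : continuous ?f |- ctsat ?f _ => exact: H
  | H : continuous ?f |- ctsat (fun t => ?f t) _ => exact: H
  | H : ctsat _ _ |- ctsat _ _ => exact: H
  | |- ctsat (fun t => @?f t + @?g t) _ => apply: (@ctsatD _ f g)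
  | |- ctsat (fun t => - @?f t) _ => apply: (@ctsatN _ f)
  | |- ctsat (fun t => @?f t * @?g t) _ => apply: (@ctsatM _ f g)
  | |- ctsat (fun t => @?f t ^+ ?n) _ => apply: (@ctsatX _ f n)
  | |- ctsat (fun t => expR (@?f t)) _ => apply: (@ctsat_exp _ f)
  end.
Ltac continuity := repeat continuity_step.
Ltac nonneg :=
  repeat first [ assumption | (apply: ltW; assumption) | exact: expR_ge0 | exact: ler01
    | exact: ler0n | exact: normr_ge0 | exact: sqr_ge0 | apply: addr_ge0
    | apply: mulr_ge0 | apply: divr_ge0 | rewrite invr_ge0 ].

(** * Comparison and primitives from -oo *)

Section MinusInfinity.
Context {R : realType}.
Implicit Types (F G g : R -> R).

Lemma expR_Ny (k : R) : 0 < k -> expR (k * t) @[t --> -oo] --> (0 : R).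
Proof.
move=> k0; apply/cvgrPdist_lt => e e0; near=> t.
rewrite sub0r normrN gtr0_norm ?expR_gt0//.
have h : 1 - k * t <= expR (- (k * t)) by have := expR_ge1Dx (- (k * t)); lra.
have t0 : t < - (e^-1 / k) by near: t; apply: nbhs_ninfty_lt; rewrite num_real.
have h2 : e^-1 < - (k * t) by rewrite -mulrN mulrC -ltr_pdivrMr//; lra.
rewrite -[expR _]invrK -expRN -[e]invrK ltf_pV2 ?posrE ?expR_gt0 ?invr_gt0//; lra.
Unshelve. all: by end_near. Qed.

Lemma squeezeNy F G (b : R) : (forall t, t <= b -> `|F t| <= G t) ->
  G t @[t --> -oo] --> (0 : R) -> F t @[t --> -oo] --> (0 : R).
Proof.
move=> FG /cvgrPdist_lt G0; apply/cvgrPdist_lt => e e0.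
have := G0 _ e0; apply: filter_app; near=> t.
rewrite !sub0r !normrN; apply: le_lt_trans.
have tb : t <= b by near: t; apply: nbhs_ninfty_le; rewrite num_real.
by rewrite (le_trans (FG _ tb))// ler_norm.
Unshelve. all: by end_near. Qed.

(** A negative value at [b] would, by monotonicity, keep [F] away from 0 all the way to -oo. *)
Lemma cmpNy F F' (b : R) : (forall t, t <= b -> hasD F t (F' t)) ->
  (forall t, t <= b -> 0 <= F' t) -> F t @[t --> -oo] --> (0 : R) -> 0 <= F b.
Proof.
move=> dF F0 /cvgrPdist_lt H; rewrite leNgt; apply/negP => Fb.
have e0 : 0 < - F b by lra.
have {}H := H _ e0; near (@ninfty_nbhs R) => t.
have tb : t <= b by near: t; apply: nbhs_ninfty_le; rewrite num_real.
have Ftb : F t <= F b.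
  by apply: (@hasD_ge0 _ F F' t b tb) => s /andP[_ sb]; [exact: dF|exact: F0].
have : `|0 - F t| < - F b by near: t.
by rewrite sub0r => Ht; have := ler_norm (- F t); lra.
Unshelve. all: by end_near. Qed.

Lemma cmpNy_le F G F' G' (b : R) :
  (forall t, t <= b -> hasD F t (F' t)) ->
  (forall t, t <= b -> hasD G t (G' t)) ->
  (forall t, t <= b -> F' t <= G' t) ->
  F t @[t --> -oo] --> (0 : R) -> G t @[t --> -oo] --> (0 : R) -> F b <= G b.
Proof.
move=> dF dG FG F0 G0.
rewrite -subr_ge0; apply: (@cmpNy (fun t => G t + - F t) (fun t => G' t + - F' t)) => [t tb|t tb|].
- by apply: hasDD; [exact: dG|apply: hasDN; exact: dF].
- by have := FG t tb; lra.
have -> : (0 : R) = 0 + - 0 by rewrite subr0.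
by apply: cvgD => //; exact: cvgN.
Qed.

(** Bounds an integral over (-oo, b] without improper integrals: the estimates below are proved by
    exhibiting [G], an explicit primitive of the bound that vanishes at -oo. *)
Lemma cmpNy_norm F G F' G' (b : R) :
  (forall t, t <= b -> hasD F t (F' t)) ->
  (forall t, t <= b -> hasD G t (G' t)) ->
  (forall t, t <= b -> `|F' t| <= G' t) ->
  F t @[t --> -oo] --> (0 : R) -> G t @[t --> -oo] --> (0 : R) -> `|F b| <= G b.
Proof.
move=> dF dG FG F0 G0; rewrite ler_norml; apply/andP; split.
  rewrite lerNl.
  apply: (@cmpNy_le (fun t => - F t) G (fun t => - F' t) G') => // [t tb|t tb|].
  - by apply: hasDN; exact: dF.
  - by have := FG t tb; rewrite ler_norml => /andP[h1 h2]; lra.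
  - by rewrite -[X in _ --> X]oppr0; exact: cvgN.
apply: (@cmpNy_le F G F' G') => // t tb.
by have := FG t tb; rewrite ler_norml => /andP[h1 h2]; lra.
Qed.

Lemma cvg0B F G : F t @[t --> -oo] --> (0 : R) -> G t @[t --> -oo] --> (0 : R) ->
  F t - G t @[t --> -oo] --> (0 : R).
Proof. by move=> F0 G0; rewrite -[X in _ --> X](subrr (0 : R)); exact: cvgB. Qed.

Lemma hasD_scaled_exp (c k t : R) : hasD (fun s => c * expR (k * s)) t (c * (expR (k * t) * k)).
Proof.
by derive; ring.
Qed.

Lemma scaled_expR_Ny (c k : R) : 0 < k -> c * expR (k * t) @[t --> -oo] --> (0 : R).
Proof. by move=> k0; rewrite -[X in _ --> X](mulr0 c); apply: cvgM; [exact: cvg_cst|exact: expR_Ny]. Qed.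

(** Adding [E], a primitive of the bound, to any primitive [F] of [g] gives a function [H] that is
    nondecreasing and bounded below on (-oo, b]. Its infimum [L] is the limit of [F] at -oo, with |F
    - L| <= E, and is the constant to subtract. *)
Lemma primitiveNy g (k : R) : 0 < k -> continuous g ->
  (exists C b : R, forall t, t <= b -> `|g t| <= C * expR (k * t)) ->
  exists2 G, forall t, hasD G t (g t) & G t @[t --> -oo] --> (0 : R).
Proof.
move=> k0 cg [C [b gC]].
have [F dF] := continuous_primitive cg.
pose E t := (C / k) * expR (k * t).
have dE t : hasD E t (C * expR (k * t)).
  by apply: (hasD_eq (hasD_scaled_exp _ _ _)); field; rewrite gt_eqF.
have C0 : 0 <= C.
  by have := le_trans (normr_ge0 _) (gC b (lexx _)); rewrite pmulr_lge0 ?expR_gt0.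
have E0 t : 0 <= E t by rewrite mulr_ge0 ?expR_ge0 ?divr_ge0 // ltW.
pose H t := F t + E t.
have Hmon s t : s <= t -> t <= b -> H s <= H t.
  move=> st tb; apply: (@hasD_ge0 _ H (fun x => g x + C * expR (k * x))) => // x xst.
    by apply: hasDD.
  have /gC : x <= b by lra.
  by rewrite ler_norml => /andP[h1 h2]; lra.
have Fmon s t : s <= t -> t <= b -> F t - F s <= E t - E s.
  move=> st tb; apply: (@hasD_le _ F E g (fun t => C * expR (k * t)) s t st) => x xst //.
  have /gC : x <= b by lra.
  by rewrite ler_norml => /andP[h1 h2]; lra.
pose A := [set H t | t in [set t | t <= b]].
have A0 : A !=set0 by exists (H b), b => //=.
have Alb : has_lbound A.
  exists (F b - E b) => _ [t /= tb <-].
  by have := Fmon t b tb (lexx _); have := E0 t; rewrite /H; lra.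
pose L := inf A.
exists (fun t => F t + - L).
  by move=> t; apply: (hasD_eq (hasDD (dF t) (hasD_cst _ _))); rewrite addr0.
apply: (@squeezeNy _ E b); last exact: scaled_expR_Ny.
move=> t tb; rewrite ler_norml; apply/andP; split.
  have : L <= H t by apply: ge_inf => //; exists t.
  by rewrite /H; lra.
rewrite lerBlDr; apply/ler_addgt0Pl => e e0.
have [_ [s /= sb <-] Hs] := inf_adherent e0 (conj A0 Alb).
have [st|/ltW ts] := lerP s t.
  by have := Fmon s t st tb; have := E0 s; rewrite -/L /H in Hs *; lra.
by have := Hmon t s ts sb; have := E0 s; have := E0 t; rewrite -/L /H in Hs *; lra.
Qed.

End MinusInfinity.

(** * The truncated integral equation *)

Section Clamp.
Context {R : realType}.
Implicit Types (u y : R).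

(** Truncation to [- u, 0]. Positive values go to 0, so that where an orbit is positive the
    truncated terms no longer depend on its value. *)
Definition clamp u y : R := Num.max (- u) (Num.min y 0).

Lemma clamp_bounds u y : 0 <= u -> - u <= clamp u y <= 0.
Proof. by move=> u0; rewrite le_max lexx/= ge_max ge_min lexx orbT andbT; lra. Qed.

Lemma clamp_id u y : - u <= y -> y <= 0 -> clamp u y = y.
Proof. by move=> uy y0; rewrite /clamp (min_idPl y0) (max_idPr uy). Qed.

Lemma clamp_ge0 u y : 0 <= u -> 0 <= y -> clamp u y = 0.
Proof. by move=> u0 y0; rewrite /clamp (min_idPr y0) max_r//; lra. Qed.

Lemma clamp_norm u y : 0 <= u -> `|clamp u y| <= u.
Proof. by move=> u0; rewrite ler_norml; have /andP[? ?] := clamp_bounds y u0; lra. Qed.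

Lemma clamp_ge u y b : 0 <= u -> 0 <= b -> - b <= y -> - b <= clamp u y.
Proof. by move=> u0 b0 by_; rewrite /clamp le_max le_min by_/= oppr_le0 b0 orbT. Qed.

Lemma clamp_lip u y z : `|clamp u y - clamp u z| <= `|y - z|.
Proof.
rewrite ler_norml /clamp; have := ler_norm (y - z); have := ler_norm (- (y - z)).
rewrite normrN; move: `|_| => d.
by case: (leP (- u) (Num.min y 0)); case: (leP (- u) (Num.min z 0));
  case: (leP y 0); case: (leP z 0); lra.
Qed.

Lemma expR_lip (a b c : R) : a <= c -> b <= c -> `|expR a - expR b| <= expR c * `|a - b|.
Proof.
wlog ab : a b / b <= a => [H|] ac bc.
  by case: (leP b a) => [|/ltW] ab; [exact: H|rewrite distrC [`|a - b|]distrC; exact: H].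
rewrite !ger0_norm ?subr_ge0 ?ler_expR//.
have [d dab ->] := hasD_MVT ab (fun t _ => @is_derive_expR R t).
rewrite ler_wpM2r ?subr_ge0// ler_expR; lra.
Qed.

End Clamp.

Lemma natr_le_exp2 {R : realType} k : k%:R <= 2 ^+ k :> R.
Proof. by rewrite -natrX ler_nat ltnW// ltn_expl. Qed.

Lemma le_addgeo {R : realType} (a b c : R) : (forall k, a <= b + c / 2 ^+ k) -> a <= b.
Proof.
move=> h; rewrite leNgt; apply/negP => ab.
have ab0 : 0 < a - b by rewrite subr_gt0.
have [c0|/ltW c0] := leP c 0.
  by have := h 0%N; rewrite expr0 divr1; lra.
pose k := Num.truncn (c / (a - b)); have k1 := truncnS_gt (c / (a - b)).
have := h k.+1; rewrite -lerBlDl ler_pdivlMr ?exprn_gt0// => /le_lt_trans.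
have : c < (a - b) * 2 ^+ k.+1.
  rewrite -ltr_pdivrMl//= mulrC (lt_le_trans k1)//; exact: natr_le_exp2.
by move=> h1 /(_ _ h1); rewrite ltxx.
Qed.

(* A sequence with geometrically decaying increments is squeezed between the
   monotone sequences [u k -/+ 2 B / 2 ^ k]. *)
Lemma geometric_limit {R : realType} (u : nat -> R) (B : R) :
  (forall k, `|u k.+1 - u k| <= B / 2 ^+ k) -> exists l, forall k, `|l - u k| <= 2 * B / 2 ^+ k.
Proof.
move=> hu.
have p0 k : 0 < 2 ^+ k :> R by rewrite exprn_gt0.
have B0 : 0 <= B by have := le_trans (normr_ge0 _) (hu 0%N); rewrite expr0 divr1.
have v0 k : 0 <= B / 2 ^+ k by rewrite divr_ge0// ltW.
have vS k : 2 * B / 2 ^+ k.+1 = B / 2 ^+ k by rewrite exprS; field; rewrite gt_eqF.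
have hu' k : - (B / 2 ^+ k) <= u k.+1 - u k <= B / 2 ^+ k by rewrite -ler_norml.
pose a k := u k - 2 * B / 2 ^+ k; pose b k := u k + 2 * B / 2 ^+ k.
have an : {homo a : i j / (i <= j)%N >-> i <= j}.
  apply: (@homo_leq R a (fun x y => x <= y)) => [x //|y x z|k]; first exact: le_trans.
  by rewrite /a vS; have /andP[] := hu' k; rewrite -!mulrA; lra.
have bn : {homo b : i j / (i <= j)%N >-> j <= i}.
  apply: (@homo_leq R b (fun x y => y <= x)) => [x //|y x z h1 h2|k]; first exact: le_trans h1.
  by rewrite /b vS; have /andP[] := hu' k; rewrite -!mulrA; lra.
have ab i j : a i <= b j.
  apply: le_trans (an _ _ (leq_maxl i j)) _; apply: le_trans _ (bn _ _ (leq_maxr i j)).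
  by rewrite /a /b; have := v0 (maxn i j); rewrite -!mulrA; lra.
have hs : has_sup (range a) by split; [exists (a 0%N), 0%N|exists (b 0%N) => _ [i _ <-]].
exists (sup (range a)) => k; rewrite ler_norml; apply/andP; split.
  have : a k <= sup (range a) by apply: sup_upper_bound => //; exists k.
  by rewrite /a; lra.
have : sup (range a) <= b k by apply: ge_sup; [exists (a 0%N), 0%N|move=> _ [i _ <-]].
by rewrite /b; lra.
Qed.

(** * The Duhamel operator and its fixed points *)

Section VolterraOperator.
Context {R : realType}.
Variables n kap m p al be M s0 : R.
Hypothesis kap0 : 0 < kap.
Hypothesis kap2 : kap < 2.
Hypothesis nk0 : 0 < n + kap.
Hypothesis m1 : 1 < m.
Hypothesis mp : m < p.
Hypothesis al0 : 0 < al.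
Hypothesis be0 : 0 < be.
Hypothesis M0 : 0 < M.
Hypothesis s00 : 0 < s0.
Implicit Types (y phi : R -> R) (eps t S E : R).

Let c1 := M / s0.
Let c10 : 0 < c1. Proof. exact: divr_gt0. Qed.

(* Truncation level: [M], reduced to [M e^(kap t) / s0] as t -> -oo so that the
   truncated nonlinearity stays contractive there. *)
Definition mu t := Num.min M (c1 * expR (kap * t)).

Lemma mu_ge0 t : 0 <= mu t.
Proof. by rewrite le_min (ltW M0) mulr_ge0 ?expR_ge0// ltW. Qed.

Lemma mu_leM t : mu t <= M. Proof. by rewrite ge_min lexx. Qed.

Lemma mu_le t : mu t <= c1 * expR (kap * t). Proof. by rewrite ge_min lexx orbT. Qed.

Definition yc y t := clamp (mu t) (y t).

Lemma yc_bounds y t : - mu t <= yc y t <= 0.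
Proof. exact/clamp_bounds/mu_ge0. Qed.

Lemma yc_norm y t : `|yc y t| <= c1 * expR (kap * t).
Proof. exact: le_trans (clamp_norm _ (mu_ge0 _)) (mu_le _). Qed.

Lemma continuous_expM (k : R) : continuous (fun t : R => expR (k * t)).
Proof.
move=> t; apply: (@continuous_comp _ _ _ (fun t => k * t) (@expR R)); last exact: continuous_expR.
by apply: continuousM; [exact: cst_continuous|exact: cvg_id].
Qed.

Lemma continuous_yc y : continuous y -> continuous (yc y).
Proof.
move=> cy t.
apply: (@continuous_max R R (fun t => - mu t) (fun t => Num.min (y t) 0)).
  apply: (@continuousN _ _ _ mu); apply: (@continuous_min R R (fun=> M)); first exact: cst_continuous.
  by apply: continuousM; [exact: cst_continuous|exact: continuous_expM].
by apply: (@continuous_min R R y (fun=> 0)); [exact: cy|exact: cst_continuous].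
Qed.

(** The primitive that vanishes at -oo, made total with the zero function as default; [primP] gives
    conditions under which it exists. *)
Definition prim (g : R -> R) : R -> R :=
  xget (fun=> 0) [set G | (forall t, hasD G t (g t)) /\ G t @[t --> -oo] --> (0 : R)].

Lemma primP g (k : R) : 0 < k -> continuous g ->
  (exists C b : R, forall t, t <= b -> `|g t| <= C * expR (k * t)) ->
  (forall t, hasD (prim g) t (g t)) /\ prim g t @[t --> -oo] --> (0 : R).
Proof.
move=> k0 cg gC; have [G dG G0] := primitiveNy k0 cg gC.
by apply: (@xgetPex _ (fun=> 0)
  [set G | (forall t, hasD G t (g t)) /\ G t @[t --> -oo] --> (0 : R)]); exists G.
Qed.

Definition Phi y := prim (yc y).

Lemma PhiP y : continuous y ->
  (forall t, hasD (Phi y) t (yc y t)) /\ Phi y t @[t --> -oo] --> (0 : R).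
Proof.
move=> cy; apply: (primP kap0); first exact: continuous_yc.
by exists c1, 0 => t _; exact: yc_norm.
Qed.

Lemma Phi_le0 y t : continuous y -> Phi y t <= 0.
Proof.
move=> /PhiP[d l]; apply: (@cmpNy_le _ (Phi y) (fun=> 0) (yc y) (fun=> 0)) => // [s _|s _|].
- exact: hasD_cst.
- by have /andP[] := yc_bounds y s.
- exact: cvg_cst.
Qed.

Lemma Phi_ge y t : continuous y -> - (c1 / kap * expR (kap * t)) <= Phi y t.
Proof.
move=> /PhiP[d l].
have : `|Phi y t| <= c1 / kap * expR (kap * t).
  apply: (@cmpNy_norm _ (Phi y) (fun t => c1 / kap * expR (kap * t)) (yc y) (fun t => c1 * expR (kap * t))) => // [s _|s _|].
  - by apply: (hasD_eq (hasD_scaled_exp _ _ _)); field; rewrite gt_eqF.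
  - exact: yc_norm.
  - exact: scaled_expR_Ny.
by rewrite ler_norml => /andP[].
Qed.

(* With phi = ln (f / f 0) and y = phi', the profile equation reads, in
   logarithmic time, y' = - n y - m y ^ 2 + X (al + be y) - Z, where [eps] is a
   power of f 0 removed by scaling. [T] is its Duhamel operator once y is
   truncated in the nonlinear terms. *)
Definition X eps phi t := eps * expR (2 * t - (m - 1) * phi t) / m.
Definition Z phi t := expR (kap * t + (p - m) * phi t) / m.
Definition Gam eps y t :=
  - m * yc y t ^+ 2 + X eps (Phi y) t * (al + be * yc y t) - Z (Phi y) t.
Definition T eps y t := expR (- n * t) * prim (fun r => expR (n * r) * Gam eps y r) t.

Lemma hasD_cont_all (f f' : R -> R) : (forall t, hasD f t (f' t)) -> continuous f.
Proof. by move=> h t; exact: hasD_continuous (h t). Qed.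

Lemma continuous_Gam eps y : continuous y -> continuous (Gam eps y).
Proof.
move=> cy t; have cyc := continuous_yc cy.
have cP : continuous (Phi y) by have [d _] := PhiP cy; exact: hasD_cont_all d.
by change (ctsat (Gam eps y) t); rewrite /Gam /X /Z; continuity.
Qed.

(** On t <= S, [Q S] bounds [expR (- (m - 1) * Phi y t)] and [P S] bounds the ratio of e^(2 t) to
    e^(kap t); the latter uses kap < 2. *)
Let Q S := expR ((m - 1) * (c1 / kap * expR (kap * S))).
Let P S := expR ((2 - kap) * S).

Lemma exp2_le S t : t <= S -> expR (2 * t) <= P S * expR (kap * t).
Proof.
move=> tS; rewrite /P -expRD ler_expR.
have := ler_wpM2l (_ : 0 <= 2 - kap) tS; rewrite subr_ge0 (ltW kap2) => /(_ isT); lra.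
Qed.

Lemma expPhi_le S y t : continuous y -> t <= S -> expR (- (m - 1) * Phi y t) <= Q S.
Proof.
move=> cy tS; rewrite ler_expR mulNr -mulrN ler_wpM2l ?subr_ge0 ?(ltW m1)//.
have := Phi_ge t cy; rewrite lerNl => /le_trans; apply.
apply: ler_wpM2l; first by apply: divr_ge0; exact: ltW.
by rewrite ler_expR; apply: ler_wpM2l => //; exact: ltW.
Qed.

Lemma X_split eps phi t : X eps phi t = eps / m * (expR (2 * t) * expR (- (m - 1) * phi t)).
Proof. by rewrite /X -expRD mulrAC mulNr. Qed.

Lemma Z_split phi t : Z phi t = expR (kap * t) * (expR ((p - m) * phi t) / m).
Proof. by rewrite /Z expRD mulrA. Qed.

(** Every term carries a factor e^(kap t): the square because [yc] is itself of that order, the X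
    term because kap < 2, and Z because [Phi] is nonpositive. *)
Lemma Gam_bound S E : 0 <= E -> exists2 C, 0 <= C & forall eps y t, continuous y ->
  0 <= eps <= E -> t <= S -> `|Gam eps y t| <= C * expR (kap * t).
Proof.
move=> E0; have m0 : 0 < m by exact: lt_trans m1.
pose C := m * (M * c1) + E / m * (P S * Q S) * (al + be * M) + m^-1.
have aM0 : 0 <= al + be * M by nonneg.
exists C => [|eps y t cy /andP[e0 eE] tS]; first by rewrite /C /P /Q; nonneg.
have /andP[yl yu] := yc_bounds y t; have muM := mu_leM t; have mul := mu_le t.
have e_ge0 := expR_ge0 (kap * t).
rewrite /Gam /C 2!mulrDl; apply: le_trans (ler_normB _ _) _; apply: lerD.
  apply: le_trans (ler_normD _ _) _; apply: lerD.
    rewrite normrM normrN (gtr0_norm m0) -mulrA; apply: ler_wpM2l; first by nonneg.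
    rewrite normrX expr2 -mulrA; apply: ler_pM; rewrite ?yc_norm//.
    by rewrite (le_trans (clamp_norm _ (mu_ge0 _)))// mu_leM.
  rewrite normrM X_split [leRHS]mulrAC; apply: ler_pM; rewrite ?normr_ge0//.
    rewrite ger0_norm; last by nonneg.
    rewrite -[leRHS]mulrA; apply: ler_pM; try nonneg.
      by apply: ler_wpM2r; nonneg.
    rewrite [leRHS]mulrAC; apply: ler_pM; try nonneg; [exact: exp2_le|exact: expPhi_le].
  have b1 : `|be * yc y t| <= be * M.
    rewrite normrM (gtr0_norm be0); apply: ler_wpM2l; first by nonneg.
    by rewrite (le_trans (clamp_norm _ (mu_ge0 _)))// mu_leM.
  by rewrite (le_trans (ler_normD _ _))// (gtr0_norm al0) lerD2l.
rewrite Z_split ger0_norm; last by nonneg.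
rewrite mulrC; apply: ler_wpM2r => //; rewrite ler_piMl//; first by nonneg.
rewrite -[X in _ <= X]expR0 ler_expR mulr_ge0_le0 ?subr_ge0 ?(ltW mp)//.
exact: Phi_le0.
Qed.

(** As [Gam] is O(e^(kap t)), the Duhamel integrand is O(e^((n + kap) t)); n may be negative, and n
    + kap > 0 is what makes the integral from -oo converge. The last clause is the initial condition
    at -oo. *)
Lemma TP eps y : 0 <= eps -> continuous y ->
  [/\ forall t, hasD (T eps y) t (- n * T eps y t + Gam eps y t),
      forall t, hasD (fun t => expR (n * t) * T eps y t) t (expR (n * t) * Gam eps y t) &
      expR (n * t) * T eps y t @[t --> -oo] --> (0 : R)].
Proof.
move=> e0 cy; have [C C0 hC] := Gam_bound 0 e0.
pose g r := expR (n * r) * Gam eps y r.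
have cg : continuous g.
  move=> t; have cG := @continuous_Gam eps y cy; change (ctsat g t); rewrite /g; continuity.
have [] := @primP g (n + kap) nk0 cg.
  exists C, 0 => t t0; rewrite /g normrM gtr0_norm ?expR_gt0//.
  by rewrite mulrDl expRD mulrCA ler_wpM2l ?expR_ge0// hC// e0 lexx.
move=> dg g0.
have TE t : expR (n * t) * T eps y t = prim g t.
  by rewrite /T mulrA -expRD mulNr subrr expR0 mul1r.
split.
- move=> t; rewrite /T -/g; derive.
  rewrite /g (mulrA (expR (- n * t)) (expR (n * t))) -expRD.
  by rewrite mulNr addNr expR0; ring.
- by move=> t; apply: hasD_ext (dg t) => s.
- by under eq_fun do rewrite TE.
Qed.

#[local] Opaque T prim.

Lemma continuous_T eps y : 0 <= eps -> continuous y -> continuous (T eps y).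
Proof. by move=> e0 cy; have [d _ _] := TP e0 cy; exact: hasD_cont_all d. Qed.

Lemma T_bound S E : 0 <= E -> exists2 C, 0 <= C & forall eps y t, continuous y ->
  0 <= eps <= E -> t <= S -> `|T eps y t| <= C * expR (kap * t).
Proof.
move=> E0; have [C C0 hC] := Gam_bound S E0.
exists (C / (n + kap)) => [|eps y t cy /andP[e0 eE] tS]; first by rewrite divr_ge0// ltW.
have [_ d l] := TP e0 cy.
have : `|expR (n * t) * T eps y t| <= C / (n + kap) * expR ((n + kap) * t).
  apply: (@cmpNy_norm _ (fun t => expR (n * t) * T eps y t)
    (fun t => C / (n + kap) * expR ((n + kap) * t)) (fun t => expR (n * t) * Gam eps y t)
    (fun t => C * expR ((n + kap) * t))) => // [s _|s st|].
  - by apply: (hasD_eq (hasD_scaled_exp _ _ _)); field; rewrite gt_eqF.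
  - rewrite normrM gtr0_norm ?expR_gt0// mulrDl expRD mulrCA ler_wpM2l ?expR_ge0//.
    by apply: hC; rewrite ?e0// (le_trans st).
  - exact: scaled_expR_Ny.
by rewrite normrM gtr0_norm ?expR_gt0// mulrDl expRD mulrCA ler_pM2l// expR_gt0.
Qed.

(** Weight of the contraction norm. The first factor is the decay of orbits at -oo; the second is a
    Bielecki-type weight whose logarithmic derivative, Lam kap e^(kap t), has the shape of the
    Lipschitz constant of [Gam], so that a large [Lam] gives a contraction without shortening the
    interval. *)
Definition om Lam t := expR (kap * t) * expR (Lam * expR (kap * t)).

(** A primitive of [om] is [expR (Lam * expR (kap * t))] divided by kap Lam, so integration gains
    the small factor 1 / (kap Lam). The comparison uses this primitive minus its limit at -oo. *)
Lemma Phi_lip y1 y2 D Lam S : continuous y1 -> continuous y2 -> 0 < Lam -> 0 <= D ->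
  (forall t, t <= S -> `|y1 t - y2 t| <= D * om Lam t) ->
  forall t, t <= S ->
  `|Phi y1 t - Phi y2 t| <= D / (kap * Lam) * expR (Lam * expR (kap * t)).
Proof.
move=> c1' c2' L0 D0 hy t tS.
have [d1 l1] := PhiP c1'; have [d2 l2] := PhiP c2'.
have K0 : 0 <= D / (kap * Lam) by nonneg.
suff : `|Phi y1 t - Phi y2 t| <= D / (kap * Lam) * (expR (Lam * expR (kap * t)) - 1).
  by move=> /le_trans; apply; rewrite ler_wpM2l// gerBl.
apply: (@cmpNy_norm _ (fun t => Phi y1 t - Phi y2 t)
  (fun t => D / (kap * Lam) * (expR (Lam * expR (kap * t)) - 1))
  (fun t => yc y1 t - yc y2 t) (fun t => D * om Lam t)).
- by move=> s _; derive.
- by move=> s _; derive; rewrite /om; field; rewrite !gt_eqF.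
- move=> s st; rewrite (le_trans (clamp_lip _ _ _))//; apply: hy; exact: le_trans tS.
- exact: cvg0B l1 l2.
- apply: (@squeezeNy _ _ (fun t => D / (kap * Lam) * (expR Lam * Lam) * expR (kap * t)) 0);
    last exact: scaled_expR_Ny.
  move=> s s0x; rewrite normrM (ger0_norm K0) -[leRHS]mulrA; apply: ler_wpM2l => //.
  have := @expR_lip _ (Lam * expR (kap * s)) 0 Lam; rewrite expR0 subr0 => h.
  have e0 : 0 <= expR (kap * s) by nonneg.
  have es : Lam * expR (kap * s) <= Lam.
    by rewrite ler_piMr ?(ltW L0)// -[leRHS]expR0 ler_expR mulr_ge0_le0 ?(ltW kap0).
  apply: le_trans (h es (ltW L0)) _.
  by rewrite ger0_norm ?mulrA//; nonneg.
Qed.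

(** The Lipschitz constant keeps the factor e^(kap t), for the same reasons as in [Gam_bound]. The
    increments [d1] of [y] and [d2] of [Phi y] are kept apart because they are later estimated with
    different weights. *)
Lemma Gam_lip S E : 0 <= E -> exists2 L, 0 <= L & forall e1 e2 y1 y2 t d1 d2,
  continuous y1 -> continuous y2 -> 0 <= e1 <= E -> 0 <= e2 <= E -> t <= S ->
  `|y1 t - y2 t| <= d1 -> `|Phi y1 t - Phi y2 t| <= d2 ->
  `|Gam e1 y1 t - Gam e2 y2 t| <= L * expR (kap * t) * (d1 + d2 + `|e1 - e2|).
Proof.
move=> E0; have m0 : 0 < m by exact: lt_trans m1.
have m10 : 0 < m - 1 by rewrite subr_gt0.
have pm0 : 0 < p - m by rewrite subr_gt0.
pose a := al + be * M.
have a0 : 0 <= a by rewrite /a; nonneg.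
have P0 : 0 <= P S by exact: expR_ge0.
have Q0 : 0 <= Q S by exact: expR_ge0.
pose L1 := P S * Q S * a / m.
pose L2 := P S * (E * Q S * (m - 1) * a) / m.
pose L3 := P S * (E * Q S * be) / m.
pose L := m * (2 * c1) + (p - m) / m + L1 + L2 + L3.
have [L10 L20 L30] : [/\ 0 <= L1, 0 <= L2 & 0 <= L3] by rewrite /L1 /L2 /L3; split; nonneg.
have L40 : 0 <= m * (2 * c1) by nonneg.
have L50 : 0 <= (p - m) / m by nonneg.
exists L => [|e1 e2 y1 y2 t d1 d2 cy1 cy2 /andP[e10 e1E] /andP[e20 e2E] tS hy hP].
  by rewrite /L; nonneg.
have d10 := le_trans (normr_ge0 _) hy; have d20 := le_trans (normr_ge0 _) hP.
have u0 := expR_ge0 (kap * t); set u := expR (kap * t) in u0 *.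
have f10 := Phi_le0 t cy1; have f20 := Phi_le0 t cy2.
have g1 := expPhi_le cy1 tS; have g2 := expPhi_le cy2 tS.
have yy : `|yc y1 t - yc y2 t| <= d1 by exact: le_trans (clamp_lip _ _ _) hy.
have T1 : `|yc y1 t ^+ 2 - yc y2 t ^+ 2| <= d1 * (2 * (c1 * u)).
  rewrite subr_sqr normrM; apply: ler_pM => //.
  rewrite (le_trans (ler_normD _ _))// mulr2n mulrDl mul1r.
  by apply: lerD; exact: yc_norm.
have T3 : `|Z (Phi y1) t - Z (Phi y2) t| <= u * ((p - m) / m) * d2.
  rewrite !Z_split -/u -mulrBr -mulrBl !normrM (ger0_norm u0) -!mulrA.
  apply: ler_wpM2l => //.
  have k1 : (p - m) * Phi y1 t <= 0 by rewrite mulr_ge0_le0// ltW.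
  have k2 : (p - m) * Phi y2 t <= 0 by rewrite mulr_ge0_le0// ltW.
  have := expR_lip k1 k2; rewrite expR0 mul1r -mulrBr normrM (gtr0_norm pm0) => h.
  have mi : `|m^-1| = m^-1 by rewrite gtr0_norm ?invr_gt0.
  rewrite mi mulrA [leRHS]mulrAC mulrC [leRHS]mulrC.
  apply: ler_wpM2l; first by nonneg.
  by apply: le_trans h _; apply: ler_wpM2l => //; exact: ltW.
have EE : `|expR (- (m - 1) * Phi y1 t) - expR (- (m - 1) * Phi y2 t)| <= Q S * ((m - 1) * d2).
  have k1 : - (m - 1) * Phi y1 t <= (m - 1) * (c1 / kap * expR (kap * S)) by rewrite -ler_expR.
  have k2 : - (m - 1) * Phi y2 t <= (m - 1) * (c1 / kap * expR (kap * S)) by rewrite -ler_expR.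
  apply: le_trans (expR_lip k1 k2) _; rewrite -/(Q S) -mulrBr normrM normrN (gtr0_norm m10).
  by apply: ler_wpM2l => //; apply: ler_wpM2l => //; exact: ltW.
have an (y : R -> R) : `|al + be * yc y t| <= a.
  have b1 : `|be * yc y t| <= be * M.
    rewrite normrM (gtr0_norm be0); apply: ler_wpM2l; first by nonneg.
    by rewrite (le_trans (clamp_norm _ (mu_ge0 _)))// mu_leM.
  by rewrite (le_trans (ler_normD _ _))// (gtr0_norm al0) lerD2l.
have T2 : `|X e1 (Phi y1) t * (al + be * yc y1 t) - X e2 (Phi y2) t * (al + be * yc y2 t)| <=
    u * (L1 * `|e1 - e2| + L2 * d2 + L3 * d1).
  rewrite !X_split.
  set E1 := expR (- (m - 1) * Phi y1 t) in g1 EE *.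
  set E2 := expR (- (m - 1) * Phi y2 t) in g2 EE *.
  set a1 := al + be * yc y1 t; set a2 := al + be * yc y2 t.
  (* Telescoping: eps, the exponential and the last factor are changed one at a time. *)
  have -> : e1 / m * (expR (2 * t) * E1) * a1 - e2 / m * (expR (2 * t) * E2) * a2 =
    expR (2 * t) * ((e1 - e2) * (E1 * a1) + e2 * (E1 - E2) * a1 + e2 * E2 * (a1 - a2)) / m.
    by field; rewrite gt_eqF.
  have -> : u * (L1 * `|e1 - e2| + L2 * d2 + L3 * d1) =
    P S * u * (`|e1 - e2| * (Q S * a) + E * (Q S * ((m - 1) * d2)) * a + E * Q S * (be * d1)) / m.
    by rewrite /L1 /L2 /L3; ring.
  rewrite !normrM (gtr0_norm (_ : 0 < m^-1)) ?invr_gt0//; apply: ler_wpM2r; first by nonneg.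
  rewrite (gtr0_norm (expR_gt0 _)); apply: ler_pM; rewrite ?expR_ge0//; first exact: exp2_le.
  have E1p : 0 <= E1 by exact: expR_ge0.
  have E2p : 0 <= E2 by exact: expR_ge0.
  apply: le_trans (ler_normD _ _) _; apply: lerD.
    apply: le_trans (ler_normD _ _) _; apply: lerD.
      rewrite !normrM; apply: ler_wpM2l => //; apply: ler_pM => //; last exact: an.
      by rewrite ger0_norm.
    rewrite !normrM (ger0_norm e20); apply: ler_pM; try nonneg; last exact: an.
    by apply: ler_pM; try nonneg.
  rewrite !normrM (ger0_norm e20) (ger0_norm E2p).
  apply: ler_pM; try nonneg; first by apply: ler_pM; try nonneg.
  rewrite (_ : a1 - a2 = be * (yc y1 t - yc y2 t)); last by rewrite /a1 /a2; ring.
  by rewrite normrM (gtr0_norm be0); apply: ler_wpM2l => //; exact: ltW.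
rewrite /Gam.
set y1' := yc y1 t in T1 T2 *; set y2' := yc y2 t in T1 T2 *.
set X1 := X _ _ _ * _ in T2 *; set X2 := X _ _ _ * _ in T2 *.
have -> : - m * y1' ^+ 2 + X1 - Z (Phi y1) t - (- m * y2' ^+ 2 + X2 - Z (Phi y2) t) =
  - (m * (y1' ^+ 2 - y2' ^+ 2)) + (X1 - X2) - (Z (Phi y1) t - Z (Phi y2) t) by ring.
apply: le_trans (ler_normB _ _) _; apply: le_trans (lerD (ler_normD _ _) (lexx _)) _.
rewrite normrN normrM (gtr0_norm m0).
apply: (@le_trans _ _ (m * (d1 * (2 * (c1 * u))) +
  u * (L1 * `|e1 - e2| + L2 * d2 + L3 * d1) + u * ((p - m) / m) * d2)).
  apply: lerD => //; apply: lerD => //; apply: ler_wpM2l => //; exact: ltW.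
have n0 := normr_ge0 (e1 - e2); set ne := `|e1 - e2| in n0 *.
rewrite -subr_ge0.
have -> : L * u * (d1 + d2 + ne) - (m * (d1 * (2 * (c1 * u))) +
  u * (L1 * ne + L2 * d2 + L3 * d1) + u * ((p - m) / m) * d2) =
  u * ((m * (2 * c1)) * (d2 + ne) + ((p - m) / m) * (d1 + ne) + L1 * (d1 + d2) +
   L2 * (d1 + ne) + L3 * (d2 + ne)) by rewrite /L; ring.
by nonneg.
Qed.

Lemma T_lip S E : 0 <= E -> exists Lam K, [/\ 0 < Lam, 0 <= K &
  forall e1 e2 y1 y2 D, continuous y1 -> continuous y2 -> 0 <= e1 <= E -> 0 <= e2 <= E ->
    0 <= D -> (forall t, t <= S -> `|y1 t - y2 t| <= D * om Lam t) ->
    forall t, t <= S -> `|T e1 y1 t - T e2 y2 t| <= (D / 2 + K * `|e1 - e2|) * om Lam t].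
Proof.
move=> E0; have [L' L'0 hL'] := Gam_lip S E0.
pose L := L' + 1; have L0 : 0 < L by rewrite ltr_wpDl.
have Lge : L' <= L by rewrite lerDl.
have nk := nk0.
(* Chosen so that both [L1] and [L2] below hold: differentiating the weight produces n + kap and kap
   Lam e^(kap t), and half of the latter absorbs the error in [y], half of the former the error in
   [Phi]. *)
pose Lam := 2 * L / kap * (1 + (n + kap)^-1).
have i0 : 0 < (n + kap)^-1 by rewrite invr_gt0.
have q0 : 0 < 2 * L / kap by rewrite divr_gt0// mulr_gt0.
have Lam0 : 0 < Lam by rewrite mulr_gt0// addr_gt0.
have kL : kap * Lam = 2 * L + 2 * L * (n + kap)^-1 by rewrite /Lam; field; rewrite !gt_eqF.
have kL0 : 0 < kap * Lam by rewrite mulr_gt0.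
have L1 : L <= kap * Lam / 2.
  rewrite kL -subr_ge0 (_ : _ - _ = L * (n + kap)^-1); first by nonneg.
  by field; rewrite gt_eqF.
have L2 : L / (kap * Lam) <= (n + kap) / 2.
  rewrite ler_pdivrMr// kL -subr_ge0 (_ : _ - _ = (n + kap) * L); first by nonneg.
  by field; rewrite gt_eqF.
exists Lam, (L / (n + kap)); split => //; first by nonneg.
move=> e1 e2 y1 y2 D cy1 cy2 he1 he2 D0 hy t tS.
have /andP[e10 _] := he1; have /andP[e20 _] := he2.
have [_ dT1 l1] := TP e10 cy1; have [_ dT2 l2] := TP e20 cy2.
set de := `|e1 - e2|; have de0 : 0 <= de by exact: normr_ge0.
set D' := D / 2 + L / (n + kap) * de.
pose W t := D' * (expR ((n + kap) * t) * expR (Lam * expR (kap * t))).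
suff : `|expR (n * t) * T e1 y1 t - expR (n * t) * T e2 y2 t| <= W t.
  rewrite -mulrBr normrM gtr0_norm ?expR_gt0// /W (mulrDl n) expRD /om.
  by rewrite -(mulrA (expR (n * t))) mulrCA ler_pM2l// expR_gt0.
apply: (@cmpNy_norm _ (fun t => expR (n * t) * T e1 y1 t - expR (n * t) * T e2 y2 t) W
  (fun t => expR (n * t) * Gam e1 y1 t - expR (n * t) * Gam e2 y2 t)
  (fun t => D' * (expR ((n + kap) * t) * expR (Lam * expR (kap * t)) *
     ((n + kap) + kap * Lam * expR (kap * t))))).
- by move=> s _; apply: hasDD (dT1 s) _; apply: hasDN (dT2 s).
- by move=> s _; rewrite /W; derive; ring.
- move=> s st; have sS := le_trans st tS.
  have := hL' e1 e2 y1 y2 s _ _ cy1 cy2 he1 he2 sS (hy s sS) (Phi_lip cy1 cy2 Lam0 D0 hy sS).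
  rewrite -/de /om; set u := expR (kap * s); set O := expR (Lam * u) => hG.
  rewrite -mulrBr normrM gtr0_norm ?expR_gt0// (mulrDl n) expRD -/u.
  have u0 : 0 < u by exact: expR_gt0.
  have O1 : 1 <= O by rewrite -expR0 ler_expR mulr_ge0// ltW.
  have O0 : 0 < O by exact: expR_gt0.
  have -> : D' * (expR (n * s) * u * O * (n + kap + kap * Lam * u)) =
    expR (n * s) * (u * O * (D' * (n + kap + kap * Lam * u))) by ring.
  apply: ler_wpM2l; first exact: expR_ge0.
  apply: le_trans hG _.
  have h1 : L' * u * (D * (u * O) + D / (kap * Lam) * O + de) <=
     L * u * (D * (u * O) + D / (kap * Lam) * O + de * O).
    apply: ler_pM; try nonneg.
    - by apply: ler_wpM2r; [exact: ltW|].
    - by rewrite lerD2l ler_peMr.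
  apply: le_trans h1 _.
  have -> : L * u * (D * (u * O) + D / (kap * Lam) * O + de * O) =
    u * O * (D * (L * u) + D * (L / (kap * Lam)) + L * de) by ring.
  apply: ler_wpM2l; first by nonneg.
  have h2 : D * (L * u) <= D * (kap * Lam / 2 * u).
    by apply: ler_wpM2l => //; apply: ler_wpM2r => //; exact: ltW.
  have h3 : D * (L / (kap * Lam)) <= D * ((n + kap) / 2) by apply: ler_wpM2l.
  have -> : D' * (n + kap + kap * Lam * u) = D * ((n + kap) / 2) + D * (kap * Lam / 2 * u) +
     L * de + L / (n + kap) * de * (kap * Lam * u) by rewrite /D'; field; rewrite gt_eqF.
  have h4 : 0 <= L / (n + kap) * de * (kap * Lam * u) by nonneg.
  lra.
- exact: cvg0B l1 l2.
- apply: (@squeezeNy _ _ (fun t => D' * expR Lam * expR ((n + kap) * t)) 0);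
    last exact: scaled_expR_Ny.
  have D'0 : 0 <= D' by rewrite /D'; nonneg.
  move=> s s0x; rewrite /W ger0_norm; last by nonneg.
  rewrite -mulrA; apply: ler_wpM2l => //; rewrite mulrC; apply: ler_wpM2r; first exact: expR_ge0.
  by rewrite ler_expR ler_piMr ?(ltW Lam0)// -[leRHS]expR0 ler_expR mulr_ge0_le0 ?(ltW kap0).
Qed.

Definition yk eps k := iter k (T eps) (fun=> 0).

Lemma continuous_yk eps k : 0 <= eps -> continuous (yk eps k).
Proof.
by move=> e0; elim: k => [|k IH]; [move=> t; exact: cst_continuous|exact: continuous_T].
Qed.

Lemma om_gt0 Lam t : 0 < om Lam t. Proof. by rewrite mulr_gt0// expR_gt0. Qed.

Lemma om_le Lam t S : 0 < Lam -> t <= S -> om Lam t <= om Lam S.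
Proof.
move=> L0 tS; have h : expR (kap * t) <= expR (kap * S) by rewrite ler_expR ler_wpM2l// ltW.
by apply: ler_pM => //; rewrite ?expR_ge0// ler_expR ler_wpM2l// ltW.
Qed.

Lemma yk_step S E : 0 <= E -> exists Lam K D, [/\ 0 < Lam, 0 <= K, 0 <= D & [/\
  forall eps y D' , continuous y -> 0 <= eps <= E -> 0 <= D' ->
    forall y', continuous y' ->
    (forall t, t <= S -> `|y t - y' t| <= D' * om Lam t) ->
    forall t, t <= S -> `|T eps y t - T eps y' t| <= (D' / 2) * om Lam t,
  forall eps k t, 0 <= eps <= E -> t <= S ->
    `|yk eps k.+1 t - yk eps k t| <= D / 2 ^+ k * om Lam t &
  forall e1 e2 k t, 0 <= e1 <= E -> 0 <= e2 <= E -> t <= S ->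
    `|yk e1 k t - yk e2 k t| <= 2 * K * `|e1 - e2| * om Lam t]].
Proof.
move=> E0; have [Lam [K [L0 K0 hT]]] := T_lip S E0; have [D D0 hD] := T_bound S E0.
exists Lam, K, D; split => //; split.
- move=> eps y D' cy he D'0 y' cy' hy t tS.
  by have := hT eps eps y y' D' cy cy' he he D'0 hy t tS; rewrite (subrr eps) normr0 mulr0 addr0.
- move=> eps k t he; have /andP[e0 _] := he.
  elim: k t => [|k IH] t tS.
    rewrite expr0 divr1 subr0.
    apply: (le_trans (hD eps (yk eps 0) t (@continuous_yk eps 0 e0) he tS)).
    rewrite /om; apply: ler_wpM2l => //; rewrite ler_peMr ?expR_ge0//.
    by rewrite -expR0 ler_expR mulr_ge0 ?expR_ge0// ltW.
  have D2 : 0 <= D / 2 ^+ k by rewrite divr_ge0// exprn_ge0.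
  have := hT eps eps _ _ _ (@continuous_yk _ k.+1 e0) (@continuous_yk _ k e0) he he D2 IH t tS.
  rewrite (subrr eps) normr0 mulr0 addr0 => /le_trans; apply.
  rewrite (_ : D / 2 ^+ k.+1 = D / 2 ^+ k / 2)//.
  by rewrite exprSr invfM mulrA.
- move=> e1 e2 k t he1 he2; have /andP[e10 _] := he1; have /andP[e20 _] := he2.
  (* The bound 2 K |e1 - e2| is the fixed point of D |-> D / 2 + K |e1 - e2|, hence preserved by the
     iteration. *)
  have d0 : 0 <= 2 * K * `|e1 - e2| by nonneg.
  elim: k t => [|k IH] t tS; first by rewrite subrr normr0 mulr_ge0// ltW// om_gt0.
  have := hT e1 e2 _ _ _ (@continuous_yk _ k e10) (@continuous_yk _ k e20) he1 he2 d0 IH t tS.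
  move=> /le_trans; apply; apply: ler_wpM2r; first by rewrite ltW// om_gt0.
  by move: `|e1 - e2| => d; lra.
Qed.

(** A lower barrier. While e^(kap t) <= s0, the first condition keeps al + be y, hence the X term,
    nonnegative, and the second bounds the loss m y ^ 2 + Z by B (n + kap) e^(kap t), the forcing
    for which the barrier is an exact solution up to sign. *)
Lemma T_invariant B eps y : 0 < B -> B * s0 * be <= al -> m * B ^+ 2 * s0 + m^-1 <= B * (n + kap) ->
  0 <= eps -> continuous y ->
  (forall t, expR (kap * t) <= s0 -> - (B * expR (kap * t)) <= y t) ->
  forall t, expR (kap * t) <= s0 -> - (B * expR (kap * t)) <= T eps y t.
Proof.
move=> B0 h1 h2 e0 cy hy t ts.
have m0 : 0 < m by exact: lt_trans m1.
have [_ d l] := TP e0 cy.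
suff : - (B * expR ((n + kap) * t)) <= expR (n * t) * T eps y t.
  by rewrite mulrDl expRD mulrCA -mulrN ler_pM2l// expR_gt0.
apply: (@cmpNy_le _ (fun t => - (B * expR ((n + kap) * t))) (fun t => expR (n * t) * T eps y t)
  (fun t => - (B * (n + kap) * expR ((n + kap) * t))) (fun t => expR (n * t) * Gam eps y t)) => //.
- by move=> s _; derive; ring.
- move=> s st; rewrite [in leLHS]mulrDl expRD mulrCA -mulrN; apply: ler_wpM2l; first exact: expR_ge0.
  have us : expR (kap * s) <= s0 by apply: le_trans ts; rewrite ler_expR ler_wpM2l// ltW.
  have u0 : 0 < expR (kap * s) by exact: expR_gt0.
  have Z0 : Z (Phi y) s <= expR (kap * s) * m^-1.
    rewrite Z_split; apply: ler_wpM2l; first exact: ltW.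
    rewrite ler_piMl ?invr_ge0 ?(ltW m0)// -[leRHS]expR0 ler_expR mulr_ge0_le0 ?subr_ge0 ?(ltW mp)//.
    exact: Phi_le0.
  have yb : - (B * expR (kap * s)) <= yc y s.
    by apply: clamp_ge; [exact: mu_ge0|nonneg|exact: hy].
  have /andP[_ y0] := yc_bounds y s.
  have X0 : 0 <= X eps (Phi y) s * (al + be * yc y s).
    apply: mulr_ge0; first by rewrite /X; nonneg.
    have : be * (- (B * s0)) <= be * yc y s.
      apply: ler_wpM2l; first exact: ltW.
      by apply: le_trans yb; rewrite lerN2 ler_wpM2l// ltW.
    by move: h1; rewrite mulrN mulrC; lra.
  have Bs0 : 0 <= B * expR (kap * s) by nonneg.
  have y2 : yc y s ^+ 2 <= (B * expR (kap * s)) ^+ 2.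
    by rewrite -[yc y s ^+ 2]sqrrN lerXn2r ?nnegrE ?oppr_ge0// lerNl.
  have y3 : m * yc y s ^+ 2 <= m * (B ^+ 2 * s0) * expR (kap * s).
    rewrite -mulrA; apply: ler_wpM2l; first exact: ltW.
    apply: le_trans y2 _; rewrite exprMn -(mulrA (B ^+ 2) s0); apply: ler_wpM2l; first by nonneg.
    by rewrite expr2; apply: ler_wpM2r => //; exact: ltW.
  rewrite /Gam mulNr.
  have : (m * B ^+ 2 * s0 + m^-1) * expR (kap * s) <= B * (n + kap) * expR (kap * s).
    by apply: ler_wpM2r => //; exact: ltW.
  move: y3 Z0 X0; move: (X _ _ _ * _) => x; move: (yc y s ^+ 2) (Z _ _) (expR _) => a b c.
  by rewrite mulrDl; move: (m^-1); move=> mi; rewrite !mulrA; lra.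
- rewrite -oppr0; apply: cvgN; exact: scaled_expR_Ny.
Qed.

(** Pointwise limits of the Picard iterates from 0. The estimate in eps and the barrier hold for
    each iterate with constants free of [k], and pass to the limit. *)
Lemma fixed_point_family : exists Y : R -> R -> R,
  [/\ forall eps, 0 <= eps -> continuous (Y eps) /\ T eps (Y eps) =1 Y eps,
    forall S E, 0 <= E -> exists2 C, 0 <= C & forall e1 e2 t, 0 <= e1 <= E -> 0 <= e2 <= E ->
      t <= S -> `|Y e1 t - Y e2 t| <= C * `|e1 - e2| &
    forall B, 0 < B -> B * s0 * be <= al -> m * B ^+ 2 * s0 + m^-1 <= B * (n + kap) ->
      forall eps t, 0 <= eps -> expR (kap * t) <= s0 -> - (B * expR (kap * t)) <= Y eps t].
Proof.
(* The property is required for every [B] at once, so that the limit chosen at [t] does not depend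
   on the window t <= S whose constants later estimate it. For negative eps the requirement is
   void. *)
have lim_ex : forall eps t, exists l, 0 <= eps -> forall B,
    (forall k, `|yk eps k.+1 t - yk eps k t| <= B / 2 ^+ k) ->
    forall k, `|l - yk eps k t| <= 2 * B / 2 ^+ k.
  move=> eps t.
  have [e0|] := boolP (0 <= eps); last by move=> _; exists 0.
  have [Lam [K [D [L0 K0 D0 [_ h _]]]]] := yk_step t e0.
  have hl k : `|yk eps k.+1 t - yk eps k t| <= D * om Lam t / 2 ^+ k.
    by rewrite mulrAC; apply: h; rewrite ?e0 ?lexx.
  have [l hl'] := geometric_limit hl.
  exists l => _ B hB k; have [l2 hl2] := geometric_limit hB.
  suff -> : l = l2 by exact: hl2.
  apply/eqP; rewrite -subr_eq0 -normr_le0; apply: (@le_addgeo _ _ _ (2 * (D * om Lam t) + 2 * B)) => j.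
  rewrite add0r mulrDl; have -> : l - l2 = (l - yk eps j t) - (l2 - yk eps j t) by ring.
  by apply: le_trans (ler_normB _ _) _; apply: lerD.
pose Y eps t := sval (cid (lim_ex eps t)).
have HY eps t : 0 <= eps -> forall B, (forall k, `|yk eps k.+1 t - yk eps k t| <= B / 2 ^+ k) ->
    forall k, `|Y eps t - yk eps k t| <= 2 * B / 2 ^+ k by exact: (svalP (cid (lim_ex eps t))).
have HYS S E Lam D :
  (forall eps k t, 0 <= eps <= E -> t <= S ->
    `|yk eps k.+1 t - yk eps k t| <= D / 2 ^+ k * om Lam t) ->
  forall eps t k, 0 <= eps <= E -> t <= S -> `|Y eps t - yk eps k t| <= 2 * D / 2 ^+ k * om Lam t.
  move=> h eps t k he tS; have /andP[e0 _] := he.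
  have -> : 2 * D / 2 ^+ k * om Lam t = 2 * (D * om Lam t) / 2 ^+ k by rewrite mulrA mulrAC.
  apply: HY => // j.
  by rewrite mulrAC; exact: h.
exists Y; split.
- move=> eps e0.
  have cY : continuous (Y eps).
    move=> t0; pose S := t0 + 1.
    have [Lam [K [D [L0 K0 D0 [_ h _]]]]] := yk_step S e0.
    have hY t k : t <= S -> `|Y eps t - yk eps k t| <= 2 * D / 2 ^+ k * om Lam S.
      move=> tS; apply: le_trans (HYS _ _ _ _ h eps t k _ tS) _; first by rewrite e0 lexx.
      by apply: ler_wpM2l; rewrite ?om_le// divr_ge0 ?exprn_ge0//; nonneg.
    apply/cvgrPdist_le => e e00.
    have [k hk] : exists k, 2 * D / 2 ^+ k * om Lam S <= e / 3.
      apply: contrapT => /forallNP hn.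
      have : e / 3 <= 0; last by lra.
      apply: (@le_addgeo _ _ _ (2 * D * om Lam S)) => k; rewrite add0r mulrAC.
      by rewrite leNgt; apply/negP => /ltW; exact: hn.
    have := @continuous_yk eps k e0 t0; move=> /cvgrPdist_le/(_ (e / 3)).
    have e3 : 0 < e / 3 by rewrite divr_gt0.
    move=> /(_ e3); apply: filterS2; last first.
      have : t0 < S by rewrite /S; lra.
      by move=> /lt_nbhsl; exact.
    move=> t tS tk.
    have -> : Y eps t0 - Y eps t = (Y eps t0 - yk eps k t0) + (yk eps k t0 - yk eps k t)
       - (Y eps t - yk eps k t) by ring.
    apply: le_trans (ler_normB _ _) _; apply: le_trans (lerD (ler_normD _ _) (lexx _)) _.
    have q1 := le_trans (hY t0 k (_ : t0 <= S)) hk.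
    have q2 := le_trans (hY t k (ltW tS)) hk.
    have q3 : t0 <= S by rewrite /S; lra.
    have := q1 q3; lra.
  split => // t.
  have [Lam [K [D [L0 K0 D0 [hT h _]]]]] := yk_step t e0.
  have he : 0 <= eps <= eps by rewrite e0 lexx.
  apply/eqP; rewrite -subr_eq0 -normr_le0.
  apply: (@le_addgeo _ _ _ (2 * (D * om Lam t))) => k; rewrite add0r.
  have D2 : 0 <= 2 * D / 2 ^+ k by rewrite divr_ge0 ?exprn_ge0//; nonneg.
  have h1 := hT eps (Y eps) _ cY he D2 _ (@continuous_yk _ k e0) (fun s => HYS _ _ _ _ h eps s k he) t (lexx _).
  have h2 := HYS _ _ _ _ h eps t k.+1 he (lexx _).
  have -> : T eps (Y eps) t - Y eps t = (T eps (Y eps) t - yk eps k.+1 t) - (Y eps t - yk eps k.+1 t).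
    by rewrite opprB addrA subrK.
  apply: le_trans (ler_normB _ _) _; apply: le_trans (lerD h1 h2) _.
  by rewrite exprS invfM; lra.
- move=> S E E0; have [Lam [K [D [L0 K0 D0 [_ h hl]]]]] := yk_step S E0.
  have o0 := om_gt0 Lam S.
  exists (2 * K * om Lam S) => [|e1 e2 t he1 he2 tS]; first by nonneg.
  apply: (@le_addgeo _ _ _ (4 * D * om Lam S)) => k.
  have -> : Y e1 t - Y e2 t = (Y e1 t - yk e1 k t) + (yk e1 k t - yk e2 k t) - (Y e2 t - yk e2 k t) by ring.
  apply: le_trans (ler_normB _ _) _; apply: le_trans (lerD (ler_normD _ _) (lexx _)) _.
  have i1 := HYS _ _ _ _ h e1 t k he1 tS; have i2 := HYS _ _ _ _ h e2 t k he2 tS.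
  have i3 := hl e1 e2 k t he1 he2 tS; have ot := om_le L0 tS.
  have i4 : 2 * D / 2 ^+ k * om Lam t <= 2 * D / 2 ^+ k * om Lam S.
    by apply: ler_wpM2l => //; rewrite divr_ge0 ?exprn_ge0//; nonneg.
  have i5 : 2 * K * `|e1 - e2| * om Lam t <= 2 * K * `|e1 - e2| * om Lam S.
    by apply: ler_wpM2l => //; nonneg.
  have -> : 2 * K * om Lam S * `|e1 - e2| + 4 * D * om Lam S / 2 ^+ k =
    2 * (2 * D / 2 ^+ k * om Lam S) + 2 * K * `|e1 - e2| * om Lam S by ring.
  lra.
- move=> B B0 h1 h2 eps t e0 ts.
  have yB k s : expR (kap * s) <= s0 -> - (B * expR (kap * s)) <= yk eps k s.
    elim: k s => [|k IH] s ss; first by rewrite oppr_le0; nonneg.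
    by apply: T_invariant ss => //; exact: continuous_yk.
  have [Lam [K [D [L0 K0 D0 [_ h _]]]]] := yk_step t e0.
  apply: (@le_addgeo _ _ _ (2 * D * om Lam t)) => k.
  have := HYS _ _ _ _ h eps t k; rewrite e0 !lexx => /(_ isT isT).
  rewrite ler_norml => /andP[h3 _]; have := yB k t ts.
  by rewrite (mulrAC _ (om Lam t)); lra.
Qed.

End VolterraOperator.

(** * Shooting *)

Section Crossing.
Context {R : realType}.
Implicit Types (f : R -> R) (a b : R).

Lemma first_zero f a b : continuous f -> a <= b -> 0 < f a -> f b <= 0 ->
  exists2 c, a <= c <= b & f c = 0 /\ forall t, a <= t < c -> 0 < f t.
Proof.
move=> cf ab fa fb.
pose A := [set t | a <= t <= b /\ forall s, a <= s <= t -> 0 < f s].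
have Aa : A a by split; [rewrite lexx|move=> s as_; have -> : s = a by lra].
have Ab : ubound A b by move=> t [/andP[]].
have hs : has_sup A by split; [exists a|exists b].
pose c := sup A.
have ac : a <= c by apply: sup_upper_bound.
have cb : c <= b by apply: ge_sup => //; exists a.
have pos t : a <= t < c -> 0 < f t.
  move=> /andP[at_ tc].
  have d0 : 0 < c - t by lra.
  have [s [sab hs'] st] := sup_adherent d0 hs.
  by apply: hs'; rewrite -/c in st; lra.
exists c; first by rewrite ac.
split => //; apply/eqP; rewrite eq_le; apply/andP; split; rewrite leNgt; apply/negP => fc.
  have cb' : c < b by rewrite lt_neqAle cb andbT; apply/eqP => cb'; move: fb; rewrite -cb'; lra.
  have /cvgrPdist_lt/(_ _ fc) := cf c.
  move=> [e /= e0 he].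
  pose d := Num.min (e / 2) (b - c).
  have d0 : 0 < d by rewrite lt_min; apply/andP; split; lra.
  have de : d < e by rewrite /d gt_min; apply/orP; left; lra.
  have db : d <= b - c by rewrite /d ge_min lexx orbT.
  have : c + d <= c; last by lra.
  apply: sup_upper_bound => //; split; first by lra.
  move=> s /andP[as_ sd]; have [sc|cs] := ltP s c; first by apply: pos; rewrite as_.
  have := he s; rewrite /ball/= => h.
  have : `|c - s| < e by rewrite ler0_norm; lra.
  by move=> /h; have := ler_norm (f c - f s); lra.
have ac' : a < c by rewrite lt_neqAle ac andbT; apply/eqP => ac'; move: fc; rewrite -ac'; lra.
have fc' : 0 < - f c by lra.
have /cvgrPdist_lt/(_ _ fc') := cf c.
move=> [e /= e0 he].
pose d := Num.min (e / 2) (c - a).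
have d0 : 0 < d by rewrite lt_min; apply/andP; split; lra.
have de : d < e by rewrite /d gt_min; apply/orP; left; lra.
have db : d <= c - a by rewrite /d ge_min lexx orbT.
have h1 : 0 < f (c - d) by apply: pos; lra.
have := he (c - d); rewrite /ball/= => h.
have : `|c - (c - d)| < e by rewrite ger0_norm; lra.
by move=> /h; have := ler_norm (- (f c - f (c - d))); rewrite normrN; lra.
Qed.

Lemma last_zero f a b : continuous f -> a <= b -> f a <= 0 -> 0 < f b ->
  exists2 c, a <= c <= b & f c = 0 /\ forall t, c < t <= b -> 0 < f t.
Proof.
move=> cf ab fa fb.
have cg : continuous (fun t => f (- t)).
  move=> t; apply: (@ctsat_comp _ f (fun t => - t)); first exact: cf.
  exact: (ctsatN (@ctsat_id _ t)).
have ba : - b <= - a by lra.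
have [||c cab [fc hc]] := first_zero cg ba; rewrite ?opprK//.
exists (- c); first by lra.
by split => // t tc; rewrite -[t]opprK; apply: hc; lra.
Qed.

End Crossing.

(** * Irreversible exits and the separating parameter *)

Section Shooting.
Context {R : realType}.
Variables n kap m p al be M s0 B : R.
Hypothesis kap0 : 0 < kap.
Hypothesis kap2 : kap < 2.
Hypothesis nk0 : 0 < n + kap.
Hypothesis n20 : 0 < n + 2.
Hypothesis m1 : 1 < m.
Hypothesis mp : m < p.
Hypothesis al0 : 0 < al.
Hypothesis be0 : 0 < be.
Hypothesis M0 : 0 < M.
Hypothesis s00 : 0 < s0.
Hypothesis B0 : 0 < B.
Hypothesis alM : al <= be * M.
Hypothesis nM : n <= m * M.
Hypothesis BM : B * s0 <= M.
Hypothesis subcrit : n * (p + m) < 2 * m * (n + kap).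

Variables Y F : R -> R -> R.
Implicit Types (eps t : R).
Let c e t := clamp (mu kap M s0 t) (Y e t).
Let XX e t := X m e (F e) t.
Let ZZ e t := Z kap m p (F e) t.
Let Ga e t := - m * c e t ^+ 2 + XX e t * (al + be * c e t) - ZZ e t.
Hypothesis cY : forall e, 0 <= e -> continuous (Y e).
Hypothesis dF : forall e, 0 <= e -> forall t, hasD (F e) t (c e t).
Hypothesis F0 : forall e, 0 <= e -> F e t @[t --> -oo] --> (0 : R).
Hypothesis F_le0 : forall e t, 0 <= e -> F e t <= 0.
Hypothesis dY : forall e, 0 <= e -> forall t, hasD (Y e) t (- n * Y e t + Ga e t).
Hypothesis Y0 : forall e, 0 <= e -> expR (n * t) * Y e t @[t --> -oo] --> (0 : R).
Hypothesis YB : forall e t, 0 <= e -> expR (kap * t) <= s0 -> - (B * expR (kap * t)) <= Y e t.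
Hypothesis Ylip : forall S E, 0 <= E -> exists2 C, 0 <= C & forall e1 e2 t,
  0 <= e1 <= E -> 0 <= e2 <= E -> t <= S -> `|Y e1 t - Y e2 t| <= C * `|e1 - e2|.

Let m0 : 0 < m. Proof. exact: lt_trans m1. Qed.
Let pm0 : 0 < p - m. Proof. by rewrite subr_gt0. Qed.

Let mu0 t : 0 <= mu kap M s0 t. Proof. exact: mu_ge0. Qed.

Let c_bounds e t : - M <= c e t <= 0.
Proof.
have := clamp_bounds (Y e t) (mu0 t); have := mu_leM kap M s0 t.
by rewrite /c; lra.
Qed.

Lemma XX_ge0 e t : 0 <= e -> 0 <= XX e t.
Proof. by move=> e0; rewrite /XX /X; have := m0 => m0'; nonneg. Qed.

Lemma ZZ_gt0 e t : 0 < ZZ e t.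
Proof. by rewrite divr_gt0// expR_gt0. Qed.

Lemma F_nincr e s t : 0 <= e -> s <= t -> F e t <= F e s.
Proof.
move=> e0 st; have := @hasD_ge0 _ (fun t => - F e t) (fun t => - c e t) s t st.
rewrite lerN2; apply => r _; first exact/hasDN/dF.
by have /andP[] := c_bounds e r; lra.
Qed.

(* X / Z = eps e^((2 - kap) t - (p - 1) F) increases with t. *)
Lemma XZ_sign e s t : 0 <= e -> s <= t -> ZZ e s <= al * XX e s -> ZZ e t <= al * XX e t.
Proof.
move=> e0 st.
pose r t := (2 - kap) * t - (p - 1) * F e t.
have XE t' : al * XX e t' - ZZ e t' = ZZ e t' * (al * e * expR (r t') - 1).
  rewrite /XX /ZZ /X /Z.
  rewrite (_ : 2 * t' - (m - 1) * F e t' = kap * t' + (p - m) * F e t' + r t'); last first.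
    by rewrite /r; ring.
  by rewrite expRD; ring.
rewrite -subr_ge0 -[in X in _ -> X]subr_ge0 !XE.
rewrite !pmulr_rge0 ?ZZ_gt0// !subr_ge0 => /le_trans; apply.
apply: ler_wpM2l; first by rewrite mulr_ge0// ltW.
rewrite ler_expR /r; have h1 := F_nincr e0 st.
have h2 : (2 - kap) * s <= (2 - kap) * t by rewrite ler_wpM2l// subr_ge0 ltW.
have h3 : (p - 1) * F e t <= (p - 1) * F e s.
  by rewrite ler_wpM2l// subr_ge0; have := m1; have := mp; lra.
by move: h2 h3; lra.
Qed.

Lemma dW e : 0 <= e -> forall t, hasD (fun t => expR (n * t) * Y e t) t (expR (n * t) * Ga e t).
Proof. by move=> e0 t; have dYe := dY e0; derive; ring. Qed.

Lemma Ga_pos e t : 0 <= Y e t -> Ga e t = al * XX e t - ZZ e t.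
Proof. by move=> y0; rewrite /Ga /c clamp_ge0// !(mulr0, expr0n, addr0, add0r) [al * _]mulrC. Qed.

Lemma continuous_W e : 0 <= e -> continuous (fun t => expR (n * t) * Y e t).
Proof. by move=> e0; exact: hasD_cont_all (dW e0). Qed.

Let W0 e t : (0 < expR (n * t) * Y e t) = (0 < Y e t).
Proof. by rewrite pmulr_rgt0// expR_gt0. Qed.

(** Compare al X with Z at time s. If al X >= Z, this persists, so e^(n t) Y does not decrease while
    Y is nonnegative and cannot return to 0. If al X < Z, this held at all earlier times, which
    forces Y > 0 on all of (-oo, s]; but then e^(n t) Y cannot have risen from its limit 0 at
    -oo. *)
Lemma stays_positive e s t : 0 <= e -> s <= t -> 0 < Y e s -> 0 < Y e t.
Proof.
move=> e0 st ys; rewrite ltNge; apply/negP => yt.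
have cW := continuous_W e0; have dWe := dW e0.
have [hs|hs] := leP (ZZ e s) (al * XX e s).
  have [||r /andP[sr rt] [Wr hr]] := first_zero cW st; rewrite ?W0//.
    by rewrite pmulr_rle0// expR_gt0.
  have : expR (n * s) * Y e s <= expR (n * r) * Y e r.
    apply: (@hasD_ge0 _ (fun t => expR (n * t) * Y e t) (fun t => expR (n * t) * Ga e t) _ _ sr) => q /andP[sq qr]; first exact: dWe.
    rewrite Ga_pos; last first.
      have [qr'|rq] := ltP q r; first by have := hr q; rewrite sq qr' W0 => /(_ isT)/ltW.
      have qE : q = r by apply/eqP; rewrite eq_le qr.
      by move/eqP: Wr; rewrite qE mulf_eq0 gt_eqF ?expR_gt0//= => /eqP ->.
    by rewrite mulr_ge0 ?expR_ge0// subr_ge0; exact: XZ_sign hs.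
  by rewrite Wr leNgt W0 ys.
have neg q : q <= s -> al * XX e q - ZZ e q <= 0.
  move=> qs; rewrite subr_le0 leNgt; apply/negP => /ltW/(XZ_sign e0 qs).
  by rewrite leNgt hs.
have pos q : q <= s -> 0 < Y e q.
  move=> qs; rewrite ltNge; apply/negP => yq.
  have [||r /andP[qr rs] [Wr hr]] := last_zero cW qs; rewrite ?W0//.
    by rewrite pmulr_rle0// expR_gt0.
  have : - (expR (n * r) * Y e r) <= - (expR (n * s) * Y e s).
    apply: (@hasD_ge0 _ (fun t => - (expR (n * t) * Y e t)) (fun t => - (expR (n * t) * Ga e t)) _ _ rs).
      by move=> x _; exact: hasDN.
    move=> x /andP[rx xs]; rewrite Ga_pos; last first.
      have [rx'|xr] := ltP r x; first by have := hr x; rewrite rx' xs W0 => /(_ isT)/ltW.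
      have xE : x = r by apply/eqP; rewrite eq_le rx xr.
      by move/eqP: Wr; rewrite xE mulf_eq0 gt_eqF ?expR_gt0//= => /eqP ->.
    by rewrite -mulrN mulr_ge0 ?expR_ge0// oppr_ge0 neg.
  by rewrite Wr oppr0 oppr_ge0 leNgt W0 ys.
have : 0 <= - (expR (n * s) * Y e s).
  apply: (@cmpNy _ (fun t => - (expR (n * t) * Y e t)) (fun t => - (expR (n * t) * Ga e t))).
  - by move=> x _; exact: hasDN.
  - move=> x xs; rewrite Ga_pos ?(ltW (pos _ xs))//.
    by rewrite -mulrN mulr_ge0 ?expR_ge0// oppr_ge0 neg.
  - by rewrite -[X in _ --> X]oppr0; apply: cvgN; exact: Y0.
by rewrite oppr_ge0 leNgt W0 ys.
Qed.

Lemma mu_M t : s0 <= expR (kap * t) -> mu kap M s0 t = M.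
Proof.
by move=> h; rewrite /mu min_l// -mulrA ler_peMr ?(ltW M0)// mulrC ler_pdivlMr// mul1r.
Qed.

(** By [YB] and [BM], an orbit can be below - M only once the truncation level has reached M. From
    there [c] equals - M as long as Y <= - M, and [alM] and [nM] make e^(n t) (Y + M)
    nonincreasing. *)
Lemma stays_below e s t : 0 <= e -> s <= t -> Y e s < - M -> Y e t < - M.
Proof.
move=> e0 st ys; rewrite ltNge; apply/negP => yt.
have sge : s0 <= expR (kap * s).
  rewrite leNgt; apply/negP => /ltW h; have := YB e0 h.
  have : B * expR (kap * s) <= B * s0 by rewrite ler_wpM2l// ltW.
  by have := BM; lra.
have cf : continuous (fun t => - (Y e t + M)).
  by have cYe := cY e0; move=> x; change (ctsat (fun t => - (Y e t + M)) x); continuity.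
have [||r /andP[sr rt] [Yr hr]] := first_zero cf st; try lra.
have dYe := dY e0.
have : - (expR (n * s) * (Y e s + M)) <= - (expR (n * r) * (Y e r + M)).
  apply: (@hasD_ge0 _ (fun t => - (expR (n * t) * (Y e t + M)))
    (fun t => - (expR (n * t) * (Ga e t + n * M))) _ _ sr).
    by move=> x _; derive; ring.
  move=> x /andP[sx xr]; rewrite -mulrN mulr_ge0 ?expR_ge0//.
  have yx : Y e x <= - M.
    have [xr'|rx] := ltP x r; first by have := hr x; rewrite sx xr' => /(_ isT); lra.
    have -> : x = r by apply/eqP; rewrite eq_le xr.
    by move: Yr; lra.
  have cx : c e x = - M.
    rewrite /c mu_M; last by apply: le_trans sge _; rewrite ler_expR ler_wpM2l// ltW.
    by have M0' := M0; rewrite /clamp min_l; [rewrite max_l|]; lra.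
  rewrite /Ga cx.
  have h1 : XX e x * (al + be * - M) <= 0.
    by rewrite mulr_ge0_le0 ?XX_ge0//; have := alM; lra.
  have h2 := ZZ_gt0 e x.
  have h3 : n * M <= m * M * M by rewrite ler_wpM2r// ltW.
  by move: h1 h2 h3; rewrite sqrrN expr2; move: (XX e x * _) (ZZ e x) => u v; lra.
have -> : Y e r + M = 0 by move: Yr; lra.
rewrite mulr0 oppr0 oppr_le0 pmulr_rge0 ?expR_gt0//; lra.
Qed.

(** Before e^(kap t) reaches s0, the barrier keeps Y above the reduced truncation level; afterwards
    that level is M. *)
Lemma clamp_inactive e : 0 <= e -> (forall t, - M <= Y e t <= 0) -> forall t, c e t = Y e t.
Proof.
move=> e0 h t; rewrite /c; have /andP[h1 h2] := h t; apply: clamp_id => //.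
have [ht|ht] := leP s0 (expR (kap * t)); first by rewrite mu_M.
have := YB e0 (ltW ht) => h3.
suff : B * expR (kap * t) <= mu kap M s0 t by lra.
rewrite le_min; apply/andP; split.
  by apply: le_trans BM; rewrite ler_wpM2l ?ltW.
by rewrite ler_wpM2r ?expR_ge0// ler_pdivlMr.
Qed.

Lemma ZZ_le e t : 0 <= e -> ZZ e t <= expR (kap * t) / m.
Proof.
move=> e0; rewrite /ZZ Z_split mulrA ler_wpM2r ?invr_ge0 ?(ltW m0)//.
rewrite ler_piMr ?expR_ge0// -[leRHS]expR0 ler_expR mulr_ge0_le0 ?(ltW pm0)//.
exact: F_le0.
Qed.

Lemma eZZ_Ny e : 0 <= e -> expR (n * t) * ZZ e t @[t --> -oo] --> (0 : R).
Proof.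
move=> e0; apply: (@squeezeNy _ _ (fun t => m^-1 * expR ((n + kap) * t)) 0); last exact: scaled_expR_Ny.
move=> t _; have z0 := ltW (ZZ_gt0 e t); rewrite ger0_norm; last by nonneg.
by rewrite mulrDl expRD [leRHS]mulrCA ler_wpM2l ?expR_ge0// mulrC ZZ_le.
Qed.

(* Pohozaev: [G] would be positive and increasing, yet tend to 0 at +oo. *)
Lemma zero_goes_below : exists t, Y 0 t < - M.
Proof.
apply: contrapT => /forallNP h.
have YM t : - M <= Y 0 t by rewrite leNgt; apply/negP/h.
have e0 : (0 : R) <= 0 := lexx _.
have XX0 t : XX 0 t = 0 by rewrite /XX /X !mul0r.
have dWe := dW e0; have Wl := Y0 e0.
have Yle t : Y 0 t <= 0.
  rewrite leNgt; apply/negP => yt.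
  have : 0 <= - (expR (n * t) * Y 0 t).
    apply: (@cmpNy _ (fun t => - (expR (n * t) * Y 0 t)) (fun t => - (expR (n * t) * Ga 0 t))).
    - by move=> x _; exact: hasDN.
    - move=> x xs; rewrite -mulrN mulr_ge0 ?expR_ge0// oppr_ge0 /Ga XX0 mul0r addr0.
      rewrite mulNr -opprD oppr_le0 addr_ge0 ?(ltW (ZZ_gt0 _ _))// mulr_ge0 ?sqr_ge0//.
      exact: ltW m0.
    - by rewrite -[X in _ --> X]oppr0; apply: cvgN.
  by rewrite oppr_ge0 leNgt W0 yt.
have cE : forall t, c 0 t = Y 0 t by apply: clamp_inactive => // t; rewrite YM Yle.
have dFe t : hasD (F 0) t (Y 0 t) by rewrite -cE; exact: dF.
have GaE t : Ga 0 t = - m * Y 0 t ^+ 2 - ZZ 0 t by rewrite /Ga XX0 cE mul0r addr0.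
have dYe t : hasD (Y 0) t (- n * Y 0 t - m * Y 0 t ^+ 2 - ZZ 0 t).
  by apply: hasD_eq (dY e0 t) _; rewrite GaE; ring.
have dZ t : hasD (ZZ 0) t (ZZ 0 t * (kap + (p - m) * Y 0 t)).
  by rewrite /ZZ /Z; derive; ring.
have nk := nk0; have m0' := m0; have pm0' := pm0; have k0 := kap0.
have zl := eZZ_Ny e0.
(* As Y <= 0, the quantity e^(n t) (Y + Z / (n + kap)) is nonincreasing, and it starts from 0 at
   -oo. *)
have YZ t : Y 0 t <= - (ZZ 0 t / (n + kap)).
  have : 0 <= - (expR (n * t) * (Y 0 t + ZZ 0 t * (n + kap)^-1)).
    apply: (@cmpNy _ (fun t => - (expR (n * t) * (Y 0 t + ZZ 0 t * (n + kap)^-1)))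
      (fun t => expR (n * t) * (m * Y 0 t ^+ 2 + (p - m) / (n + kap) * (ZZ 0 t * - Y 0 t)))).
    - by move=> x _; derive; field; rewrite gt_eqF.
    - move=> x _; have z0 := ltW (ZZ_gt0 0 x).
      have y0 : 0 <= - Y 0 x by rewrite oppr_ge0.
      by nonneg.
    - rewrite -[X in _ --> X]oppr0; apply: cvgN.
      have -> : (fun x => expR (n * x) * (Y 0 x + ZZ 0 x * (n + kap)^-1)) =
         (fun x => expR (n * x) * Y 0 x + expR (n * x) * ZZ 0 x * (n + kap)^-1).
        by apply/funext => x; ring.
      rewrite -[X in _ --> X](addr0 (0 : R)); apply: cvgD => //.
      by rewrite -[X in _ --> X](mul0r (n + kap)^-1); apply: cvgM => //; exact: cvg_cst.
  by rewrite oppr_ge0 pmulr_rle0 ?expR_gt0//; lra.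
(* [YZ] integrated once: [k1] is the coefficient of e^(kap t) in the expansion of f ^ (- (p - m))
   when f 0 = 1, and here the leading term is a lower bound for all t. Hence f = O(xi ^ (- kap / (p
   - m))). *)
pose k1 := (p - m) / (m * (n + kap) * kap).
have k10 : 0 < k1 by rewrite divr_gt0// !mulr_gt0.
have expF t : k1 * expR (kap * t) <= expR (- (p - m) * F 0 t).
  suff : k1 * expR (kap * t) <= expR (- (p - m) * F 0 t) - 1 by lra.
  apply: (@cmpNy_le _ (fun t => k1 * expR (kap * t)) (fun t => expR (- (p - m) * F 0 t) - 1)
    (fun t => (p - m) / (m * (n + kap)) * expR (kap * t))
    (fun t => expR (- (p - m) * F 0 t) * (- (p - m) * Y 0 t))).
  - by move=> x _; rewrite /k1; derive; field; rewrite !gt_eqF.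
  - by move=> x _; derive; ring.
  - move=> x _; have := YZ x; rewrite -lerN2 opprK => hx.
    have : expR (- (p - m) * F 0 x) * ((p - m) * (ZZ 0 x / (n + kap))) <=
        expR (- (p - m) * F 0 x) * ((p - m) * - Y 0 x).
      by rewrite ler_wpM2l ?expR_ge0// ler_wpM2l// ltW.
    have -> : expR (- (p - m) * F 0 x) * (- (p - m) * Y 0 x) =
      expR (- (p - m) * F 0 x) * ((p - m) * - Y 0 x) by ring.
    have ee : expR (- (p - m) * F 0 x) * expR ((p - m) * F 0 x) = 1.
      by rewrite -expRD mulNr addNr expR0.
    apply: le_trans; rewrite /ZZ Z_split.
    have -> : expR (- (p - m) * F 0 x) *
       ((p - m) * (expR (kap * x) * (expR ((p - m) * F 0 x) / m) / (n + kap))) =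
      (expR (- (p - m) * F 0 x) * expR ((p - m) * F 0 x)) *
         ((p - m) / (m * (n + kap)) * expR (kap * x)) by field; rewrite !gt_eqF.
    by rewrite ee mul1r.
  - exact: scaled_expR_Ny.
  - rewrite -[X in _ --> X](subrr (1 : R)); apply: cvgB; last exact: cvg_cst.
    have l0 : - (p - m) * F 0 x @[x --> -oo] --> - (p - m) * 0.
      by apply: cvgM; [exact: cvg_cst|exact: (F0 e0)].
    rewrite mulr0 in l0; rewrite -[X in _ --> X]expR0.
    exact: (continuous_cvg _ (@continuous_expR R 0) l0).
have Fup t : F 0 t <= (- ln k1 - kap * t) / (p - m).
  rewrite ler_pdivlMr//; have := expF t.
  rewrite -{1}[k1]lnK ?posrE// -expRD ler_expR; lra.
have Zup t : ZZ 0 t <= (m * k1)^-1.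
  rewrite /ZZ /Z invfM mulrC ler_wpM2l ?invr_ge0 ?(ltW m0)//.
  rewrite -[k1^-1]lnK ?posrE ?invr_gt0// ler_expR lnV ?posrE//.
  have := Fup t; rewrite ler_pdivlMr//; lra.
have pm2 : 0 < p + m by rewrite addr_gt0// (lt_trans m0).
(* With n = N - 2 and v = f ^ m, [G] is the Pohozaev functional xi ^ N (v' ^ 2 / 2 + m xi ^ sigma f
   ^ (p + m) / (p + m)) + (N - 2) / 2 xi ^ (N - 1) v v' of the equation v'' + (N - 1) / xi v' + xi ^
   sigma v ^ (p / m) = 0. *)
pose En t := m ^+ 2 / 2 * Y 0 t ^+ 2 + m ^+ 2 / (p + m) * ZZ 0 t + n * m / 2 * Y 0 t.
pose G t := expR (n * t + 2 * m * F 0 t) * En t.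
(* Only a multiple of Z survives in the derivative of [G]; the sign of its coefficient is exactly
   subcriticality. *)
pose del := (n + kap) * m / (p + m) - n / 2.
have del0 : 0 < del.
  have -> : del = (2 * m * (n + kap) - n * (p + m)) / (2 * (p + m)).
    by rewrite /del; field; rewrite gt_eqF.
  by rewrite divr_gt0 ?mulr_gt0// subr_gt0.
pose G' t := expR (n * t + 2 * m * F 0 t) * (del * m * ZZ 0 t).
have G'0 t : 0 < G' t by apply: mulr_gt0; [exact: expR_gt0|apply: mulr_gt0; [exact: mulr_gt0|exact: ZZ_gt0]].
have dG t : hasD G t (G' t).
  rewrite /G /En; derive; rewrite /G' /del /=; field; rewrite gt_eqF//.
have G0 t : 0 <= G t.
  apply: (@cmpNy _ G G') => // [x _|]; first exact: ltW.
  pose CC := m ^+ 2 / 2 * M + `|n * m / 2|; pose CD := m ^+ 2 / (p + m).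
  apply: (@squeezeNy _ _ (fun x => CC * `|expR (n * x) * Y 0 x| + CD * (expR (n * x) * ZZ 0 x)) 0).
    move=> x _; have z0 := ltW (ZZ_gt0 0 x).
    have cd0 : 0 <= CD by rewrite /CD divr_ge0 ?sqr_ge0// ltW.
    have -> : CC * `|expR (n * x) * Y 0 x| + CD * (expR (n * x) * ZZ 0 x) =
      expR (n * x) * (CC * `|Y 0 x| + CD * ZZ 0 x).
      by rewrite normrM gtr0_norm ?expR_gt0//; ring.
    rewrite /G expRD -mulrA normrM gtr0_norm ?expR_gt0//.
    apply: ler_wpM2l; first exact: expR_ge0.
    rewrite normrM gtr0_norm ?expR_gt0//.
    have eF1 : expR (2 * m * F 0 x) <= 1.
      by rewrite -[leRHS]expR0 ler_expR mulr_ge0_le0 ?F_le0// mulr_ge0// ltW.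
    apply: (@le_trans _ _ `|En x|); first by rewrite ler_piMl.
    apply: (@le_trans _ _ (m ^+ 2 / 2 * (M * `|Y 0 x|) + CD * ZZ 0 x + `|n * m / 2| * `|Y 0 x|)).
      apply: le_trans (ler_normD _ _) _; rewrite [`|n * m / 2 * _|]normrM lerD2r.
      apply: le_trans (ler_normD _ _) _; apply: lerD; last by rewrite ger0_norm// mulr_ge0.
      rewrite normrM ger0_norm ?divr_ge0 ?sqr_ge0//.
      apply: ler_wpM2l; first by rewrite divr_ge0 ?sqr_ge0.
      rewrite normrX expr2; apply: ler_wpM2r => //.
      by rewrite ler_norml; have := YM x; have := Yle x; have := M0; lra.
    by rewrite /CC; move: `|Y 0 x| `|n * m / 2| => a b; lra.
  rewrite -[X in _ --> X](addr0 (0 : R)); apply: cvgD.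
    rewrite -[X in _ --> X](mulr0 CC); apply: cvgM; first exact: cvg_cst.
    by rewrite -[X in _ --> X](normr0 R); exact: cvg_norm.
  by rewrite -[X in _ --> X](mulr0 CD); apply: cvgM; first exact: cvg_cst.
have Gm s t : s <= t -> G s <= G t.
  by move=> st; apply: (@hasD_ge0 _ G G' s t st) => // x _; exact: ltW.
have g00 : 0 < G 0.
  have [||x _] := @hasD_MVT _ G G' (-1) 0; [lra| by move=> *; exact: dG|].
  by have := G'0 x; have := G0 (-1); rewrite sub0r opprK mulr1; lra.
(* By [Fup], e^(n t + 2 m F) is at most a multiple of e^(- nu t), and [nu] is positive by
   subcriticality once more. *)
pose nu := 2 * m * kap / (p - m) - n.
have nu0 : 0 < nu.
  have -> : nu = (2 * m * (n + kap) - n * (p + m)) / (p - m) by rewrite /nu; field; rewrite gt_eqF.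
  by rewrite divr_gt0// subr_gt0.
pose CE := m ^+ 2 / 2 * M ^+ 2 + m ^+ 2 / (p + m) * (m * k1)^-1 + `|n * m / 2| * M.
have M0' := M0.
have CE0 : 0 <= CE by rewrite /CE; nonneg.
have EnC t : En t <= CE.
  have ym : `|Y 0 t| <= M by rewrite ler_norml; have := YM t; have := Yle t; have := M0; lra.
  apply: lerD; last first.
    by apply: le_trans (ler_norm _) _; rewrite [`|_ * Y 0 t|]normrM; apply: ler_wpM2l; rewrite ?normr_ge0.
  apply: lerD; last by apply: ler_wpM2l; rewrite ?Zup// divr_ge0 ?sqr_ge0// ltW.
  apply: ler_wpM2l; first by rewrite divr_ge0 ?sqr_ge0.
  by rewrite -[Y 0 t ^+ 2]real_normK ?num_real// lerXn2r ?nnegrE// ltW.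
pose CF := CE * expR (2 * m * (- ln k1 / (p - m))).
have Gup t : G t <= CF * expR (- (nu * t)).
  apply: (@le_trans _ _ (expR (n * t + 2 * m * F 0 t) * CE)); first by rewrite ler_wpM2l ?expR_ge0.
  rewrite [leLHS]mulrC /CF -(mulrA CE); apply: ler_wpM2l => //; rewrite -expRD ler_expR.
  have : 2 * m * F 0 t <= 2 * m * ((- ln k1 - kap * t) / (p - m)).
    by rewrite ler_wpM2l//; nonneg.
  rewrite /nu (_ : 2 * m * ((- ln k1 - kap * t) / (p - m)) =
     2 * m * (- ln k1 / (p - m)) - 2 * m * kap / (p - m) * t); first by lra.
  by field; rewrite gt_eqF.
have CF0 : 0 <= CF by rewrite /CF; nonneg.
(* Late enough for 1 + nu t, a lower bound of e^(nu t), to exceed CF / G 0. *)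
pose t := CF / G 0 / nu.
have t0 : 0 <= t by rewrite /t; nonneg.
have := Gup t; have := Gm _ _ t0.
have e1 := expR_ge1Dx (nu * t).
have nt : nu * t = CF / G 0 by rewrite /t mulrC divfK// gt_eqF.
rewrite expRN => h1 h2; have := le_trans h1 h2; rewrite ler_pdivlMr ?expR_gt0//.
rewrite leNgt; move/negP; apply.
apply: (@lt_le_trans _ _ (G 0 * (1 + nu * t))); last by rewrite ler_wpM2l// ltW.
by rewrite nt mulrDr mulr1 mulrCA divff ?gt_eqF// mulr1 ltrDr.
Qed.

(** Up to a fixed time t1 the factor al + be c is at least al / 2, so the forcing is at least E
    times a positive multiple of e^(2 t), minus a term independent of E; after integration a large E
    wins. *)
Lemma large_goes_above : exists2 E, 0 < E & exists t, 0 < Y E t.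
Proof.
have [be0' B0' s00' m0'] := And4 be0 B0 s00 m0.
have nk := nk0; have n2 := n20; have al0' := al0.
pose s1 := Num.min s0 (al / (2 * (be * B))).
have s10 : 0 < s1 by rewrite lt_min s00/= divr_gt0// !mulr_gt0.
pose t1 := ln s1 / kap.
have et1 : expR (kap * t1) = s1 by rewrite /t1 mulrC divfK ?gt_eqF// lnK ?posrE.
pose k2 := m * B ^+ 2 * s0 + m^-1.
pose a := k2 / (n + kap) * expR ((n + kap) * t1).
pose b := al / (2 * m) / (n + 2) * expR ((n + 2) * t1).
have b0 : 0 < b by rewrite mulr_gt0 ?expR_gt0// !divr_gt0// mulr_gt0.
have a0 : 0 <= a by rewrite /a /k2; nonneg.
(* Makes the lower bound - a + E b at t1 equal to 1. *)
pose E := (a + 1) / b.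
have E0 : 0 < E by rewrite divr_gt0// ltr_wpDl.
exists E => //; exists t1; rewrite -W0.
suff : - a + E * b <= expR (n * t1) * Y E t1.
  by apply: lt_le_trans; rewrite /E divfK ?gt_eqF//; lra.
have dWe := dW (ltW E0).
apply: (@cmpNy_le _ (fun t => - (k2 / (n + kap) * expR ((n + kap) * t)) +
    E * (al / (2 * m) / (n + 2) * expR ((n + 2) * t))) (fun t => expR (n * t) * Y E t)
  (fun t => expR (n * t) * (- k2 * expR (kap * t) + E * (al / (2 * m) * expR (2 * t))))
  (fun t => expR (n * t) * Ga E t)) => //.
- move=> x _; derive.
  by rewrite (mulrDl n kap) (mulrDl n 2) !expRD; field; rewrite !gt_eqF.
- move=> x xt; apply: ler_wpM2l; first exact: expR_ge0.
  have us : expR (kap * x) <= s1 by rewrite -et1 ler_expR ler_wpM2l// ltW.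
  have us0 : expR (kap * x) <= s0 by apply: le_trans us _; rewrite ge_min lexx.
  have us2 : expR (kap * x) <= al / (2 * (be * B)).
    by apply: le_trans us _; rewrite ge_min lexx orbT.
  have u0 := expR_ge0 (kap * x); set u := expR (kap * x) in us us0 us2 u0 *.
  have Bu0 : 0 <= B * u by nonneg.
  have cB : - (B * u) <= c E x by apply: clamp_ge => //; exact: YB (ltW E0) us0.
  have /andP[_ cx0] := c_bounds E x.
  have half : al / 2 <= al + be * c E x.
    have h1 : be * (- (B * u)) <= be * c E x by rewrite ler_wpM2l// ltW.
    have h2 : be * B * u <= al / 2.
      have := ler_wpM2l (_ : 0 <= be * B) us2; rewrite mulr_ge0 ?(ltW be0) ?(ltW B0)// => /(_ isT).
      by rewrite (_ : be * B * (al / (2 * (be * B))) = al / 2)//; field; rewrite !gt_eqF.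
    by move: h1; rewrite mulrN mulrA; lra.
  have hX : E * expR (2 * x) / m <= XX E x.
    rewrite /XX /X ler_wpM2r ?invr_ge0 ?(ltW m0)// ler_wpM2l ?(ltW E0)// ler_expR lerDl oppr_ge0.
    by rewrite mulr_ge0_le0 ?F_le0 ?(ltW E0)// subr_ge0 ltW.
  have hXa : E * (al / (2 * m) * expR (2 * x)) <= XX E x * (al + be * c E x).
    have -> : E * (al / (2 * m) * expR (2 * x)) = E * expR (2 * x) / m * (al / 2).
      by field; rewrite gt_eqF.
    by apply: ler_pM => //; nonneg.
  have c2 : c E x ^+ 2 <= (B * u) ^+ 2.
    by rewrite -[c E x ^+ 2]sqrrN lerXn2r ?nnegrE ?oppr_ge0// lerNl.
  have c3 : m * c E x ^+ 2 <= m * B ^+ 2 * s0 * u.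
    have -> : m * B ^+ 2 * s0 * u = m * (B ^+ 2 * (s0 * u)) by ring.
    apply: ler_wpM2l; first exact: ltW.
    apply: le_trans c2 _; rewrite exprMn; apply: ler_wpM2l; first exact: sqr_ge0.
    by rewrite expr2; apply: ler_wpM2r.
  have hZ := ZZ_le x (ltW E0); rewrite -/u in hZ.
  move: hXa c3 hZ; rewrite /Ga /k2 mulNr.
  move: (XX E x * _) (E * _) (c E x ^+ 2) (ZZ E x) => v w d z; rewrite (mulrC u).
  by rewrite mulrDl; lra.
- rewrite -[X in _ --> X](addr0 (0 : R)); apply: cvgD.
    by rewrite -[X in _ --> X]oppr0; apply: cvgN; exact: scaled_expR_Ny.
  rewrite -[X in _ --> X](mulr0 E); apply: cvgM; first exact: cvg_cst.
  exact: scaled_expR_Ny.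
- exact: (Y0 (ltW E0)).
Qed.

Lemma near_param E e0 t d : 0 <= e0 <= E -> 0 < d -> exists2 r, 0 < r &
  forall e, 0 <= e <= E -> `|e - e0| < r -> `|Y e t - Y e0 t| < d.
Proof.
move=> he0 d0; have E0 : 0 <= E by have /andP[] := he0; exact: le_trans.
have [C C0 hC] := Ylip t E0.
exists (d / (C + 1)); first by rewrite divr_gt0// ltr_wpDl.
move=> e he; rewrite ltr_pdivlMr ?ltr_wpDl// => h.
apply: le_lt_trans (hC e e0 t he he0 (lexx _)) _; apply: le_lt_trans h.
by rewrite mulrC ler_wpM2l// lerDl.
Qed.

(** The parameter is the supremum e of those in [0, E] whose orbit goes below - M. If its orbit went
    below, so would those of slightly larger parameters (e = E is excluded, that orbit going above).
    If it went above 0, so would nearby members of the set, which also go below, and no orbit makes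
    both exits. As the orbit of 0 goes below, e is not 0. *)
Lemma connecting_parameter : exists2 e, 0 < e & forall t, - M <= Y e t <= 0.
Proof.
have [t1 ht1] := zero_goes_below.
have [E E0 [t2 ht2]] := large_goes_above.
have E0' := ltW E0.
pose A := [set e | 0 <= e <= E /\ exists t, Y e t < - M].
have A0 : A 0 by split; [rewrite lexx|exists t1].
have AE : ubound A E by move=> e [/andP[]].
have hs : has_sup A by split; [exists 0|exists E].
pose e := sup A.
have e_ge0 : 0 <= e by apply: sup_upper_bound.
have e_leE : e <= E by apply: ge_sup => //; exists 0.
have he : 0 <= e <= E by rewrite e_ge0.
have disj x t t' : 0 <= x -> Y x t < - M -> 0 < Y x t' -> False.
  move=> x0 yt yt'; have [tt'|/ltW tt'] := leP t t'.
    by have := stays_below x0 tt' yt; have := M0; lra.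
  by have := stays_positive x0 tt' yt'; have := M0; lra.
have notbelow t : - M <= Y e t.
  rewrite leNgt; apply/negP => yt.
  have d0 : 0 < - M - Y e t by lra.
  have [r r0 hr] := near_param t he d0.
  have [eE|Ee] := ltP e E; last first.
    have eE : e = E by apply/eqP; rewrite eq_le e_leE.
    by apply: (disj e t t2) => //; rewrite eE.
  pose d := Num.min (r / 2) (E - e).
  have d1 : 0 < d by rewrite lt_min; apply/andP; split; lra.
  have d2 : d <= r / 2 by rewrite ge_min lexx.
  have d3 : d <= E - e by rewrite ge_min lexx orbT.
  have : e + d <= e; last by lra.
  apply: sup_upper_bound => //; split; first by lra.
  exists t; have := hr (e + d); rewrite [e + d - e]addrC addKr gtr0_norm//.
  have h1 : 0 <= e + d <= E by lra.
  have h2 : d < r by lra.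
  by move=> /(_ h1 h2); have := ler_norm (Y (e + d) t - Y e t); lra.
have notabove t : Y e t <= 0.
  rewrite leNgt; apply/negP => yt.
  have [r r0 hr] := near_param t he yt.
  have [x [hx [s hxs]] ex] := sup_adherent r0 hs; rewrite -/e in ex.
  have xe : x <= e by apply: sup_upper_bound => //; split => //; exists s.
  have /andP[x0 _] := hx.
  apply: (disj x s t) => //.
  have : `|x - e| < r by rewrite ler0_norm; lra.
  by move=> /(hr _ hx); have := ler_norm (- (Y x t - Y e t)); rewrite normrN; lra.
exists e; last by move=> t; rewrite notbelow notabove.
rewrite lt_neqAle e_ge0 andbT; apply/eqP => eE.
by have := notbelow t1; rewrite -eE; lra.
Qed.

End Shooting.

(** * Asymptotics of the connecting orbit *)

Section Orbit.
Context {R : realType}.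
Variables n kap m p al be : R.
Hypothesis kap0 : 0 < kap.
Hypothesis kap2 : kap < 2.
Hypothesis nk0 : 0 < n + kap.
Hypothesis n20 : 0 < n + 2.
Hypothesis m1 : 1 < m.
Hypothesis mp : m < p.
Hypothesis al0 : 0 < al.
Hypothesis be0 : 0 < be.
Hypothesis subcrit : n * (p + m) < 2 * m * (n + kap).

Let m0 : 0 < m. Proof. exact: lt_trans m1. Qed.
Let pm0 : 0 < p - m. Proof. by rewrite subr_gt0. Qed.

Definition orbit (eps M C : R) (y phi : R -> R) :=
  [/\ forall t, hasD phi t (y t), phi t @[t --> -oo] --> (0 : R),
      forall t, hasD y t (- n * y t - m * y t ^+ 2 + X m eps phi t * (al + be * y t) - Z kap m p phi t),
      forall t, - M <= y t <= 0 & forall t, `|y t| <= C * expR (kap * t)].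

Lemma orbit_exists : exists eps M C y phi, [/\ 0 < eps, 0 < M & orbit eps M C y phi].
Proof.
have k0 := kap0; have nk := nk0; have m0' := m0; have al0' := al0; have be0' := be0.
(* The sum of the two lower bounds demanded by [alM] and [nM]. *)
pose M := al / be + `|n| / m.
have ab0 : 0 < al / be by rewrite divr_gt0.
have nm0 : 0 <= `|n| / m by nonneg.
have M0 : 0 < M by rewrite ltr_wpDr.
(* Twice the coefficient of the true expansion of y: B (n + kap) = 2 / m leaves 1 / m for Z and, by
   the first entry of [s0], 1 / m for m B ^ 2 s0. The second entry of [s0] keeps al + be y
   nonnegative on the barrier. *)
pose B := 2 / (m * (n + kap)).
have B0 : 0 < B by rewrite divr_gt0// mulr_gt0.
pose s0 := Num.min ((m * B) ^- 2) (al / (be * B)).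
have s00 : 0 < s0.
  rewrite lt_min; apply/andP; split; first by rewrite invr_gt0 exprn_gt0// mulr_gt0.
  by rewrite divr_gt0// mulr_gt0.
have s01 : s0 <= (m * B) ^- 2 by rewrite ge_min lexx.
have s02 : s0 <= al / (be * B) by rewrite ge_min lexx orbT.
have alM : al <= be * M.
  rewrite /M mulrDr (_ : be * (al / be) = al) ?lerDl; first by nonneg.
  by field; rewrite gt_eqF.
have nM : n <= m * M.
  rewrite /M mulrDr (_ : m * (`|n| / m) = `|n|); last by field; rewrite gt_eqF.
  by apply: le_trans (ler_norm _) _; rewrite lerDr; nonneg.
have BM : B * s0 <= M.
  apply: (@le_trans _ _ (B * (al / (be * B)))); first by rewrite ler_wpM2l// ltW.
  rewrite (_ : B * (al / (be * B)) = al / be); last by field; rewrite !gt_eqF.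
  by rewrite lerDl.
have Bal : B * s0 * be <= al.
  apply: (@le_trans _ _ (be * B * (al / (be * B)))).
    rewrite (_ : B * s0 * be = be * B * s0); last by ring.
    by rewrite ler_wpM2l//; nonneg.
  by rewrite mulrC divfK// gt_eqF// mulr_gt0.
have B1 : m * B ^+ 2 * s0 + m^-1 <= B * (n + kap).
  have : m * B ^+ 2 * s0 <= m * B ^+ 2 * (m * B) ^- 2 by rewrite ler_wpM2l//; nonneg.
  rewrite (_ : m * B ^+ 2 * (m * B) ^- 2 = m^-1); last by field; rewrite !gt_eqF.
  rewrite (_ : B * (n + kap) = m^-1 + m^-1); first by lra.
  by rewrite /B; field; rewrite !gt_eqF.
have [Y [YT Ylip YB]] := fixed_point_family kap0 kap2 nk0 m1 mp al0 be0 M0 s00.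
pose F e := Phi kap M s0 (Y e).
have cY e : 0 <= e -> continuous (Y e) by move=> e0; have [] := YT e e0.
have YE e : 0 <= e -> T n kap m p al be M s0 e (Y e) = Y e.
  by move=> e0; apply/funext; have [] := YT e e0.
have TPe e (e0 : 0 <= e) := TP kap0 kap2 nk0 m1 mp al0 be0 M0 s00 e0 (cY e e0).
have dF e : 0 <= e -> forall t, hasD (F e) t (yc kap M s0 (Y e) t).
  by move=> e0; have [] := PhiP kap0 M0 s00 (cY e e0).
have F0 e : 0 <= e -> F e t @[t --> -oo] --> (0 : R).
  by move=> e0; have [] := PhiP kap0 M0 s00 (cY e e0).
have Fle e t : 0 <= e -> F e t <= 0 by move=> e0; exact: Phi_le0 (cY e e0).
have dY e : 0 <= e -> forall t, hasD (Y e) t (- n * Y e t + Gam kap m p al be M s0 e (Y e) t).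
  by move=> e0; have [d _ _] := TPe e e0; rewrite YE in d.
have Y0 e : 0 <= e -> expR (n * t) * Y e t @[t --> -oo] --> (0 : R).
  by move=> e0; have [_ _ d] := TPe e e0; rewrite YE in d.
have [e e0 he] := connecting_parameter kap0 kap2 nk0 n20 m1 mp al0 be0 M0 s00 B0 alM nM BM
  subcrit cY dF F0 Fle dY Y0 (YB B B0 Bal B1) Ylip.
have e0' := ltW e0.
have cE : forall t, yc kap M s0 (Y e) t = Y e t.
  exact: (clamp_inactive M0 s00 B0 BM (fun e t e0 h => YB B B0 Bal B1 e t e0 h) e0' he).
exists e, M, (M / s0), (Y e), (F e); split => //; split => //.
- by move=> t; rewrite -cE; exact: dF.
- exact: F0.
- by move=> t; apply: (hasD_eq (dY e e0' t)); rewrite /Gam cE -/(F e); ring.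
- by move=> t; rewrite -cE; exact: yc_norm.
Qed.

Variables (eps M C : R) (y phi : R -> R).
Hypothesis eps0 : 0 < eps.
Hypothesis M0 : 0 < M.
Hypothesis orb : orbit eps M C y phi.

Let C0 : 0 <= C.
Proof.
have [_ _ _ _ /(_ 0)] := orb.
by rewrite mulr0 expR0 mulr1; apply: le_trans; exact: normr_ge0.
Qed.

Lemma orbit_phi_le0 t : phi t <= 0.
Proof.
have [d l _ yM _] := orb.
apply: (@cmpNy_le _ phi (fun=> 0) y (fun=> 0)) => // [s _|s _|].
- exact: hasD_cst.
- by have /andP[] := yM s.
- exact: cvg_cst.
Qed.

Lemma orbit_phi_norm t : `|phi t| <= C / kap * expR (kap * t).
Proof.
have [d l _ _ yC] := orb.
apply: (@cmpNy_norm _ phi (fun t => C / kap * expR (kap * t)) y (fun t => C * expR (kap * t))) => //.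
- by move=> s _; apply: (hasD_eq (hasD_scaled_exp _ _ _)); field; rewrite gt_eqF.
- exact: scaled_expR_Ny.
Qed.

Let exp_sub1 (k b t : R) : 0 <= k -> t <= 0 -> b = k * phi t \/ b = - (k * phi t) ->
  `|expR b - 1| <= expR (k * (C / kap)) * (k * (C / kap)) * expR (kap * t).
Proof.
move=> k0 t0 hb.
have Ck : 0 <= C / kap by rewrite divr_ge0// ltW.
have nb : `|b| <= k * (C / kap) * expR (kap * t).
  have -> : `|b| = k * `|phi t| by case: hb => ->; rewrite ?normrN normrM (ger0_norm k0).
  by rewrite -mulrA ler_wpM2l// orbit_phi_norm.
have e1 : expR (kap * t) <= 1 by rewrite -[leRHS]expR0 ler_expR mulr_ge0_le0// ltW.
have bk : b <= k * (C / kap).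
  apply: le_trans (ler_norm _) _; apply: le_trans nb _.
  by rewrite ler_piMr//; nonneg.
have k1 : 0 <= k * (C / kap) by nonneg.
have := expR_lip bk k1; rewrite expR0 subr0 => /le_trans; apply.
by rewrite -mulrA ler_wpM2l ?expR_ge0.
Qed.

(** Remainders come at two rates, 2 kap from terms quadratic in the leading order and 2 from X; both
    exceed kap. Used with q = n for y and q = 0 for phi. *)
Let two_scale (q : R) (G g : R -> R) (K1 K2 : R) : 0 < q + 2 * kap -> 0 < q + 2 ->
  (forall t, t <= 0 -> hasD G t (g t)) -> G t @[t --> -oo] --> (0 : R) ->
  (forall t, t <= 0 -> `|g t| <= K1 * expR ((q + 2 * kap) * t) + K2 * expR ((q + 2) * t)) ->
  forall t, t <= 0 -> `|G t| <=
    K1 / (q + 2 * kap) * expR ((q + 2 * kap) * t) + K2 / (q + 2) * expR ((q + 2) * t).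
Proof.
move=> q1 q2 dG lG hg t t0.
apply: (@cmpNy_norm _ G (fun t => K1 / (q + 2 * kap) * expR ((q + 2 * kap) * t) +
   K2 / (q + 2) * expR ((q + 2) * t)) g
   (fun t => K1 * expR ((q + 2 * kap) * t) + K2 * expR ((q + 2) * t))) => //.
- by move=> s st; apply: dG; exact: le_trans t0.
- by move=> s st; derive; field; rewrite !gt_eqF.
- by move=> s st; apply: hg; exact: le_trans t0.
- by rewrite -[X in _ --> X](addr0 (0 : R)); apply: cvgD; exact: scaled_expR_Ny.
Qed.

Let a0 := (m * (n + kap))^-1.

(** With this [a0], the leading part e^(kap t) / m of Z disappears from the equation for y + a0
    e^(kap t). What is left is m y ^ 2 and the variation of e^((p - m) phi), of order e^(2 kap t),
    and the X term, of order e^(2 t). *)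
Lemma orbit_y_expansion : exists K1 K2, forall t, t <= 0 ->
  `|y t + a0 * expR (kap * t)| <= K1 * expR (2 * kap * t) + K2 * expR (2 * t).
Proof.
have [dphi phi0 dy yM yC] := orb.
have k0 := kap0; have nk := nk0; have m0' := m0; have al0' := al0; have be0' := be0; have C0' := C0.
have n2 := n20; have e0 := eps0.
pose KZ := expR ((p - m) * (C / kap)) * ((p - m) * (C / kap)) / m.
pose KX := eps / m * expR ((m - 1) * (C / kap)) * (al + be * M).
pose K1 := m * C ^+ 2 + KZ.
have q1 : 0 < n + 2 * kap by have := nk0; have := kap0; lra.
exists (K1 / (n + 2 * kap)), (KX / (n + 2)) => t t0.
suff : `|expR (n * t) * (y t + a0 * expR (kap * t))| <=
  K1 / (n + 2 * kap) * expR ((n + 2 * kap) * t) + KX / (n + 2) * expR ((n + 2) * t).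
  rewrite normrM gtr0_norm ?expR_gt0// (mulrDl n (2 * kap)) (mulrDl n 2) !expRD.
  by rewrite (mulrCA (K1 / _)) (mulrCA (KX / _)) -mulrDr ler_pM2l ?expR_gt0.
apply: (@two_scale n (fun t => expR (n * t) * (y t + a0 * expR (kap * t))) (fun t => expR (n * t) * (- m * y t ^+ 2 +
   X m eps phi t * (al + be * y t) + (expR (kap * t) / m - Z kap m p phi t)))) => //.
- move=> s s0; derive; rewrite /a0; field; rewrite !gt_eqF//.
- apply: (@squeezeNy _ _ (fun t => (C + a0) * expR ((n + kap) * t)) 0); last exact: scaled_expR_Ny.
  move=> s _; rewrite normrM gtr0_norm ?expR_gt0// (mulrDl n kap) expRD [leRHS]mulrCA.
  apply: ler_wpM2l; first exact: expR_ge0.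
  apply: le_trans (ler_normD _ _) _; rewrite mulrDl lerD// ger0_norm// /a0; nonneg.
- move=> s s0; rewrite normrM gtr0_norm ?expR_gt0//.
  rewrite (mulrDl n (2 * kap)) (mulrDl n 2) !expRD (mulrCA K1) (mulrCA KX) -mulrDr.
  apply: ler_wpM2l; first exact: expR_ge0.
  have u2 : expR (2 * kap * s) = expR (kap * s) ^+ 2.
    by rewrite expr2 -expRD; congr expR; ring.
  have u0 := expR_ge0 (kap * s).
  have T1 : `|- m * y s ^+ 2| <= m * C ^+ 2 * expR (2 * kap * s).
    rewrite normrM normrN (gtr0_norm m0) u2 -mulrA -exprMn normrX.
    by apply: ler_wpM2l; [exact: ltW|rewrite lerXn2r ?nnegrE ?mulr_ge0].
  have T2 : `|X m eps phi s * (al + be * y s)| <= KX * expR (2 * s).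
    have hX : `|X m eps phi s| <= eps / m * expR ((m - 1) * (C / kap)) * expR (2 * s).
      rewrite ger0_norm; last by rewrite /X; nonneg.
      rewrite X_split -!mulrA; apply: ler_wpM2l; first by nonneg.
      apply: ler_wpM2l; first by nonneg.
      rewrite mulrC; apply: ler_wpM2r; first by nonneg.
      rewrite ler_expR mulNr -mulrN; apply: ler_wpM2l; first by rewrite subr_ge0 ltW.
      apply: le_trans (ler_norm _) _; rewrite normrN; apply: le_trans (orbit_phi_norm _) _.
      rewrite ler_piMr ?divr_ge0 ?(ltW k0)// -[leRHS]expR0 ler_expR mulr_ge0_le0 ?(ltW k0)//.
    rewrite normrM /KX mulrAC; apply: ler_pM => //.
    apply: le_trans (ler_normD _ _) _; rewrite gtr0_norm// lerD2l normrM gtr0_norm//.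
    apply: ler_wpM2l; first exact: ltW.
    by rewrite ler_norml; have := yM s; have := M0; lra.
  have T3 : `|expR (kap * s) / m - Z kap m p phi s| <= KZ * expR (2 * kap * s).
    rewrite Z_split (_ : _ - _ = - (expR (kap * s) / m * (expR ((p - m) * phi s) - 1))); last by ring.
    have pm : 0 <= p - m by rewrite ltW.
    have h := exp_sub1 pm s0 (or_introl erefl).
    rewrite normrN normrM ger0_norm; last by nonneg.
    rewrite /KZ u2.
    apply: le_trans (ler_wpM2l _ h) _; first by nonneg.
    by rewrite le_eqVlt; apply/orP; left; apply/eqP; ring.
  apply: le_trans (ler_normD _ _) _; apply: le_trans (lerD (ler_normD _ _) (lexx _)) _.
  by rewrite /K1; move: T1 T2 T3; move: `|_| `|_| `|_| (expR (2 * s)) (expR (2 * kap * s)) => a b c d e; lra.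
Qed.

(** Up to normalization e^(- (p - m) phi) is f ^ (- (p - m)). Its derivative is - (p - m) y to
    leading order, so the expansion of y is integrated once more. *)
Lemma orbit_phi_expansion : exists K1 K2, forall t, t <= 0 ->
  `|expR (- (p - m) * phi t) - 1 - (p - m) / (m * (n + kap) * kap) * expR (kap * t)| <=
    K1 * expR (2 * kap * t) + K2 * expR (2 * t).
Proof.
have [dphi phi0 dy yM yC] := orb.
have k0 := kap0; have nk := nk0; have m0' := m0; have C0' := C0; have pm0' := pm0.
have [L1 [L2 hL]] := orbit_y_expansion.
pose KE := expR ((p - m) * (C / kap)) * ((p - m) * (C / kap)).
pose K1 := (p - m) * (L1 + C * KE); pose K2 := (p - m) * L2.
exists (K1 / (2 * kap)), (K2 / 2) => t t0.
suff : `|expR (- (p - m) * phi t) - 1 - (p - m) / (m * (n + kap) * kap) * expR (kap * t)| <=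
    K1 / (0 + 2 * kap) * expR ((0 + 2 * kap) * t) + K2 / (0 + 2) * expR ((0 + 2) * t).
  by rewrite !add0r.
have q1 : 0 < 0 + 2 * kap by rewrite add0r mulr_gt0.
have q2 : 0 < 0 + 2 :> R by rewrite add0r.
refine (@two_scale 0 (fun t => expR (- (p - m) * phi t) - 1 -
   (p - m) / (m * (n + kap) * kap) * expR (kap * t))
  (fun t => - (p - m) * ((y t + a0 * expR (kap * t)) + y t * (expR (- (p - m) * phi t) - 1))) K1 K2 q1 q2 _ _ _ t t0).
- by move=> s s0; derive; rewrite /a0; field; rewrite !gt_eqF.
- have l0 : - (p - m) * phi x @[x --> -oo] --> - (p - m) * 0.
    by apply: cvgM; [exact: cvg_cst|exact: phi0].
  rewrite mulr0 in l0.
  apply: cvg0B; last exact: scaled_expR_Ny.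
  rewrite -[X in _ --> X](subrr (1 : R)); apply: cvgB; last exact: cvg_cst.
  by rewrite -[X in _ --> X]expR0; exact: (continuous_cvg _ (@continuous_expR R 0) l0).
- move=> s s0; rewrite !add0r normrM normrN (gtr0_norm pm0).
  have pm : 0 <= p - m by rewrite ltW.
  have h := @exp_sub1 (p - m) (- (p - m) * phi s) s pm s0.
  have {}h := h (or_intror (mulNr _ _)).
  have u2 : expR (2 * kap * s) = expR (kap * s) * expR (kap * s).
    by rewrite -expRD; congr expR; ring.
  rewrite /K1 /K2 -(mulrA (p - m) (L1 + _)) -(mulrA (p - m) L2) -mulrDr; apply: ler_wpM2l => //.
  apply: le_trans (ler_normD _ _) _.
  have h3 : `|y s * (expR (- (p - m) * phi s) - 1)| <= C * KE * expR (2 * kap * s).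
    rewrite normrM u2; apply: (@le_trans _ _ (C * expR (kap * s) * (KE * expR (kap * s)))).
      exact: ler_pM.
    by rewrite le_eqVlt; apply/orP; left; apply/eqP; ring.
  by move: (hL s s0) h3; move: `|_| `|_| => a b; lra.
Qed.

(** A slope bound valid only above the level [L] suffices, since the function cannot come back down
    to [L]. Applied to y and to - y, it contradicts boundedness. *)
Lemma escape (f f' : R -> R) (a L : R) : (forall t, hasD f t (f' t)) ->
  (forall t, a <= t -> L <= f t -> 1 <= f' t) -> L < f a ->
  forall t, a <= t -> f a + (t - a) <= f t.
Proof.
move=> df hf La.
have cf : continuous (fun t => f t - L).
  have cf := hasD_cont_all df.
  by move=> x; change (ctsat (fun t => f t - L) x); continuity.
have above t : a <= t -> L < f t.
  move=> at_; rewrite ltNge; apply/negP => ft.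
  have [||r /andP[ar rt] [fr hr]] := first_zero cf at_; try lra.
  have : f a <= f r.
    apply: (@hasD_ge0 _ f f' _ _ ar) => // x /andP[ax xr].
    apply: le_trans ler01 _; apply: hf => //.
    have [xr'|rx] := ltP x r; first by have := hr x; rewrite ax xr' => /(_ isT); lra.
    have -> : x = r by apply/eqP; rewrite eq_le xr.
    by lra.
  by lra.
move=> t at_.
have := @hasD_le _ (fun x => x) f (fun=> 1) f' a t at_ (fun x _ => @hasD_id _ x) (fun x _ => df x).
have hx x : a <= x <= t -> 1 <= f' x by move=> /andP[ax _]; apply: hf => //; exact: ltW (above x ax).
by move=> /(_ hx); lra.
Qed.

Let sigma := kap - 2.

(* X grows like e ^ (2 t), so y would leave [- M, 0] were al + be y not O(Z / X). *)
Lemma orbit_slow_manifold : exists2 K, 0 <= K &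
  forall t, 0 <= t -> `|al + be * y t| <= K * expR (sigma * t).
Proof.
have [dphi phi0 dy yM yC] := orb.
have m0' := m0; have e0 := eps0; have be0' := be0; have al0' := al0; have M0' := M0.
have ie0 : 0 < eps^-1 by rewrite invr_gt0.
pose K0 := `|n| * M + m * M ^+ 2.
have K00 : 0 <= K0 by rewrite /K0; nonneg.
(* The part 1 / eps beats Z, as Z <= X e^(sigma t) / eps. The other part beats the terms bounded by
   [K0] and leaves a slope of 1, as X >= eps e^(2 t) / m and 2 t + sigma t1 >= 0 for t >= t1 >=
   0. *)
pose K := eps^-1 + (K0 + 1) * m / eps.
have K_ge0 : 0 <= K by rewrite /K; nonneg.
have lin t : `|- n * y t - m * y t ^+ 2| <= K0.
  have ym : `|y t| <= M by rewrite ler_norml; have := yM t; lra.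
  apply: le_trans (ler_normB _ _) _; apply: lerD.
    by rewrite normrM normrN ler_wpM2l.
  rewrite normrM (gtr0_norm m0') normrX; apply: ler_wpM2l; first exact: ltW.
  by rewrite lerXn2r ?nnegrE// ltW.
have XL t : eps / m * expR (2 * t) <= X m eps phi t.
  rewrite /X mulrAC ler_wpM2r ?invr_ge0 ?(ltW m0')// ler_wpM2l ?(ltW e0)// ler_expR lerDl oppr_ge0.
  by rewrite mulr_ge0_le0 ?orbit_phi_le0// subr_ge0 ltW.
have X0 t : 0 <= X m eps phi t by rewrite /X; nonneg.
have ZX t : 0 <= Z kap m p phi t <= X m eps phi t * (expR (sigma * t) / eps).
  apply/andP; split; first by rewrite /Z; nonneg.
  rewrite /X /Z; have -> : eps * expR (2 * t - (m - 1) * phi t) / m * (expR (sigma * t) / eps) =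
     expR (sigma * t) * expR (2 * t - (m - 1) * phi t) / m by field; rewrite !gt_eqF.
  rewrite ler_wpM2r ?invr_ge0 ?(ltW m0')// -expRD ler_expR /sigma.
  suff : (p - m) * phi t + (m - 1) * phi t <= 0 by lra.
  by rewrite -mulrDl mulr_ge0_le0 ?orbit_phi_le0//; have := m1; have := mp; lra.
have sdec s t : s <= t -> expR (sigma * t) <= expR (sigma * s).
  by move=> st; rewrite ler_expR ler_wnM2l// /sigma; have := kap2; lra.
have big t1 t : 0 <= t1 -> t1 <= t -> (K0 + 1) <= X m eps phi t * ((K0 + 1) * m / eps * expR (sigma * t1)).
  move=> t10 t1t.
  have h1 : 1 <= expR (2 * t) * expR (sigma * t1).
    rewrite -expRD -[leLHS]expR0 ler_expR /sigma.
    have : 0 <= kap * t1 by rewrite mulr_ge0// ltW.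
    by lra.
  apply: (@le_trans _ _ (eps / m * expR (2 * t) * ((K0 + 1) * m / eps * expR (sigma * t1)))).
    have -> : eps / m * expR (2 * t) * ((K0 + 1) * m / eps * expR (sigma * t1)) =
      (K0 + 1) * (expR (2 * t) * expR (sigma * t1)) by field; rewrite !gt_eqF.
    by rewrite ler_peMr//; nonneg.
  by apply: ler_wpM2r => //; nonneg.
have K1 : 0 <= K0 + 1 by nonneg.
exists K => // t1 t10; rewrite ler_norml; apply/andP; split; rewrite leNgt; apply/negP => hy.
  pose L := (K * expR (sigma * t1) + al) / be.
  have h : forall t, t1 <= t -> L <= - y t -> 1 <= - (- n * y t - m * y t ^+ 2 +
      X m eps phi t * (al + be * y t) - Z kap m p phi t).
    move=> t t1t; rewrite /L ler_pdivrMr// => hL.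
    have h1 := lin t; have /andP[h2 _] := ZX t; have h3 := big _ _ t10 t1t.
    have h4 : X m eps phi t * (K * expR (sigma * t1)) <= X m eps phi t * - (al + be * y t).
      by rewrite ler_wpM2l//; lra.
    have h5 : X m eps phi t * ((K0 + 1) * m / eps * expR (sigma * t1)) <=
       X m eps phi t * (K * expR (sigma * t1)).
      apply: ler_wpM2l => //; apply: ler_wpM2r; first exact: expR_ge0.
      by rewrite /K lerDr ltW.
    move: h1; rewrite ler_norml => /andP[_ h1].
    move: h4; rewrite mulrN; move: h1 h2 h3 h5; move: (X m eps phi t * _) (X m eps phi t * _) (X m eps phi t * _) => a b c.
    by lra.
  have Ly : L < - y t1 by rewrite /L ltr_pdivrMr//; lra.
  (* After this lapse, a slope of at least 1 would have carried y out of [- M, 0]. *)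
  have t1M : t1 <= t1 + (M + 1) by lra.
  have := escape (fun t => hasDN (dy t)) h Ly t1M.
  by have := yM (t1 + (M + 1)); have := yM t1; lra.
pose L := (K * expR (sigma * t1) - al) / be.
have h : forall t, t1 <= t -> L <= y t -> 1 <= (- n * y t - m * y t ^+ 2 +
    X m eps phi t * (al + be * y t) - Z kap m p phi t).
  move=> t t1t; rewrite /L ler_pdivrMr// => hL.
  have h1 := lin t; have /andP[_ h2] := ZX t; have h3 := big _ _ t10 t1t.
  have h4 : X m eps phi t * (K * expR (sigma * t1)) <= X m eps phi t * (al + be * y t).
    by rewrite ler_wpM2l//; lra.
  have h6 : X m eps phi t * (expR (sigma * t) / eps) <= X m eps phi t * (expR (sigma * t1) / eps).
    by apply: ler_wpM2l => //; apply: ler_wpM2r; [exact: ltW|exact: sdec].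
  have h5 : X m eps phi t * (K * expR (sigma * t1)) =
     X m eps phi t * ((K0 + 1) * m / eps * expR (sigma * t1)) + X m eps phi t * (expR (sigma * t1) / eps).
    by rewrite /K; ring.
  move: h1; rewrite ler_norml => /andP[h1 _].
  move: h4 h1 h2 h3 h5 h6; move: (X m eps phi t * _) (X m eps phi t * _) (X m eps phi t * _)
    (X m eps phi t * _) (X m eps phi t * _) => a b c d f.
  by lra.
have Ly : L < y t1 by rewrite /L ltr_pdivrMr//; lra.
have t1M : t1 <= t1 + (M + 1) by lra.
have := escape dy h Ly t1M.
by have := yM (t1 + (M + 1)); have := yM t1; lra.
Qed.

(** The derivative (al + be y) / be is O(e^(sigma t)) with sigma < 0, hence integrable at +oo.
    Reflecting t turns this into a case of [primitiveNy], and the reflected function differs from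
    the primitive found there by a constant. *)
Lemma orbit_phi_infty : exists l, phi t + al / be * t @[t --> +oo] --> (l : R).
Proof.
have [dphi phi0 dy yM yC] := orb.
have [K K0 hK] := orbit_slow_manifold.
have be0' := be0.
have cy := hasD_cont_all dy.
pose g t := - (y (- t) + al / be).
pose psi t := phi (- t) + al / be * (- t).
have cg : continuous g.
  have cyo : continuous (fun t => y (- t)).
    by move=> t; apply: (@ctsat_comp _ y (fun t => - t)); [exact: cy|exact: (ctsatN (@ctsat_id _ t))].
  by move=> t; change (ctsat g t); rewrite /g; continuity.
have dpsi t : hasD psi t (g t).
  have dpo s : hasD (fun t => phi (- t)) s (y (- s) * - 1).
    by apply: (@hasD_comp _ phi (fun t => - t)); [exact: dphi|exact: (hasDN (@hasD_id _ s))].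
  by rewrite /psi; derive; rewrite /g; ring.
have s0 : 0 < - sigma by rewrite /sigma; have := kap2; lra.
have [|G dG G0] := primitiveNy s0 cg.
  exists (K / be), 0 => t t0.
  have t0' : 0 <= - t by lra.
  have := hK _ t0'; rewrite mulrN -mulNr => h.
  rewrite /g normrN (_ : y (- t) + al / be = (al + be * y (- t)) / be); last by field; rewrite gt_eqF.
  by rewrite normrM (gtr0_norm (_ : 0 < be^-1)) ?invr_gt0// mulrAC ler_wpM2r// invr_ge0 ltW.
have E t : psi t = (psi 0 - G 0) + G t.
  have [t0|/ltW t0] := leP 0 t.
    have h1 := @hasD_le _ psi G g g 0 t t0 (fun t _ => dpsi t) (fun t _ => dG t) (fun t _ => lexx _).
    have h2 := @hasD_le _ G psi g g 0 t t0 (fun t _ => dG t) (fun t _ => dpsi t) (fun t _ => lexx _).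
    lra.
  have h1 := @hasD_le _ psi G g g t 0 t0 (fun t _ => dpsi t) (fun t _ => dG t) (fun t _ => lexx _).
  have h2 := @hasD_le _ G psi g g t 0 t0 (fun t _ => dG t) (fun t _ => dpsi t) (fun t _ => lexx _).
  lra.
exists (psi 0 - G 0); apply/cvgy_compNP.
have -> : (fun t => phi t + al / be * t) \o -%R = (fun t => (psi 0 - G 0) + G t).
  by apply/funext => t /=; rewrite -E.
have H : (psi 0 - G 0) + G t @[t --> -oo] --> (psi 0 - G 0) + 0.
  by apply: cvgD => //; exact: cvg_cst.
by rewrite addr0 in H.
Qed.

End Orbit.

(** * The profile *)

Section LogProfile.
Context {R : realType}.
Variables n kap m p al be : R.
Hypothesis kap0 : 0 < kap.
Hypothesis kap2 : kap < 2.
Hypothesis nk0 : 0 < n + kap.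
Hypothesis n20 : 0 < n + 2.
Hypothesis m1 : 1 < m.
Hypothesis mp : m < p.
Hypothesis al0 : 0 < al.
Hypothesis be0 : 0 < be.
Hypothesis subcrit : n * (p + m) < 2 * m * (n + kap).

(* [u] and [w] are ln f and xi f' / f as functions of ln xi. *)
Record log_profile (u w : R -> R) (lA M C : R) : Prop := LogProfile {
  lp_M : 0 < M;
  lp_C : 0 <= C;
  lp_u : forall t, hasD u t (w t);
  lp_w : forall t, hasD w t (- n * w t - m * w t ^+ 2 +
    expR (2 * t + (1 - m) * u t) / m * (al + be * w t) - expR (kap * t + (p - m) * u t) / m);
  lp_uNy : u t @[t --> -oo] --> lA;
  lp_ule : forall t, u t <= lA;
  lp_wM : forall t, - M <= w t <= 0;
  lp_wC : forall t, `|w t| <= C * expR (kap * t)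
}.

Lemma log_profile_exists : exists u w lA M C, [/\ log_profile u w lA M C,
  exists K1 K2 b, forall t, t <= b ->
    `|expR (- (p - m) * u t) - expR (- (p - m) * lA) - (p - m) / (m * (n + kap) * kap) * expR (kap * t)| <=
    K1 * expR (2 * kap * t) + K2 * expR (2 * t) &
  exists l, u t + al / be * t @[t --> +oo] --> (l : R)].
Proof.
have [eps [M [C [y [phi [e0 M0 orb]]]]]] := orbit_exists kap0 kap2 nk0 n20 m1 mp al0 be0 subcrit.
have [dphi phi0 dy yM yC] := orb.
have k0 := kap0; have m1' := m1; have mp' := mp; have be0' := be0; have al0' := al0.
have m0 : 0 < m by lra.
pose L := (m - 1) * kap + 2 * (p - m).
have L0 : 0 < L by rewrite addr_gt0// mulr_gt0//; lra.
(* The logarithm [lA] of f 0 and the time shift [tA] solve the two equations [ktA] and [etA], which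
   leave the reaction term unchanged and turn the coefficient [eps] of X into 1. For kap = sigma +
   2, [L] is the denominator of the self-similar exponents. *)
pose lA := - (kap / L) * ln eps.
pose tA := (p - m) / kap * lA.
have ktA : kap * tA = (p - m) * lA by rewrite /tA; field; rewrite gt_eqF.
have etA : ln eps + 2 * tA = (1 - m) * lA.
  rewrite /tA /lA /L; field; rewrite !gt_eqF//; exact: L0.
have C0 : 0 <= C.
  by have := yC 0; rewrite mulr0 expR0 mulr1; apply: le_trans; exact: normr_ge0.
pose u t := lA + phi (t + tA); pose w t := y (t + tA).
have ds t : hasD (fun t => t + tA) t 1.
  by apply: (hasD_eq (hasDD (@hasD_id _ t) (@hasD_cst _ tA t))); rewrite addr0.
have dps t : hasD (fun t => phi (t + tA)) t (y (t + tA)).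
  by apply: (hasD_eq (hasD_comp (dphi _) (ds t))); rewrite mulr1.
have shiftNy : (fun t : R => t + tA) t @[t --> -oo] --> -oo.
  apply/cvgrNyPle => B; near=> t.
  suff : t <= B - tA by lra.
  by near: t; apply: nbhs_ninfty_le; rewrite num_real.
exists u, w, lA, M, (C * expR (kap * tA)); split.
- split.
  + exact: M0.
  + by nonneg.
  + by move=> t; rewrite /u; derive; rewrite add0r.
  + move=> t; apply: (hasD_eq (hasD_comp (dy _) (ds t))); rewrite mulr1 /w /X /Z /u.
    have E1 : eps * expR (2 * (t + tA) - (m - 1) * phi (t + tA)) =
        expR (2 * t + (1 - m) * (lA + phi (t + tA))).
      rewrite -{1}(lnK (x := eps)) ?posrE// -expRD; congr expR.
      by rewrite mulrDr (mulrDr (1 - m)) -etA; ring.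
    have E2 : expR (kap * (t + tA) + (p - m) * phi (t + tA)) =
        expR (kap * t + (p - m) * (lA + phi (t + tA))).
      by congr expR; rewrite mulrDr ktA; ring.
    by rewrite E1 E2.
  + rewrite -[X in _ --> X]addr0; apply: cvgD; first exact: cvg_cst.
    exact: (cvg_comp _ _ shiftNy phi0).
  + by move=> t; rewrite /u gerDl; exact: (orbit_phi_le0 orb).
  + by move=> t; exact: yM.
  + by move=> t; rewrite -mulrA -expRD /w (le_trans (yC _))// mulrDr addrC.
- have [K1 [K2 hK]] := orbit_phi_expansion kap0 nk0 n20 m1 mp al0 be0 e0 M0 orb.
  pose K := expR (- (p - m) * lA).
  exists (K * (K1 * expR (2 * kap * tA))), (K * (K2 * expR (2 * tA))), (- tA) => t tb.
  have h := hK (t + tA).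
  have t0 : t + tA <= 0 by lra.
  have {}h := h t0.
  rewrite /u mulrDr expRD -/K.
  have -> : K * expR (- (p - m) * phi (t + tA)) - K - (p - m) / (m * (n + kap) * kap) * expR (kap * t) =
    K * (expR (- (p - m) * phi (t + tA)) - 1 - (p - m) / (m * (n + kap) * kap) * expR (kap * (t + tA))).
    have KE : K * expR (kap * tA) = 1 by rewrite /K ktA -expRD mulNr addNr expR0.
    rewrite (mulrDr kap) expRD !mulrBr mulr1; congr (_ - _).
    by rewrite mulrCA (mulrCA K) KE mulr1.
  rewrite normrM gtr0_norm ?expR_gt0//.
  have -> : K * (K1 * expR (2 * kap * tA)) * expR (2 * kap * t) + K * (K2 * expR (2 * tA)) * expR (2 * t) =
    K * (K1 * expR (2 * kap * (t + tA)) + K2 * expR (2 * (t + tA))).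
    by rewrite !(mulrDr _ t tA) !expRD; ring.
  by rewrite ler_wpM2l// expR_ge0.
- have [l hl] := orbit_phi_infty kap0 kap2 m1 mp al0 be0 e0 M0 orb.
  exists (lA - al / be * tA + l).
  have shifty : (fun t : R => t + tA) t @[t --> +oo] --> +oo.
    apply/cvgryPge => B; near=> t.
    suff : B - tA <= t by lra.
    by near: t; apply: nbhs_pinfty_ge; rewrite num_real.
  have -> : (fun t => u t + al / be * t) =
     (fun t => (lA - al / be * tA) + (fun s => phi s + al / be * s) (t + tA)).
    by apply/funext => t; rewrite /u; ring.
  apply: cvgD; first exact: cvg_cst.
  exact: (cvg_comp _ _ shifty hl).
Unshelve. all: by end_near. Qed.

End LogProfile.

Section Profile.
Context {R : realType}.
Implicit Types (u w : R -> R) (x : R).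

(** The orbit determines f on (0, +oo) only; its limit is taken as f 0, and the same constant on
    negative numbers makes f continuous on the whole line. *)
Definition profile_of u (lA : R) x := if x <= 0 then expR lA else expR (u (ln x)).

Lemma profile_of_gt0 u lA x : 0 < profile_of u lA x.
Proof. by rewrite /profile_of; case: ifP => _; exact: expR_gt0. Qed.

Lemma profile_ofE u lA x : 0 < x -> profile_of u lA x = expR (u (ln x)).
Proof. by move=> x0; rewrite /profile_of leNgt x0. Qed.

Lemma powRE (x k : R) : 0 < x -> x `^ k = expR (k * ln x).
Proof. by move=> x0; rewrite /powR gt_eqF. Qed.

Lemma near_gt0 x : 0 < x -> \forall z \near x, 0 < z.
Proof. exact: lt_nbhsr. Qed.

Lemma cvg_at_right_ln (H : R -> R) (l : R) : H t @[t --> -oo] --> l -> H (ln x) @[x --> 0^'+] --> l.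
Proof. by move=> h; exact: (cvg_comp _ _ (@lnNy R) h). Qed.

Lemma cvg_pinfty_ln (H : R -> R) (l : R) : H t @[t --> +oo] --> l -> H (ln x) @[x --> +oo] --> l.
Proof.
move=> h; apply: (cvg_comp _ _ _ h); apply/cvgryPge => B; near=> x.
have xB : expR B <= x by near: x; apply: nbhs_pinfty_ge; rewrite num_real.
by rewrite -[B]expRK ler_ln ?posrE ?expR_gt0// (lt_le_trans _ xB)// expR_gt0.
Unshelve. all: by end_near. Qed.

Variables (N : nat) (m p sigma : R).
Let n : R := N%:R - 2.
Let kap := sigma + 2.
Let al := ss_alpha m p sigma.
Let be := ss_beta m p sigma.
Hypothesis m1 : 1 < m.
Hypothesis mp : m < p.
Hypothesis kap0 : 0 < kap.
Variables (u w : R -> R) (lA M C : R).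
Hypothesis lp : log_profile n kap m p al be u w lA M C.
Local Notation f := (profile_of u lA).

Let hasD_uln x : 0 < x -> hasD (fun x => u (ln x)) x (w (ln x) / x).
Proof.
by move=> x0; apply: (hasD_comp (lp_u lp _)); exact: is_derive1_ln.
Qed.

Let hasD_wln x : 0 < x -> hasD (fun x => w (ln x)) x
  ((- n * w (ln x) - m * w (ln x) ^+ 2 + expR (2 * ln x + (1 - m) * u (ln x)) / m *
     (al + be * w (ln x)) - expR (kap * ln x + (p - m) * u (ln x)) / m) / x).
Proof.
by move=> x0; apply: (hasD_comp (lp_w lp _)); exact: is_derive1_ln.
Qed.

Lemma hasD_profile x : 0 < x -> hasD f x (f x * (w (ln x) / x)).
Proof.
move=> x0; have h := hasD_uln x0.
apply: (@hasD_near _ (fun x => expR (u (ln x)))).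
  by apply: filterS (near_gt0 x0) => z z0; rewrite profile_ofE.
by rewrite profile_ofE//; exact: hasD_exp.
Qed.

Lemma continuous_profile : continuous f.
Proof.
move=> x; have [x0|x0|->] := ltgtP x 0.
- apply: (@hasD_continuous _ _ _ 0); apply: (@hasD_near _ (fun=> expR lA)); last exact: hasD_cst.
  by apply: filterS (lt_nbhsl x0) => z z0; rewrite /profile_of ltW.
- exact: hasD_continuous (hasD_profile x0).
- have f0 : f 0 = expR lA by rewrite /profile_of lexx.
  apply/cvgrPdist_lt => e e0; rewrite f0.
  have hl : expR (u t) @[t --> -oo] --> expR lA.
    exact: (continuous_cvg _ (@continuous_expR R lA) (lp_uNy lp)).
  have /cvgrPdist_lt/(_ _ e0) := cvg_at_right_ln hl.
  rewrite near_withinE; apply: filterS => z hz.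
  have [z0|z0] := leP z 0; first by rewrite /profile_of z0 subrr normr0.
  by rewrite profile_ofE//; exact: hz.
Qed.

Lemma profile_of_equation x : 0 < x -> profile_equation N m p sigma f x.
Proof.
move=> x0.
have m0 : 0 < m by exact: lt_trans m1.
have xn0 : x != 0 by rewrite gt_eqF.
pose fm z := f z `^ m.
pose em z := expR (m * u (ln z)).
pose dfm z := em z * (m * (w (ln z) * z^-1)).
have fmE z : 0 < z -> fm z = em z.
  by move=> z0; rewrite /fm profile_ofE// powRE ?expR_gt0// expRK.
have dem z : 0 < z -> hasD em z (dfm z).
  move=> z0; have h := hasD_uln z0; rewrite /dfm /em; derive; ring.
have d1 z : 0 < z -> hasD fm z (dfm z).
  move=> z0; apply: (@hasD_near _ em); last exact: dem.
  by apply: filterS (near_gt0 z0) => s s0; rewrite fmE.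
have d1E z : 0 < z -> fm^`()%classic z = dfm z by move=> z0; have [] := hasD_derive (d1 z z0).
have hV : hasD (fun z : R => z^-1) x (- x ^- 2 * 1) by apply: hasDV => //; exact: hasD_id.
have hw := hasD_wln x0; have he := dem x x0.
pose W' := (- n * w (ln x) - m * w (ln x) ^+ 2 + expR (2 * ln x + (1 - m) * u (ln x)) / m *
     (al + be * w (ln x)) - expR (kap * ln x + (p - m) * u (ln x)) / m) / x.
have d2 : hasD (fm^`()%classic) x (dfm x * (m * (w (ln x) * x^-1)) +
    em x * (m * (w (ln x) * - x ^- 2 + W' * x^-1))).
  apply: (@hasD_near _ dfm).
    by apply: filterS (near_gt0 x0) => s s0; rewrite d1E.
  by rewrite /dfm; derive; rewrite -/(dfm x) -/W' /dfm; ring.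
split.
- by have [] := hasD_derive (hasD_profile x0).
- by have [] := hasD_derive (d1 x x0).
- by have [] := hasD_derive d2.
rewrite -/fm; have [_ ->] := hasD_derive d2; rewrite d1E//.
have [_ ->] := hasD_derive (hasD_profile x0).
rewrite powRE// profile_ofE// powRE ?expR_gt0// expRK /dfm /W' /em -/al -/be.
have x2 : x ^+ 2 = expR (2 * ln x) by rewrite expRM_natl lnK ?posrE.
(* [E1] and [E2] undo the logarithmic change: f ^ m times the exponentials of the X and Z terms is
   xi ^ 2 f and xi ^ (sigma + 2) f ^ p. *)
have E1 : expR (m * u (ln x)) * expR (2 * ln x + (1 - m) * u (ln x)) = x ^+ 2 * expR (u (ln x)).
  by rewrite x2 -!expRD; congr expR; ring.
have E2 : expR (m * u (ln x)) * expR (kap * ln x + (p - m) * u (ln x)) =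
    x ^+ 2 * (expR (sigma * ln x) * expR (p * u (ln x))).
  by rewrite x2 -!expRD; congr expR; rewrite /kap; ring.
set U := expR (u (ln x)) in E1 *; set V := expR (m * u (ln x)) in E1 E2 *.
set P := expR (p * _) in E2 *; set S := expR (sigma * _) in E2 *.
set X1 := expR (2 * ln x + _) in E1 *; set X2 := expR (kap * ln x + _) in E2 *.
set ww := w (ln x).
have -> : V * (m * (ww * x^-1)) * (m * (ww * x^-1)) +
  V * (m * (ww * - x ^- 2 + (- n * ww - m * ww ^+ 2 + X1 / m * (al + be * ww) - X2 / m) / x * x^-1)) +
  (N%:R - 1) / x * (V * (m * (ww * x^-1))) - al * U - be * x * (U * (ww / x)) + S * P =
  ((V * X1) * (al + be * ww) - V * X2) / x ^+ 2 - U * (al + be * ww) + S * P.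
  by rewrite /n; field; rewrite xn0 gt_eqF.
by rewrite E1 E2; field.
Qed.

Lemma profile_of_profile : profile N m p sigma f.
Proof.
split.
- by apply: continuous_subspaceT; exact: continuous_profile.
- by move=> x _; exact: ltW (profile_of_gt0 _ _ _).
- by move=> x x0 _; exact: profile_of_equation.
Qed.

Lemma profile_of_at_0 :
  (exists K1 K2 b, forall t, t <= b ->
    `|expR (- (p - m) * u t) - expR (- (p - m) * lA) - (p - m) / (m * (n + kap) * kap) * expR (kap * t)| <=
    K1 * expR (2 * kap * t) + K2 * expR (2 * t)) -> sigma < 0 ->
  behavior_at_0 N m p sigma (expR (- (p - m) * lA)) f.
Proof.
move=> [K1 [K2 [b hK]]] s0.
have nk : n + kap = N%:R + sigma by rewrite /n /kap; ring.
pose H t := (expR (- (p - m) * u t) - (expR (- (p - m) * lA) +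
  (p - m) / (m * (N%:R + sigma) * (sigma + 2)) * expR (kap * t))) / expR (kap * t).
have H0 : H t @[t --> -oo] --> (0 : R).
  (* After division by e^(kap t) the remainders are e^(kap t) and e^(- sigma t); sigma < 0 makes the
     second, due to X, vanish at -oo. *)
  apply: (@squeezeNy _ _ (fun t => K1 * expR (kap * t) + K2 * expR (- sigma * t)) b).
    move=> t tb; rewrite /H normrM normfV (gtr0_norm (expR_gt0 _)) ler_pdivrMr ?expR_gt0//.
    have e2 : expR (2 * kap * t) = expR (kap * t) * expR (kap * t).
      by rewrite -expRD; congr expR; ring.
    have e3 : expR (2 * t) = expR (- sigma * t) * expR (kap * t).
      by rewrite -expRD /kap; congr expR; ring.
    have := hK t tb; rewrite e2 e3 nk -/kap (opprD (expR _)) addrA => /le_trans; apply.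
    by rewrite le_eqVlt; apply/orP; left; apply/eqP; ring.
  rewrite -[X in _ --> X](addr0 (0 : R)); apply: cvgD; apply: scaled_expR_Ny => //; lra.
have := cvg_at_right_ln H0; rewrite /behavior_at_0; apply: cvg_trans.
apply: near_eq_cvg; near=> x.
have x0 : 0 < x by near: x; exact: nbhs_right_gt.
by rewrite /H profile_ofE// !powRE ?expR_gt0// expRK.
Unshelve. all: by end_near. Qed.

Lemma profile_of_at_infty l : u t + al / be * t @[t --> +oo] --> (l : R) ->
  behavior_at_infty m p sigma (expR l) f.
Proof.
move=> hl.
have pm0 : 0 < p - m by rewrite subr_gt0.
have L0 : 0 < ss_L m p sigma.
  have h : - (2 * (m - 1)) <= sigma * (m - 1).
    rewrite -mulNr; apply: ler_wpM2r; first by rewrite subr_ge0 ltW.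
    by move: kap0; rewrite /kap; lra.
  by rewrite /ss_L; move: mp; lra.
have ab : al / be = kap / (p - m).
  by rewrite /al /be /ss_alpha /ss_beta /kap; field; rewrite !gt_eqF.
have H1 : expR (u t + al / be * t - l) @[t --> +oo] --> (1 : R).
  rewrite -[X in _ --> X]expR0 -(subrr l).
  apply: (continuous_cvg _ (@continuous_expR R (l - l))).
  by apply: cvgB => //; exact: cvg_cst.
have := cvg_pinfty_ln H1; rewrite /behavior_at_infty; apply: cvg_trans.
apply: near_eq_cvg; near=> x.
have x0 : 0 < x by near: x; apply: nbhs_pinfty_gt; rewrite num_real.
rewrite profile_ofE// powRE//.
have -> : - (sigma + 2) / (p - m) * ln x = - (al / be * ln x) by rewrite ab /kap; ring.
by rewrite -expRD -expRN -expRD; congr expR; ring.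
Unshelve. all: by end_near. Qed.

End Profile.

(** * Integration in space-time *)

Section LineIntegral.
Context {R : realType}.
Local Notation mu := (@lebesgue_measure R).
Local Notation RM := (measurableTypeR R).
Implicit Types (F k : R -> R).

(** [k] may be singular at the endpoints, where [F] is only continuous. Closed subintervals, shorter
    by [d n] at each end, are treated first; dominated convergence, with |k| as the bound, recovers
    the whole interval. *)
Lemma FTC_open F k (a b : R) : a < b ->
  (forall x, a < x < b -> hasD F x (k x)) -> (forall x, a < x < b -> ctsat k x) ->
  ctsat F a -> ctsat F b -> mu.-integrable setT (EFin \o k) ->
  (\int[mu]_(x in `]a, b[) (k x)%:E = (F b - F a)%:E)%E.
Proof.
move=> ab dF ck ca cb ik.
(* Denominators start at 3, so that 2 d n < b - a already for n = 0. *)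
pose d n : R := (b - a) / n.+3%:R.
have ba0 : 0 < b - a by rewrite subr_gt0.
have d0 n : 0 < d n by rewrite divr_gt0.
have dlt n : a + d n < b - d n.
  rewrite -subr_gt0 (_ : _ - _ = (b - a) * (1 - 2 / n.+3%:R)); last first.
    have : n.+3%:R != 0 :> R by rewrite pnatr_eq0.
    by rewrite /d; move: n.+3%:R => q q0; field.
  by rewrite mulr_gt0// subr_gt0 ltr_pdivrMr// mul1r ltr_nat.
have dcvg : d n @[n --> \oo] --> (0 : R).
  rewrite -[X in _ --> X](mulr0 (b - a)); apply: cvgM; first exact: cvg_cst.
  have := @cvg_harmonic R; rewrite -(cvg_shiftn 2); apply: cvg_trans.
  by apply: near_eq_cvg; near=> n; rewrite /= addn2.
pose D n : set RM := `[a + d n, b - d n]%classic.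
have mD n : measurable (D n) by exact: measurable_itv.
pose I : set RM := `]a, b[%classic.
pose ek : RM -> \bar R := EFin \o k.
have DI n x : D n x -> a < x < b.
  by rewrite /D/= in_itv/= => /andP[h1 h2]; have := d0 n; lra.
have ED n : (\int[mu]_x (ek \_ (D n)) x = (F (b - d n) - F (a + d n))%:E)%E.
  rewrite -integral_mkcond EFinB; apply: continuous_FTC2 => //.
  - apply: continuous_in_subspaceT => x; rewrite inE => /DI; exact: ck.
  - split.
    + by move=> x /subset_itv_oo_cc/DI/dF h; have [] := hasD_derive h.
    + apply: cvg_at_right_filter; apply: hasD_continuous; apply: dF.
      by have := d0 n; have := dlt n; lra.
    + apply: cvg_at_left_filter; apply: hasD_continuous; apply: dF.
      by have := d0 n; have := dlt n; lra.
  - by move=> x /subset_itv_oo_cc/DI/dF h; have [] := hasD_derive h.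
have /integrableP[mk _] := ik.
have c1 : (\int[mu]_x (ek \_ (D n)) x)%E @[n --> \oo] -->
    (\int[mu]_x (ek \_ I) x)%E.
  apply: (@dominated_cvg _ _ _ mu setT measurableT (fun n => (EFin \o k) \_ (D n))
    (ek \_ I) (abse \o (EFin \o k))) => //.
  - by move=> n; apply: (measurable_restrictT ek (mD n)).1; exact: (measurable_funTS mk).
  - move=> x _; rewrite /patch.
    have [xab|xab] := boolP (x \in `]a, b[%classic); last first.
      rewrite (_ : (fun n => _) = fun=> 0%E); first exact: cvg_cst.
      apply/funext => n; case: ifPn => // /set_mem/DI h.
      by move: xab; rewrite notin_setE/= in_itv/= h.
    move: xab; rewrite inE/= in_itv/= => /andP[ax xb].
    apply: cvg_near_cst; near=> n.
    rewrite mem_set// /D/= in_itv/=; apply/andP; split.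
      have : d n < x - a; last by lra.
      near: n; move/cvgrPdist_lt : dcvg => /(_ (x - a)); rewrite subr_gt0 => /(_ ax).
      by apply: filterS => n; rewrite sub0r normrN gtr0_norm.
    have : d n < b - x; last by lra.
    near: n; move/cvgrPdist_lt : dcvg => /(_ (b - x)); rewrite subr_gt0 => /(_ xb).
    by apply: filterS => n; rewrite sub0r normrN gtr0_norm.
  - by apply: integrable_abse.
  - by move=> n x _; rewrite /patch; case: ifPn => //= _; rewrite normr0 lee_fin.
have c2 : (F (b - d n) - F (a + d n))%:E @[n --> \oo] --> (F b - F a)%:E.
  apply/cvg_EFin; first by near=> n.
  apply: cvgB.
    have l : b - d n @[n --> \oo] --> b.
      by rewrite -[X in _ --> X]subr0; apply: cvgB => //; exact: cvg_cst.
    exact: (cvg_comp _ _ l cb).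
  have l : a + d n @[n --> \oo] --> a.
    by rewrite -[X in _ --> X]addr0; apply: cvgD => //; exact: cvg_cst.
  exact: (cvg_comp _ _ l ca).
rewrite (funext ED) in c1; rewrite integral_mkcond -/ek -/I.
exact: (cvg_unique _ c1 c2).
Unshelve. all: by end_near. Qed.

Lemma line_integral0 F k (a b : R) : a < b ->
  (forall x, a < x < b -> hasD F x (k x)) -> (forall x, a < x < b -> ctsat k x) ->
  ctsat F a -> ctsat F b -> F a = 0 -> F b = 0 -> (forall x, ~ a < x < b -> k x = 0) ->
  mu.-integrable setT (EFin \o k) -> (\int[mu]_x (k x)%:E = 0)%E.
Proof.
move=> ab dF ck ca cb Fa Fb k0 ik.
have := FTC_open ab dF ck ca cb ik; rewrite Fa Fb subrr integral_mkcond => h.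
rewrite -[RHS]/(0%:E) -h.
apply: eq_integral => x _; rewrite /patch; case: ifPn => //.
by rewrite notin_setE/= in_itv/= => /k0 ->.
Qed.

(** [k] may be singular at 0, but [F] is continuous there, so the boundary terms at 0 of the two
    half-intervals cancel. *)
Lemma singular_line_integral0 F k (r : R) : 0 < r -> continuous F ->
  (forall x, x != 0 -> hasD F x (k x)) -> (forall x, x != 0 -> ctsat k x) ->
  (forall x, ~ - r < x < r -> F x = 0 /\ k x = 0) ->
  mu.-integrable setT (EFin \o k) -> (\int[mu]_x (k x)%:E = 0)%E.
Proof.
move=> r0 cF dF ck k0 ik.
have /integrableP[mk _] := ik.
have rN : - r < 0 by lra.
have n1 x : - r < x < 0 -> x != 0 by move=> /andP[_ h]; rewrite lt_eqF.
have n2 x : 0 < x < r -> x != 0 by move=> /andP[h _]; rewrite gt_eqF.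
have {}i1 := @FTC_open F k (- r) 0 rN (fun x h => dF x (n1 x h)) (fun x h => ck x (n1 x h)) (cF _) (cF _) ik.
have i2 := @FTC_open F k 0 r r0 (fun x h => dF x (n2 x h)) (fun x h => ck x (n2 x h)) (cF _) (cF _) ik.
have F1 : F (- r) = 0 by apply: (k0 _ _).1; lra.
have F2 : F r = 0 by apply: (k0 _ _).1; lra.
rewrite F1 subr0 in i1; rewrite F2 sub0r in i2.
pose ek : RM -> \bar R := EFin \o k.
pose I1 : set RM := `]- r, 0[%classic; pose I2 : set RM := `]0, r[%classic.
have mI1 : measurable I1 by exact: measurable_itv.
have mI2 : measurable I2 by exact: measurable_itv.
transitivity (\int[mu]_(x in I1 `|` I2) ek x)%E.
  rewrite [RHS]integral_mkcond; apply: ae_eq_integral => //.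
    apply: (measurable_restrictT ek _).1; first exact: (measurableU _ _ mI1 mI2).
    exact: (measurable_funTS mk).
  exists [set 0]; split; [exact: measurable_set1|exact: lebesgue_measure_set1|].
  move=> x /= h; apply: contrapT => x0; apply: h => _; rewrite /patch; case: ifPn => //.
  rewrite notin_setE => /not_orP[]; rewrite /I1 /I2 /= !in_itv/= => h1 h2.
  rewrite (k0 x _).2//; move=> /andP[h3 h4].
  by have [h5|h5|] := ltgtP x 0; [apply: h1|apply: h2|exact: x0]; apply/andP.
rewrite integral_setU//=.
- by rewrite i1 i2 -EFinD subrr.
- exact: (measurable_funTS mk).
- apply/disj_set2P/seteqP; split => // x []; rewrite /I1 /I2 /= !in_itv/= => h1 h2; lra.
Qed.

End LineIntegral.

Section FubiniZero.
Context d1 d2 (T1 : measurableType d1) (T2 : measurableType d2) (R : realType).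
Context (m1 : {sigma_finite_measure set T1 -> \bar R}) (m2 : {sigma_finite_measure set T2 -> \bar R}).
Local Open Scope ereal_scope.

(** Only integrable sections have to be treated, since almost every section of an integrable
    function is; the line computations need that integrability for dominated convergence. *)
Lemma fubini_zero1 (f : T1 * T2 -> \bar R) : (m1 \x m2).-integrable setT f ->
  (forall x, m2.-integrable setT (fun y => f (x, y)) -> \int[m2]_y f (x, y) = 0) ->
  \int[m1 \x m2]_z f z = 0.
Proof.
move=> fi f0; rewrite -integral12_prod_meas1//.
rewrite (@ae_eq_integral _ _ _ m1 setT (cst 0))//; first by rewrite integral0.
- exact: (measurable_fubini_F fi).
- have := ae_integrable1 fi; apply: filterS => x fx _ /=; rewrite /fubini_F; exact: f0.
Qed.

Lemma fubini_zero2 (f : T1 * T2 -> \bar R) : (m1 \x m2).-integrable setT f ->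
  (forall y, m1.-integrable setT (fun x => f (x, y)) -> \int[m1]_x f (x, y) = 0) ->
  \int[m1 \x m2]_z f z = 0.
Proof.
move=> fi f0; rewrite -integral21_prod_meas1//.
rewrite (@ae_eq_integral _ _ _ m2 setT (cst 0))//; first by rewrite integral0.
- exact: (measurable_fubini_G fi).
- have := ae_integrable2 fi; apply: filterS => x fx _ /=; rewrite /fubini_G; exact: f0.
Qed.

End FubiniZero.

(** * Fubini along a single coordinate *)

Section TupleLines.
Context {R : realType}.
Local Notation RM := (measurableTypeR R).
Local Notation mu := (@lebesgue_measure R).

Definition upd n (t : n.-tuple RM) (i : 'I_n) (r : RM) : n.-tuple RM :=
  [tuple if j == i then r else tnth t j | j < n].

Lemma tnth_upd n (t : n.-tuple RM) i r j :
  tnth (upd t i r) j = if j == i then r else tnth t j.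
Proof. by rewrite tnth_mktuple. Qed.

Lemma tnth_tcons0 n (x : RM) (t : n.-tuple RM) : tnth (tcons (x, t)) ord0 = x.
Proof. by []. Qed.

Lemma tnth_tconsS n (x : RM) (t : n.-tuple RM) j : tnth (tcons (x, t)) (lift ord0 j) = tnth t j.
Proof. by rewrite tnthS. Qed.

Lemma upd_tcons0 n (x r : RM) (t : n.-tuple RM) : upd (tcons (x, t)) ord0 r = tcons (r, t).
Proof.
apply: eq_from_tnth => j; rewrite tnth_upd.
by case: (unliftP ord0 j) => [k|] ->; rewrite ?tnth_tconsS ?tnth_tcons0.
Qed.

Lemma upd_tconsS n (x r : RM) (t : n.-tuple RM) i :
  upd (tcons (x, t)) (lift ord0 i) r = tcons (x, upd t i r).
Proof.
apply: eq_from_tnth => j; rewrite tnth_upd.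
case: (unliftP ord0 j) => [k|] ->; rewrite ?tnth_tconsS ?tnth_tcons0//.
by rewrite tnth_upd (inj_eq lift_inj).
Qed.

Lemma lebesgue_tupleS_integrable n (h : n.+1.-tuple RM -> \bar R) :
  (lebesgue_tuple n.+1).-integrable setT h ->
  (mu \x lebesgue_tuple n)%E.-integrable setT (h \o @tcons R n).
Proof.
move=> /integrableP[mh hoo]; have mt := @measurable_tcons R n.
apply/integrableP; split; first exact: measurableT_comp.
apply: le_lt_trans hoo; rewrite le_eqVlt; apply/orP; left; apply/eqP.
have := @ge0_integral_pushforward _ _ _ _ R _ mt (mu \x lebesgue_tuple n)%E setT (abse \o h).
rewrite preimage_setT => -> //.
  exact: measurableT_comp.
by move=> y _; exact: abse_ge0.
Qed.

Lemma lebesgue_tupleS_integral n (h : n.+1.-tuple RM -> \bar R) :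
  (lebesgue_tuple n.+1).-integrable setT h ->
  (\int[lebesgue_tuple n.+1]_t h t = \int[mu \x lebesgue_tuple n]_z h (tcons z))%E.
Proof.
move=> ih; have /integrableP[mh _] := ih; have mt := @measurable_tcons R n.
have := @integral_pushforward _ _ _ _ R _ mt (mu \x lebesgue_tuple n)%E setT h mh.
by rewrite preimage_setT; apply => //; exact: lebesgue_tupleS_integrable.
Qed.

(** Coordinates are peeled off one at a time: when [i] is not the first, the first one is frozen and
    induction applies; when it is, Fubini is used in the other order. *)
Lemma tuple_line0 n (i : 'I_n) (h : n.-tuple RM -> \bar R) :
  (lebesgue_tuple n).-integrable setT h ->
  (forall t, mu.-integrable setT (fun r => h (upd t i r)) -> \int[mu]_r h (upd t i r) = 0)%E ->
  (\int[lebesgue_tuple n]_t h t = 0)%E.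
Proof.
elim: n i h => [[]//|n IH] i h ih h0.
rewrite lebesgue_tupleS_integral//.
have ih' := lebesgue_tupleS_integrable ih.
case: (unliftP ord0 i) h0 => [j|] -> h0.
  apply: fubini_zero1 => // x ix; apply: (IH j) => // t it.
  have E : (fun r => h (upd (tcons (x, t)) (lift ord0 j) r)) = (fun r => h (tcons (x, upd t j r))).
    by apply/funext => r; rewrite upd_tconsS.
  by have := h0 (tcons (x, t)); rewrite E; exact.
apply: fubini_zero2 => // t it.
(* The 0 is arbitrary, as [upd] overwrites it. *)
have E : (fun r => h (upd (tcons (0, t)) ord0 r)) = (fun r => h (tcons (r, t))).
  by apply/funext => r; rewrite upd_tcons0.
by have := h0 (tcons (0, t)); rewrite E; exact.
Qed.

End TupleLines.

(** * Topology against sigma-algebra in space-time *)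

Section SpacetimeMeasurability.
Context {R : realType} (N : nat).
Local Notation RM := (measurableTypeR R).
Local Notation spacetime := ('rV[R]_N * R)%type.
Local Notation base := (N.-tuple RM * RM)%type.

(** These are balls of the sup norm, hence products of intervals. *)
Lemma measurable_spacetime_ball (q : spacetime) (e : R) : 0 < e ->
  measurable (@spacetime_of R N @^-1` ball q e).
Proof.
move=> e0.
have -> : @spacetime_of R N @^-1` ball q e =
  [set t : N.-tuple RM | forall i, ball (q.1 ord0 i) e (tnth t i)] `*` (ball q.2 e : set RM).
  apply/seteqP; split => [[x t]|[x t]] /=.
    by move=> [[_ h1] h2]; split => //= i; have := h1 ord0 i; rewrite mxE.
  move=> [/= h1 h2]; split => //; split => // i j.
  by rewrite (ord1 i) /= mxE; exact: h1.
apply: measurableX; last exact: measurable_ball.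
by apply: (@measurable_box R N (fun i => ball (q.1 ord0 i) e)) => i; exact: measurable_ball.
Qed.

(** An open set is the union of the balls it contains that have a rational centre and radius 1 / (k
    + 1), a countable family. This ties the topology of row vectors to the product sigma-algebra of
    tuples. *)
Lemma measurable_spacetime_open (U : set spacetime) : open U ->
  measurable (@spacetime_of R N @^-1` U).
Proof.
move=> oU.
pose center (i : (N.-tuple rat * rat) * nat) : spacetime :=
  (\row_j ratr (tnth i.1.1 j), ratr i.1.2).
pose B i := ball (center i) (i.2.+1%:R^-1 : R).
pose good i := B i `<=` U.
have -> : @spacetime_of R N @^-1` U =
    \bigcup_i (if pselect (good i) then @spacetime_of R N @^-1` B i else set0).
  apply/seteqP; split => [w Uw|w [i _]]; last by case: pselect => // gi; exact: gi.
  have /nbhs_ballP[e /= e0 eU] : nbhs (spacetime_of w) U by exact: open_nbhs_nbhs.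
  have e20 : 0 < e / 2 by rewrite divr_gt0.
  have [k hk] : exists k, (k.+1%:R^-1 : R) < e / 2.
    by have [k _ /(_ k (leqnn k))] := near_infty_natSinv_lt (PosNum e20); exists k.
  have k0 : 0 < (k.+1%:R^-1 : R) by rewrite invr_gt0.
  have [d dE] : exists d : R, d = k.+1%:R^-1 by exists k.+1%:R^-1.
  rewrite -dE in hk k0.
  have rq (x : R) : exists q : rat, `|ratr q - x| < d.
    have xx : x - d < x + d by lra.
    have [q] := rat_in_itvoo xx; rewrite in_itv/= => /andP[h1 h2].
    by exists q; rewrite ltr_norml; lra.
  pose qx (j : 'I_N) := sval (cid (rq (tnth w.1 j))).
  have hqx j : `|ratr (qx j) - tnth w.1 j| < d by exact: (svalP (cid (rq _))).
  have [qt hqt] := rq w.2.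
  pose i : (N.-tuple rat * rat) * nat := ([tuple qx j | j < N], qt, k).
  have Bw : B i (spacetime_of w).
    rewrite /B /= -dE; split => /=; last exact: hqt.
    by split => // a j; rewrite /= !mxE tnth_mktuple; exact: hqx.
  have gi : good i.
    rewrite /good /B /= -dE => z [[_ z1] z2]; apply: eU.
    have tri (q x y : R) : `|q - x| < d -> `|q - y| < d -> `|x - y| < e.
      move=> h1 h2; have -> : x - y = (q - y) - (q - x) by ring.
      apply: le_lt_trans (ler_normB _ _) _; lra.
    split; last exact: (tri (ratr qt)).
    split => // a j; have aE : a = ord0 by exact: ord1.
    subst a; rewrite /= mxE; apply: (tri (ratr (qx j))) => //.
    by have := z1 ord0 j; rewrite /center/= mxE tnth_mktuple.
  by exists i => //=; case: pselect.
apply: countable_bigcupT_measurable; first exact: countableP.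
move=> i; case: pselect => gi //=.
by apply: measurable_spacetime_ball; rewrite invr_gt0.
Qed.

Lemma measurable_spacetime_compact (K : set spacetime) : compact K ->
  measurable (@spacetime_of R N @^-1` K).
Proof.
move=> cK; rewrite -[K]setCK preimage_setC; apply: measurableC.
have clK : closed K by apply: (compact_closed _ cK); exact: norm_hausdorff.
exact: (measurable_spacetime_open (closed_openC clK)).
Qed.

Lemma measurable_spacetime_continuous (g : spacetime -> R) : continuous g ->
  measurable_fun setT (g \o @spacetime_of R N).
Proof.
move=> cg; apply: (measurability _ (RGenOInfty.measurableE R)).
move=> /= _ [_ [a ->]] <-; rewrite setTI comp_preimage.
apply: measurable_spacetime_open; apply: open_comp; first by move=> x _; exact: cg.
by first [exact: rray_open|exact: interval_open|rewrite set_itvE; exact: open_gt].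
Qed.

End SpacetimeMeasurability.

(** * Local integrability of |x|^s for - N < s < 0 *)

Section RadialPower.
Context {R : realType} (N : nat).
Local Notation RM := (measurableTypeR R).
Local Notation mu := (@lebesgue_measure R).
Implicit Types (t : N.-tuple RM).

Definition radius t : R := enorm (\row_i tnth t i).

Lemma radiusE t : radius t = Num.sqrt (\sum_i tnth t i ^+ 2).
Proof. by rewrite /radius /enorm; congr Num.sqrt; apply: eq_bigr => i _; rewrite mxE. Qed.

Lemma radius_ge t i : `|tnth t i| <= radius t.
Proof.
rewrite radiusE -sqrtr_sqr ler_wsqrtr// (bigD1 i)//= lerDl sumr_ge0// => j _; exact: sqr_ge0.
Qed.

Lemma radius_ge0 t : 0 <= radius t.
Proof. by rewrite radiusE sqrtr_ge0. Qed.

Lemma radius_gt0 t i : tnth t i != 0 -> 0 < radius t.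
Proof. by move=> h; apply: lt_le_trans (radius_ge t i); rewrite normr_gt0. Qed.

Lemma radius_sqr t : radius t ^+ 2 = \sum_i tnth t i ^+ 2.
Proof. by rewrite radiusE sqr_sqrtr// sumr_ge0// => j _; exact: sqr_ge0. Qed.

Lemma measurable_radius : measurable_fun setT radius.
Proof.
have -> : radius = Num.sqrt \o (fun t => \sum_i (tnth t i : R) ^+ 2).
  by apply/funext => t; rewrite radiusE.
apply: measurableT_comp; first by apply: continuous_measurable_fun; exact: sqrt_continuous.
apply: measurable_sum => i; apply: measurable_funX; exact: measurable_tnth.
Qed.

Lemma measurable_radius_powR (s : R) : measurable_fun setT (fun t => radius t `^ s).
Proof. exact: (measurableT_comp (@measurable_powR R s) measurable_radius). Qed.

Definition in_box (r : R) t := [forall i, `|tnth t i| <= r].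
Definition box (r : R) := [set t | in_box r t].

Lemma boxE r : box r = [set t | forall i, (`[- r, r]%classic : set RM) (tnth t i)].
Proof.
apply/seteqP; split => t /= => [/forallP h i|h]; first by rewrite in_itv/= -ler_norml; exact: h.
by apply/forallP => i; have := h i; rewrite in_itv/= -ler_norml.
Qed.

Lemma measurable_tuple_box r : measurable (box r).
Proof.
by rewrite boxE; apply: (@measurable_box R N (fun=> `[- r, r]%classic)) => i; exact: measurable_itv.
Qed.

Lemma volume_box r : 0 <= r -> lebesgue_tuple N (box r) = ((2 * r) ^+ N)%:E.
Proof.
move=> r0; rewrite boxE (lebesgue_tuple_box (A := fun=> `[- r, r]%classic)); last first.
  by move=> i; exact: measurable_itv.
rewrite (eq_bigr (fun=> (2 * r)%:E)); last first.
  move=> i _; rewrite lebesgue_measure_itv/= lte_fin.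
  case: ltP => h; first by rewrite -EFinD; congr EFin; lra.
  by congr EFin; lra.
by rewrite prodEFin prodr_const card_ord.
Qed.

(* The box minus the origin is a union of dyadic shells, on the k-th of which
   [radius ^ s] is at most [(r / 2 ^ (k + 1)) ^ s]. *)
Lemma integral_radius_box (s r : R) : s < 0 -> - N%:R < s -> 0 < r ->
  (\int[lebesgue_tuple N]_(t in box r) (radius t `^ s)%:E < +oo)%E.
Proof.
move=> s0 sN r0.
pose c k : R := (r / 2 ^+ k.+1) `^ s.
pose B k := box (r / 2 ^+ k).
have p2 k : 0 < (2 : R) ^+ k by rewrite exprn_gt0.
have c0 k : 0 <= c k by exact: powR_ge0.
pose f k t := ((c k)%:E * (\1_(B k) t)%:E)%E.
have f0 k t : (0 <= f k t)%E by rewrite /f mule_ge0// ?lee_fin ?c0// lee_fin.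
have mB k : measurable (B k) by exact: measurable_tuple_box.
have mf k : measurable_fun setT (f k).
  by apply: emeasurable_funM => //; apply/measurable_EFinP; exact: measurable_indic.
have pw t : box r t -> ((radius t `^ s)%:E <= \sum_(0 <= k <oo) f k t)%E.
  move=> tr.
  have S0 : (0 <= \sum_(0 <= k <oo) f k t)%E by apply: nneseries_ge0 => k _ _.
  have [t0|/existsNP[i ti]] := pselect (forall i, tnth t i = 0).
    (* At the origin the left side is 0, as [powR] sends 0 to 0 for a nonzero exponent. *)
    have -> : radius t = 0.
      by rewrite radiusE big1 ?sqrtr0// => i _; rewrite t0 expr0n.
    by rewrite powR0// lt_eqF.
  have ti0 : 0 < `|tnth t i| by rewrite normr_gt0; apply/eqP.
  have ex : exists j, ~~ in_box (r / 2 ^+ j) t.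
    have [j hj] : exists j, r / 2 ^+ j < `|tnth t i|.
      exists (Num.truncn (r / `|tnth t i|)).+1.
      rewrite ltr_pdivrMr// -ltr_pdivrMl// mulrC.
      apply: lt_le_trans (truncnS_gt _) _; exact: natr_le_exp2.
    by exists j; apply/forallPn; exists i; rewrite -ltNge.
  have [k [Bk /forallPn[i' hi']]] : exists k, in_box (r / 2 ^+ k) t /\ ~~ in_box (r / 2 ^+ k.+1) t.
    case: (ex_minnP ex) => [[|k] hk min_k].
      by move: hk; rewrite expr0 divr1 tr.
    exists k; split => //; apply/negPn/negP => /min_k; by rewrite ltnn.
  rewrite -ltNge in hi'.
  have ck : radius t `^ s <= c k.
    have rk0 : 0 < r / 2 ^+ k.+1 by rewrite divr_gt0.
    have rad : r / 2 ^+ k.+1 <= radius t by apply: le_trans (radius_ge t i'); exact: ltW.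
    have rad0 := lt_le_trans rk0 rad.
    rewrite /c !powRE// ler_expR ler_wnM2l ?(ltW s0)// ler_ln// posrE.
  apply: le_trans (nneseries_lim_ge k.+1 _); last by [].
  rewrite big_nat_recr//= /f indicE mem_set// mule1.
  apply: (@le_trans _ _ (c k)%:E); first by rewrite lee_fin.
  by rewrite -[leLHS]add0e; apply: leeD => //; apply: sume_ge0 => j _; exact: f0.
apply: (@le_lt_trans _ _ (\int[lebesgue_tuple N]_t \sum_(0 <= k <oo) f k t)%E).
  rewrite integral_mkcond; apply: ge0_le_integral => //.
  - by move=> t _; rewrite patchE; case: ifP => // _; rewrite lee_fin powR_ge0.
  - apply: (measurable_restrictT (fun t => (radius t `^ s)%:E) (measurable_tuple_box r)).1.
    apply: measurable_funTS.
    apply/measurable_EFinP; exact: measurable_radius_powR.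
  - exact: (ge0_emeasurable_sum (P := predT) (fun k t _ _ => f0 k t) (fun k _ => mf k)).
  - move=> t _; rewrite patchE; case: ifPn => [/set_mem|_]; first exact: pw.
    by apply: nneseries_ge0 => k _ _.
rewrite integral_nneseries//.
(* Bounding each shell by its whole box gives the terms a q ^ k with q = 2 ^ (- (s + N)), and q < 1
   because s > - N. *)
pose q : R := (2^-1) `^ s * 2^-1 ^+ N.
pose a : R := (r / 2) `^ s * (2 * r) ^+ N.
have q0 : 0 < q by rewrite mulr_gt0 ?powR_gt0 ?exprn_gt0// invr_gt0.
have q1 : q < 1.
  have h2 : (0 : R) < 2^-1 by rewrite invr_gt0.
  rewrite /q -powR_mulrn ?(ltW h2)// !powRE// -expRD -[ltRHS]expR0 ltr_expR.
  rewrite -mulrDl nmulr_llt0; first by lra.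
  by rewrite lnV ?posrE// oppr_lt0 ln_gt0// ltr1n.
have a0 : 0 <= a by rewrite mulr_ge0 ?powR_ge0// exprn_ge0// mulr_ge0// ltW.
have If k : (\int[lebesgue_tuple N]_t f k t = (a * q ^+ k)%:E)%E.
  rewrite /f ge0_integralZl//; last first.
  - by rewrite lee_fin.
  - by apply/measurable_EFinP; exact: measurable_indic.
  have -> : (\int[lebesgue_tuple N]_t (\1_(B k) t)%:E = ((2 * (r / 2 ^+ k)) ^+ N)%:E)%E.
    by rewrite integral_indic ?setIT; [exact: volume_box (divr_ge0 (ltW r0) (ltW (p2 k)))|exact: measurableT|exact: mB].
  rewrite -EFinM; congr EFin; rewrite /c /a /q.
  have -> : r / 2 ^+ k.+1 = r / 2 * 2^-1 ^+ k by rewrite exprS invfM exprVn mulrA.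
  have h2 : (0 : R) <= 2^-1 by rewrite invr_ge0.
  have r2 : 0 <= r / 2 by rewrite divr_ge0// ltW.
  rewrite powRM ?exprn_ge0// -[(2^-1 ^+ k) `^ s](_ : ((2^-1) `^ s) ^+ k = _); last first.
    by rewrite -(powR_mulrn k h2) -(powR_mulrn k (powR_ge0 _ _)) powRAC.
  have -> : 2 * (r / 2 ^+ k) = 2 * r * 2^-1 ^+ k by rewrite exprVn mulrA.
  rewrite !exprMn -!exprM (mulnC k N); ring.
apply: (@le_lt_trans _ _ (a / (1 - q))%:E); last exact: ltry.
apply: lime_le; first by apply: is_cvg_nneseries => k _ _; apply: integral_ge0 => t _.
near=> n; rewrite (eq_bigr (fun k => (a * q ^+ k)%:E)); last by move=> k _; exact: If.
rewrite sumEFin lee_fin.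
have := @geometric_seriesE R a q; rewrite lt_eqF// => /(_ isT)/(congr1 (fun u => u n)).
rewrite /series/= => ->; rewrite ler_pM2r ?invr_gt0 ?subr_gt0//.
by rewrite ler_piMr// gerBl exprn_ge0// ltW.
Unshelve. all: by end_near. Qed.

Lemma coordinate_hyperplane_null (i : 'I_N) :
  lebesgue_tuple N [set t : N.-tuple RM | tnth t i = 0] = 0%E.
Proof.
pose A (j : 'I_N) : set RM := if j == i then [set 0] else setT.
have -> : [set t : N.-tuple RM | tnth t i = 0] = [set t | forall j, A j (tnth t j)].
  apply/seteqP; split => t /= h; last by have := h i; rewrite /A eqxx.
  by move=> j; rewrite /A; case: eqP => [->|].
rewrite lebesgue_tuple_box; last by move=> j; rewrite /A; case: ifP.
by rewrite (bigD1 i)//= /A eqxx lebesgue_measure_set1 mul0e.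
Qed.

End RadialPower.

(** * Compact supports and domination in space-time *)

Section Spacetime.
Context {R : realType} (N : nat).
Local Notation RM := (measurableTypeR R).
Local Notation mu := (@lebesgue_measure R).
Local Notation spacetime := ('rV[R]_N * R)%type.
Local Notation base := (N.-tuple RM * RM)%type.

Lemma compact_bound (K : set spacetime) (g : spacetime -> R) : compact K -> continuous g ->
  exists2 B : R, 0 <= B & forall z, K z -> `|g z| <= B.
Proof.
move=> cK cg; have [->|/set0P K0] := eqVneq K set0; first by exists 0.
have cn : {within K, continuous (fun z => `|g z|)}.
  by apply: continuous_subspaceT => z; apply: cvg_norm; exact: cg.
have [c _ hc] := compact_EVT_max K0 cK cn.
by exists `|g c| => // z Kz; apply: hc; rewrite inE.
Qed.

Lemma compact_in_slab (K : set spacetime) (T : R) : 0 < T -> compact K -> K `<=` strip T ->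
  exists r eta : R, [/\ 0 < r, 0 < eta < T & forall z, K z ->
    (forall i, `|z.1 ord0 i| <= r) /\ 0 < z.2 <= T - eta].
Proof.
move=> T0 cK KT.
have [f hf] : exists f : 'I_N -> R, forall i z, K z -> `|z.1 ord0 i| <= f i.
  have ex (i : 'I_N) : exists B : R, forall z, K z -> `|z.1 ord0 i| <= B.
    have cg : continuous (fun z : spacetime => z.1 ord0 i).
      move=> z; apply: (@continuous_comp _ _ _ fst (fun x : 'rV[R]_N => x ord0 i)).
        exact: cvg_fst.
      exact: coord_continuous.
    by have [B _ hB] := compact_bound cK cg; exists B.
  by exists (fun i => sval (cid (ex i))) => i; exact: (svalP (cid (ex i))).
have [eta he] : exists eta : R, 0 < eta < T /\ forall z, K z -> z.2 <= T - eta.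
  have [->|/set0P K0] := eqVneq K set0.
    by exists (T / 2); split => //; lra.
  have cs : {within K, continuous (fun z : spacetime => z.2)}.
    by apply: continuous_subspaceT => z; exact: cvg_snd.
  have [c Kc hc] := compact_EVT_max K0 cK cs.
  have /andP[c0 cT] : 0 < c.2 < T by apply: KT; rewrite inE in Kc.
  exists (T - c.2); split; first by lra.
  by move=> z Kz; have := hc z; rewrite inE => /(_ Kz); lra.
exists (1 + \sum_i `|f i|), eta; split; [|by case: he|].
  by rewrite ltr_wpDr// sumr_ge0.
move=> z Kz; split; last first.
  by have [_ /(_ _ Kz) ->] := he; rewrite andbT; have /andP[] := KT _ Kz.
move=> i; apply: le_trans (hf i z Kz) _; apply: le_trans (ler_norm _) _.
by rewrite (bigD1 i)//= addrCA lerDl addr_ge0// sumr_ge0.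
Qed.

(** By Tonelli: the time integral only contributes a factor T, and the spatial bound is integrable
    by [integral_radius_box]. *)
Lemma spacetime_dominated (f : base -> R) (r T C s : R) :
  s < 0 -> - N%:R < s -> 0 < r -> 0 < T -> 0 <= C -> measurable_fun setT f ->
  (forall w, box r w.1 -> 0 <= w.2 <= T -> `|f w| <= C * (1 + radius w.1 `^ s)) ->
  (forall w, ~ (box r w.1 /\ 0 <= w.2 <= T) -> f w = 0) ->
  (lebesgue_tuple N \x mu)%E.-integrable setT (EFin \o f).
Proof.
move=> s0 sN r0 T0 C0 mf hf f0.
have mef : measurable_fun setT (EFin \o f) by apply/measurable_EFinP.
apply/integrable12ltyP => //.
pose g (x : N.-tuple RM) : \bar R := (C * (1 + radius x `^ s) * T)%:E.
have mg : measurable_fun setT g.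
  apply/measurable_EFinP; apply: measurable_funM => //; apply: measurable_funM => //.
  apply: measurable_funD => //; exact: measurable_radius_powR.
have g0 x : (0 <= g x)%E.
  by rewrite lee_fin !mulr_ge0 ?addr_ge0 ?powR_ge0// ltW.
have mbox := @measurable_tuple_box R N r.
apply: (@le_lt_trans _ _ (\int[lebesgue_tuple N]_x (g \_ (box r)) x)%E).
  apply: ge0_le_integral => //.
  - by move=> x _; apply: integral_ge0 => t _; exact: abse_ge0.
  - apply: (measurable_fun_fubini_tonelli_F (abse \o (EFin \o f))).
      exact: measurableT_comp.
    by move=> w; exact: abse_ge0.
  - by apply: (measurable_restrictT g mbox).1; exact: measurable_funTS.
  - move=> x _; rewrite patchE; case: ifPn => [/set_mem xb|/negP xb].
      apply: (@le_trans _ _ (\int[mu]_t ((cst (C * (1 + radius x `^ s))%:E) \_ (`[0%R, T]%classic : set RM)) t)%E).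
        apply: ge0_le_integral => //.
        + apply: measurableT_comp => //; apply/measurable_EFinP.
          exact: (measurableT_comp mf (pair1_measurable x)).
        + by apply: (measurable_restrictT _ _).1 => //; exact: measurable_cst.
        + move=> t _; rewrite patchE; case: ifPn => [/set_mem|/negP tT].
            by rewrite /= in_itv/= => tT; rewrite lee_fin; exact: hf.
          have -> : (EFin \o f) (x, t) = 0%E.
            rewrite /= f0//; move=> [_ h]; apply: tT; apply/mem_set.
            by rewrite /= in_itv.
          by rewrite abse0.
      rewrite -integral_mkcond integral_cst; last exact: measurable_itv.
      have mT : mu (`[0, T]%classic : set RM) = T%:E.
        by have := @lebesgue_measure_itv R `[0, T]; rewrite /= lte_fin T0 sube0.
      by rewrite [X in (_ * X <= _)%E](_ : _ = T%:E) -?EFinM.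
    rewrite integral0_eq// => t _.
    have -> : (EFin \o f) (x, t) = 0%E.
      by rewrite /= f0//; move=> [h _]; apply: xb; exact: mem_set.
    by rewrite abse0.
rewrite -integral_mkcond.
have -> : g = (fun x => (C * T)%:E * (1 + (radius x `^ s)%:E))%E.
  by apply/funext => x; rewrite /g -EFinD -EFinM; congr EFin; ring.
have CT : 0 <= C * T by rewrite mulr_ge0// ltW.
have mrT : measurable_fun setT (fun x : N.-tuple RM => (radius x `^ s)%:E).
  by apply/measurable_EFinP; exact: measurable_radius_powR.
have mrs := measurable_funTS (D := box r) mrT.
have pw0 x : (0 <= (radius (N := N) x `^ s)%:E :> \bar R)%E by rewrite lee_fin powR_ge0.
rewrite ge0_integralZl//; last 2 first.
- by apply: emeasurable_funD => //; exact: measurable_cst.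
- by move=> x _; rewrite adde_ge0.
rewrite ge0_integralD//.
rewrite integral_cst// mul1e [X in (X + _)%E](_ : _ = ((2 * r) ^+ N)%:E); last exact: volume_box (ltW r0).
apply: lte_mul_pinfty => //.
apply: lte_add_pinfty; first exact: ltry.
exact: integral_radius_box.
Qed.

Lemma coordinates_neq0_ae :
  {ae (lebesgue_tuple N \x mu)%E, forall w : base, forall i, tnth w.1 i != 0}.
Proof.
suff h i : {ae (lebesgue_tuple N \x mu)%E, forall w : base, tnth w.1 i != 0}.
  exact: filter_forall.
pose A := [set t : N.-tuple RM | tnth t i = 0].
have mA : measurable A.
  have -> : A = (@tnth N RM ^~ i) @^-1` [set 0] by apply/seteqP; split.
  rewrite -[X in measurable X]setTI.
  exact: (@measurable_tnth _ RM N i measurableT [set 0] (measurable_set1 _)).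
exists (A `*` setT); split.
- exact: measurableX.
- rewrite product_measure1E// [X in (X * _)%E](_ : _ = 0%E) ?mul0e//.
  exact: coordinate_hyperplane_null.
- by move=> w /= /negP; rewrite negbK => /eqP w0.
Qed.

Lemma line_hasD (g : spacetime -> R) (v z0 : spacetime) (r : R) :
  derivable g (z0 + r *: v) v -> hasD (fun r => g (z0 + r *: v)) r ('D_v g (z0 + r *: v)).
Proof.
move=> dg.
have E : (fun h : R => h^-1 *: (((fun r : R => g (z0 + r *: v)) \o shift r) (h *: 1) - g (z0 + r *: v))) =
  (fun h : R => h^-1 *: ((g \o shift (z0 + r *: v)) (h *: v) - g (z0 + r *: v))).
  apply/funext => h /=; congr (_ *: (g _ - _)).
  by rewrite [h *: 1]mulr1 scalerDl addrCA.
apply: DeriveDef; first by rewrite /derivable E.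
by rewrite /derive E.
Qed.

End Spacetime.

(** * The self-similar function as a weak solution *)

Section LogSelfSimilar.
Context {R : realType}.
Variables (N : nat) (m p sigma : R) (u w : R -> R).
Local Notation al := (ss_alpha m p sigma).
Local Notation be := (ss_beta m p sigma).

(* The self-similar function and the terms of its equation as functions of
   [q = |x|^2] and [th = ln (T - t)]. *)
Definition ss_lam (q th : R) := 2^-1 * ln q - be * th.
Definition ss_log q th := - al * th + u (ss_lam q th).
Definition ss_u q th := expR (ss_log q th).
Definition ss_v q th := expR (m * ss_log q th).
Definition ss_w q th := w (ss_lam q th).
Definition ss_reaction q th := expR (sigma / 2 * ln q + p * ss_log q th).
Definition ss_ut q th := expR (- th) * ss_u q th * (al + be * ss_w q th).
Definition ss_vx y q th := m * ss_v q th * ss_w q th * y / q.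
(** The second derivative of U ^ m in the coordinate [y], from which the profile equation has
    eliminated the second derivative of the profile. Over all coordinates the first term sums to 0
    and the second to U_t - |x| ^ sigma U ^ p. *)
Definition ss_vxx y q th :=
  m * ss_v q th * ss_w q th * (q^-1 - N%:R * y ^+ 2 / q ^+ 2)
  + y ^+ 2 / q * (ss_ut q th - ss_reaction q th).

Lemma sum_ss_vxx (n : nat) (y : 'I_n -> R) q th : n = N -> q != 0 -> \sum_i y i ^+ 2 = q ->
  \sum_i ss_vxx (y i) q th = ss_ut q th - ss_reaction q th.
Proof.
move=> nN q0 yq; rewrite /ss_vxx big_split/= -mulr_suml -mulr_suml yq divff// mul1r.
rewrite -mulr_sumr.
have -> : \sum_i (q^-1 - N%:R * y i ^+ 2 / q ^+ 2) = 0.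
  rewrite sumrB sumr_const card_ord -mulr_suml -mulr_sumr yq -nN -mulr_natl.
  by field.
by rewrite mulr0 add0r.
Qed.

Hypothesis m1 : 1 < m.
Hypothesis mp : m < p.
Hypothesis L0 : 0 < ss_L m p sigma.
Variables (lA M C : R).
Hypothesis lp : log_profile (N%:R - 2) (sigma + 2) m p al be u w lA M C.

Lemma hasD_ss_u q (g : R -> R) t d : hasD g t d ->
  hasD (fun t => ss_u q (g t)) t (- d * ss_u q (g t) * (al + be * ss_w q (g t))).
Proof.
move=> dg.
have dl : hasD (fun t => ss_lam q (g t)) t (- be * d).
  by rewrite /ss_lam; derive; ring.
have du : hasD (fun t => u (ss_lam q (g t))) t (ss_w q (g t) * (- be * d)).
  exact: (hasD_comp (lp_u lp _) dl).
rewrite /ss_u /ss_log; derive; ring.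
Qed.

Lemma hasD_ss_ut q T t : t < T ->
  hasD (fun t => ss_u q (ln (T - t))) t (ss_ut q (ln (T - t))).
Proof.
move=> tT; have T0 : 0 < T - t by rewrite subr_gt0.
have dg : hasD (fun t => ln (T - t)) t ((T - t)^-1 * -1).
  by apply: (@hasD_ln _ (fun t => T - t)) => //; derive; ring.
apply: hasD_eq (hasD_ss_u q dg) _.
by rewrite /ss_ut expRN lnK ?posrE//; ring.
Qed.

Section Line.
Variables (S th r : R).
Hypothesis q0 : 0 < r ^+ 2 + S.
Let q := r ^+ 2 + S.

Let hasD_lam : hasD (fun r => ss_lam (r ^+ 2 + S) th) r (r / q).
Proof.
have dq : hasD (fun r => r ^+ 2 + S) r (2 * r) by derive; rewrite /=; ring.
have dl := @hasD_ln _ (fun r => r ^+ 2 + S) r _ q0 dq.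
rewrite /ss_lam; derive; rewrite -/q; have : q != 0 by rewrite gt_eqF.
by move: q => Q Q0; field.
Qed.

Lemma hasD_ss_v : hasD (fun r => ss_v (r ^+ 2 + S) th) r (ss_vx r q th).
Proof.
have du := hasD_comp (lp_u lp _) hasD_lam.
by rewrite /ss_v /ss_log; derive; rewrite /ss_vx /ss_v /ss_log /ss_w -/q; ring.
Qed.

Lemma hasD_ss_vx : hasD (fun r : R => ss_vx r (r ^+ 2 + S) th) r (ss_vxx r q th).
Proof.
have dq : hasD (fun r => r ^+ 2 + S) r (2 * r) by derive; rewrite /=; ring.
have qn0 : q != 0 by rewrite gt_eqF.
have dV := @hasDV _ (fun r => r ^+ 2 + S) r _ qn0 dq.
have qE : q = expR (ln q) by rewrite lnK.
have dv := hasD_ss_v.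
have dw := hasD_comp (lp_w lp _) hasD_lam.
(* [ln1] and [ln2] are the relations between al and be that make U_t, the diffusion and the reaction
   scale with the same power of T - t. *)
have ln1 : 2 * be + al * (m - 1) = 1.
  rewrite /ss_beta /ss_alpha; have := L0; rewrite /ss_L => h.
  by field; rewrite gt_eqF.
have ln2 : (sigma + 2) * be = al * (p - m).
  by rewrite /ss_beta /ss_alpha; have := L0 => h; field; rewrite gt_eqF.
have E1 : ss_v q th * expR (2 * ss_lam q th + (1 - m) * u (ss_lam q th)) =
    q * (expR (- th) * ss_u q th).
  rewrite [X in _ = X * _]qE -!expRD; congr expR.
  rewrite /ss_log; set U := u _; rewrite /ss_lam.
  transitivity (ln q + U - al * th - th * (2 * be + al * (m - 1))); first by field.
  by rewrite ln1; ring.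
have E2 : ss_v q th * expR ((sigma + 2) * ss_lam q th + (p - m) * u (ss_lam q th)) =
    q * ss_reaction q th.
  rewrite [X in _ = X * _]qE -!expRD; congr expR.
  rewrite /ss_log; set U := u _; rewrite /ss_lam.
  transitivity (p * U + (sigma / 2 + 1) * ln q - th * (m * al + (sigma + 2) * be)).
    by field.
  by rewrite ln2; field.
rewrite /ss_vx /ss_w; derive.
rewrite -/q /ss_vxx /ss_ut /ss_vx -/(ss_w q th).
move: E1 E2; set X1 := expR _; set X2 := expR ((sigma + 2) * _ + _).
set V := ss_v q th; set W := ss_w q th; set Ut := expR _ * _; set P := ss_reaction _ _.
move=> E1 E2; have m0 : m != 0 by rewrite gt_eqF//; have := m1; lra.
transitivity (m * V * W * (q^-1 - N%:R * r ^+ 2 / q ^+ 2) +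
  r ^+ 2 / q ^+ 2 * ((V * X1) * (al + be * W) - V * X2)).
  by move: q qn0 X1 X2 {E1 E2} V W => Q Q0 X1 X2 V W; field; rewrite Q0 m0.
rewrite E1 E2; move: q qn0 V W Ut P {E1 E2} => Q Q0 V W Ut P; field; exact: Q0.
Qed.

End Line.

Lemma continuous_powR_bound (g : R -> R) K s : 0 < s -> 0 <= K -> g 0 = 0 ->
  (forall r, r != 0 -> `|g r| <= K * expR (s * ln `|r|)) -> ctsat g 0.
Proof.
move=> s0 K0 g0 gK; apply/cvgrPdist_lt => e e0; rewrite g0.
pose de := expR (s^-1 * ln (e / (K + 1))).
have K1 : 0 < K + 1 by lra.
have eK : 0 < e / (K + 1) by rewrite divr_gt0.
have hd : \forall r \near (0 : R), `|r| < de by apply: nbhs0_lt; exact: expR_gt0.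
near=> r; rewrite sub0r normrN.
have [->|r0] := eqVneq r 0; first by rewrite g0 normr0.
have rd : `|r| < de.
  by near: r; exact: hd.
apply: le_lt_trans (gK r r0) _.
have hr : 0 < `|r| by rewrite normr_gt0.
have : expR (s * ln `|r|) < e / (K + 1).
  rewrite -[ltRHS]lnK ?posrE// ltr_expR -ltr_pdivlMl//.
  by rewrite -ltr_expR lnK ?posrE.
rewrite ltr_pdivlMr// => h.
have := expR_gt0 (s * ln `|r|); set X := expR _ in h * => X0.
apply: le_lt_trans h; rewrite mulrC ler_pM2l//; lra.
Unshelve. all: by end_near. Qed.

Lemma ln_sqrt_sqr (r : R) : 2^-1 * ln (r ^+ 2) = ln `|r|.
Proof.
have [->|r0] := eqVneq r 0; first by rewrite expr0n/= normr0 ln0// mulr0.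
have h : 0 < `|r| by rewrite normr_gt0.
by rewrite -[r ^+ 2]ger0_norm ?sqr_ge0// normrX lnXn//; field.
Qed.

(** Here [v] is U ^ m on a coordinate line and [S] the sum of squares of the other coordinates. If S
    > 0 the line misses x = 0 and the formulas hold throughout. If S = 0, [v] takes at r = 0 the
    value given by f 0, and [vx], being O(|r| ^ (sigma + 1)), the value 0; sigma > -1 makes it
    continuous. *)
Lemma ss_flux (S th : R) : 0 <= S -> (0 < S \/ -1 < sigma) ->
  exists v vx : R -> R, [/\ continuous v, continuous vx,
    forall r : R, r != 0 -> v r = ss_v (r ^+ 2 + S) th,
    forall r : R, r != 0 -> hasD v r (vx r) &
    forall r : R, r != 0 -> hasD vx r (ss_vxx r (r ^+ 2 + S) th)].
Proof.
move=> S0 Ss.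
have r2 (r : R) : r != 0 -> 0 < r ^+ 2 + S.
  by move=> r0; rewrite ltr_wpDr// lt_neqAle eq_sym sqrf_eq0 r0 sqr_ge0.
have [Sp|Sn] := ltP 0 S.
  have q0 (r : R) : 0 < r ^+ 2 + S by rewrite ltr_wpDl// sqr_ge0.
  exists (fun r : R => ss_v (r ^+ 2 + S) th), (fun r : R => ss_vx r (r ^+ 2 + S) th); split.
  - by move=> r; apply: hasD_continuous (hasD_ss_v th (q0 r)).
  - by move=> r; apply: hasD_continuous (hasD_ss_vx th (q0 r)).
  - by [].
  - by move=> r _; exact: hasD_ss_v.
  - by move=> r _; exact: hasD_ss_vx.
have {Sn} S00 : S = 0 by apply/eqP; rewrite eq_le Sn.
subst S; case: Ss => [|s1]; first by rewrite ltxx.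
have nb (r : R) : r != 0 -> \forall z \near r, z != 0.
  have [h|h|//] := ltgtP r 0 => _.
    by apply: filterS (lt_nbhsl h) => z z0; rewrite lt_eqF.
  by apply: filterS (lt_nbhsr h) => z z0; rewrite gt_eqF.
pose f := profile_of u lA.
pose v (r : R) := expR (m * (- al * th + ln (f (`|r| * expR (- be * th))))).
have vE (r : R) : r != 0 -> v r = ss_v (r ^+ 2 + 0) th.
  move=> r0; have h : 0 < `|r| by rewrite normr_gt0.
  rewrite /v /f profile_ofE ?mulr_gt0 ?expR_gt0// expRK lnM ?posrE ?expR_gt0// expRK.
  by rewrite /ss_v /ss_log /ss_lam addr0 ln_sqrt_sqr (mulNr be).
have dv (r : R) : r != 0 -> hasD v r (ss_vx r (r ^+ 2 + 0) th).
  move=> r0; apply: hasD_near (hasD_ss_v th (r2 r r0)).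
  by apply: filterS (nb r r0) => z z0; rewrite vE.
have cv r : ctsat v r.
  have cn : ctsat (fun r : R => `|r|) r by exact: norm_continuous.
  have cf : ctsat (fun r : R => f (`|r| * expR (- be * th))) r.
    apply: (@ctsat_comp _ f (fun r : R => `|r| * expR (- be * th))).
      exact: (continuous_profile lp).
    continuity.
  have cl := @ctsat_ln _ (fun r : R => f (`|r| * expR (- be * th))) r (profile_of_gt0 _ _ _) cf.
  by rewrite /v; continuity.
exists v, (fun r : R => ss_vx r (r ^+ 2 + 0) th); split.
- exact: cv.
- move=> s; have [->|s0] := eqVneq s 0; last exact: hasD_continuous (hasD_ss_vx th (r2 s s0)).
  apply: (@continuous_powR_bound _ (m * expR (m * (- al * th + lA)) * C *
    expR (- (sigma + 2) * be * th)) (sigma + 1)).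
  + lra.
  + by rewrite !mulr_ge0 ?expR_ge0 ?(lp_C lp)//; have := m1; lra.
  + by rewrite /ss_vx mulr0 mul0r.
  move=> r r0; have h : 0 < `|r| by rewrite normr_gt0.
  have m0 : 0 < m by have := m1; lra.
  have E : expR ((sigma + 1) * ln `|r|) =
      expR ((sigma + 2) * ln `|r|) * (`|r| / r ^+ 2).
    have -> : `|r| / r ^+ 2 = `|r|^-1.
      by rewrite -[r ^+ 2]ger0_norm ?sqr_ge0// normrX; field; rewrite gt_eqF.
    rewrite -{3}[`|r|]lnK ?posrE// -expRN -expRD; congr expR; ring.
  rewrite E /ss_vx addr0 !normrM normfV (gtr0_norm m0) (ger0_norm (sqr_ge0 r)).
  rewrite (ger0_norm (expR_ge0 _)).
  have hw : `|ss_w (r ^+ 2) th| <= C * expR (- (sigma + 2) * be * th) * expR ((sigma + 2) * ln `|r|).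
    apply: le_trans (lp_wC lp _) _; rewrite -mulrA -expRD ler_wpM2l ?(lp_C lp)// ler_expR.
    by rewrite /ss_lam ln_sqrt_sqr le_eqVlt; apply/orP; left; apply/eqP; ring.
  have hv : ss_v (r ^+ 2) th <= expR (m * (- al * th + lA)).
    by rewrite ler_expR ler_pM2l// lerD2l (lp_ule lp).
  have rr0 : 0 <= `|r| / r ^+ 2 by rewrite divr_ge0// sqr_ge0.
  rewrite -[leLHS]mulrA [leRHS]mulrA ler_wpM2r//.
  have h1 := ler_pM (expR_ge0 _) (normr_ge0 _) hv hw.
  by have := ler_wpM2l (ltW m0) h1; rewrite !mulrA.
- exact: vE.
- exact: dv.
- by move=> r r0; exact: (hasD_ss_vx th (r2 r r0)).
Qed.

End LogSelfSimilar.

Section SelfSimilarMeasurable.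
Context {R : realType} d (X : measurableType d).
Variables (N : nat) (m p sigma : R) (u w : R -> R).
Hypothesis cu : continuous u.
Hypothesis cw : continuous w.
Variables (q th y : X -> R).
Hypothesis mq : measurable_fun setT q.
Hypothesis mth : measurable_fun setT th.
Hypothesis my : measurable_fun setT y.

Let mlam : measurable_fun setT (fun z => ss_lam m p sigma (q z) (th z)).
Proof.
apply: measurable_funB; apply: measurable_funM => //.
by apply: measurableT_comp => //; exact: measurable_ln.
Qed.

Let mlog : measurable_fun setT (fun z => ss_log m p sigma u (q z) (th z)).
Proof.
apply: measurable_funD; first exact: measurable_funM.
exact: (measurableT_comp (continuous_measurable_fun cu) mlam).
Qed.

Lemma measurable_ss_u : measurable_fun setT (fun z => ss_u m p sigma u (q z) (th z)).
Proof. by apply: measurableT_comp => //; exact: measurable_expR. Qed.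

Lemma measurable_ss_v : measurable_fun setT (fun z => ss_v m p sigma u (q z) (th z)).
Proof. by apply: measurableT_comp; [exact: measurable_expR|exact: measurable_funM]. Qed.

Let mw : measurable_fun setT (fun z => ss_w m p sigma w (q z) (th z)).
Proof. exact: (measurableT_comp (continuous_measurable_fun cw) mlam). Qed.

Lemma measurable_ss_ut : measurable_fun setT (fun z => ss_ut m p sigma u w (q z) (th z)).
Proof.
apply: measurable_funM; last by apply: measurable_funD => //; exact: measurable_funM.
apply: measurable_funM; last exact: measurable_ss_u.
by apply: measurableT_comp; [exact: measurable_expR|exact: measurable_funN].
Qed.

Lemma measurable_ss_vxx : (forall z, 0 <= q z) ->
  measurable_fun setT (fun z => ss_vxx N m p sigma u w (y z) (q z) (th z)).
Proof.
move=> q0.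
have mV : measurable_fun setT (fun z => (q z)^-1).
  rewrite (_ : (fun z => _) = (fun z => q z `^ (-1))).
    exact: (measurableT_comp (measurable_powR _) mq).
  by apply/funext => z; rewrite powR_inv1.
have my2 := measurable_funX 2 my.
have mV2 : measurable_fun setT (fun z => (q z ^+ 2)^-1).
  under eq_fun do rewrite -exprVn.
  exact: measurable_funX.
have mr : measurable_fun setT (fun z => ss_reaction m p sigma u (q z) (th z)).
  apply: measurableT_comp; first exact: measurable_expR.
  apply: measurable_funD; apply: measurable_funM => //.
  by apply: measurableT_comp => //; exact: measurable_ln.
apply: measurable_funD; apply: measurable_funM.
- by apply: measurable_funM; [apply: measurable_funM; [|exact: measurable_ss_v]|].
- by apply: measurable_funB => //; do !apply: measurable_funM.
- exact: measurable_funM.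
- by apply: measurable_funB => //; exact: measurable_ss_ut.
Qed.

End SelfSimilarMeasurable.

(** * Bounds at a fixed distance from the blow-up time *)

Section SelfSimilarBounds.
Context {R : realType}.
Variables (N : nat) (m p sigma : R) (u w : R -> R) (lA M C : R).
Local Notation al := (ss_alpha m p sigma).
Local Notation be := (ss_beta m p sigma).
Hypothesis m1 : 1 < m.
Hypothesis mp : m < p.
Hypothesis sigma2 : 0 < sigma + 2.
Hypothesis L0 : 0 < ss_L m p sigma.
Hypothesis lp : log_profile (N%:R - 2) (sigma + 2) m p al be u w lA M C.

Lemma ss_alpha_gt0 : 0 < al.
Proof. exact: divr_gt0. Qed.

Lemma ss_beta_gt0 : 0 < be.
Proof. by rewrite divr_gt0// subr_gt0. Qed.

(** The distance [eta] kept from the time T bounds [ss_log] by [a]. In the second derivative, w =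
    O(xi ^ (sigma + 2)) reduces the singular factor |x| ^ (-2) to |x| ^ sigma, which is also the
    size of the reaction term. *)
Lemma ss_bounds (eta : R) : 0 < eta -> exists2 K : R, 0 <= K &
  forall rho th : R, 0 <= rho -> ln eta <= th ->
  [/\ `|ss_u m p sigma u (rho ^+ 2) th| <= K, `|ss_v m p sigma u (rho ^+ 2) th| <= K,
      `|ss_ut m p sigma u w (rho ^+ 2) th| <= K &
      forall y, y ^+ 2 <= rho ^+ 2 ->
        `|ss_vxx N m p sigma u w y (rho ^+ 2) th| <= K * (1 + rho `^ sigma)].
Proof.
move=> eta0.
have al0 := ss_alpha_gt0; have be0 := ss_beta_gt0.
have m0 : 0 < m by have := m1; lra.
have p0 : 0 < p by have := mp; lra.
have C0 := lp_C lp; have M0 := lp_M lp.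
pose a := - al * ln eta + lA.
pose Kut := expR (- ln eta) * expR a * (al + be * M).
pose Kw := m * expR (m * a) * (C * expR (- ((sigma + 2) * be) * ln eta)) * (1 + N%:R).
pose K := expR a + expR (m * a) + Kut + expR (p * a) + Kw.
have Kut0 : 0 <= Kut by rewrite /Kut; nonneg.
have Kw0 : 0 <= Kw by rewrite /Kw; nonneg.
exists K; first by rewrite /K; nonneg.
move=> rho th rho0 eth.
have lo : ss_log m p sigma u (rho ^+ 2) th <= a.
  rewrite /ss_log /a !mulNr lerD ?(lp_ule lp)// lerN2 ler_pM2l//.
have [ea1 ea2 ea3] : [/\ 0 <= expR a, 0 <= expR (m * a) & 0 <= expR (p * a)].
  by split; exact: expR_ge0.
have hu : ss_u m p sigma u (rho ^+ 2) th <= expR a by rewrite ler_expR.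
have hv : ss_v m p sigma u (rho ^+ 2) th <= expR (m * a) by rewrite ler_expR ler_pM2l.
have /andP[w1 w2] := lp_wM lp (ss_lam m p sigma (rho ^+ 2) th).
have hut : `|ss_ut m p sigma u w (rho ^+ 2) th| <= Kut.
  rewrite /ss_ut !normrM !(ger0_norm (expR_ge0 _)) /Kut.
  apply: ler_pM => //.
    by apply: ler_pM; rewrite ?expR_ge0// ler_expR; lra.
  rewrite /ss_w; set W := w _ in w1 w2 *.
  have h1 : - (be * M) <= be * W by rewrite -mulrN ler_pM2l.
  have h2 : be * W <= 0 by rewrite pmulr_rle0.
  rewrite ler_norml; move: h1 h2 al0; move: (be * W) (be * M) al => b1 b2 a'; lra.
split.
- by rewrite ger0_norm ?expR_ge0// /K; lra.
- by rewrite ger0_norm ?expR_ge0// /K; lra.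
- by rewrite /K; lra.
move=> y yr.
have pw0 : 0 <= rho `^ sigma by exact: powR_ge0.
have K0 : 0 <= K by rewrite /K; nonneg.
(* At [rho = 0] both terms of [ss_vxx] are 0, the inverse of 0 being 0. *)
have [r0|rn0] := eqVneq rho 0.
  rewrite r0 expr0n/= /ss_vxx expr0n/= !invr0 !mulr0 subr0 mulr0 mul0r addr0 normr0.
  by apply: mulr_ge0 => //; rewrite addr_ge0// powR_ge0.
have rp : 0 < rho by rewrite lt_neqAle eq_sym rn0.
have lnr : 2^-1 * ln (rho ^+ 2) = ln rho by rewrite ln_sqrt_sqr ger0_norm.
have hr : ss_reaction m p sigma u (rho ^+ 2) th <= rho `^ sigma * expR (p * a).
  rewrite /ss_reaction expRD powRE//.
  have -> : sigma / 2 * ln (rho ^+ 2) = sigma * ln rho by rewrite -lnr; ring.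
  by rewrite ler_pM2l ?expR_gt0// ler_expR ler_pM2l.
have hr0 : 0 <= ss_reaction m p sigma u (rho ^+ 2) th by exact: expR_ge0.
have q0 : 0 < rho ^+ 2 by rewrite exprn_gt0.
have hw : `|ss_w m p sigma w (rho ^+ 2) th| <=
    C * expR (- ((sigma + 2) * be) * ln eta) * (rho `^ sigma * rho ^+ 2).
  apply: le_trans (lp_wC lp _) _; rewrite -mulrA ler_wpM2l//.
  have -> : rho `^ sigma * rho ^+ 2 = expR ((sigma + 2) * ln rho).
    by rewrite powRE// mulrDl expRD expRM_natl lnK.
  rewrite -expRD ler_expR /ss_lam lnr mulrBr addrC lerD2r.
  by rewrite mulNr mulrA lerN2 ler_pM2l// mulr_gt0.
have y0 : 0 <= y ^+ 2 / rho ^+ 2 by rewrite divr_ge0// sqr_ge0.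
have y1 : y ^+ 2 / rho ^+ 2 <= 1 by rewrite ler_pdivrMr// mul1r.
rewrite /ss_vxx.
have -> : (rho ^+ 2)^-1 - N%:R * y ^+ 2 / (rho ^+ 2) ^+ 2 =
    (1 - N%:R * (y ^+ 2 / rho ^+ 2)) / rho ^+ 2.
  by field; rewrite gt_eqF.
move: y0 y1; set Y := y ^+ 2 / rho ^+ 2 => y0 y1.
have hN : `|1 - N%:R * Y| <= 1 + N%:R.
  have n0 : (0 : R) <= N%:R by [].
  have h1 : 0 <= N%:R * Y by exact: mulr_ge0.
  have h2 : N%:R * Y <= N%:R by rewrite ler_piMr.
  by rewrite ler_norml; lra.
have hA : `|m * ss_v m p sigma u (rho ^+ 2) th * ss_w m p sigma w (rho ^+ 2) th
    * ((1 - N%:R * Y) / rho ^+ 2)| <= Kw * rho `^ sigma.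
  rewrite !normrM normfV (gtr0_norm m0) (ger0_norm (expR_ge0 _)) (gtr0_norm q0).
  rewrite [leLHS]mulrA ler_pdivrMr//.
  have -> : Kw * rho `^ sigma * rho ^+ 2 = m * expR (m * a) *
    (C * expR (- ((sigma + 2) * be) * ln eta) * (rho `^ sigma * rho ^+ 2)) * (1 + N%:R).
    by rewrite /Kw; ring.
  have v0 : 0 <= m * ss_v m p sigma u (rho ^+ 2) th by apply: mulr_ge0; [exact: ltW|exact: expR_ge0].
  by apply: ler_pM => //; [exact: mulr_ge0|apply: ler_pM => //; rewrite ler_pM2l].
have hB : `|Y * (ss_ut m p sigma u w (rho ^+ 2) th - ss_reaction m p sigma u (rho ^+ 2) th)| <=
    Kut + rho `^ sigma * expR (p * a).
  rewrite normrM (ger0_norm y0); apply: le_trans (ler_piMl (normr_ge0 _) y1) _.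
  apply: le_trans (ler_normB _ _) _; apply: lerD => //.
  by rewrite (ger0_norm hr0).
apply: le_trans (ler_normD _ _) _; apply: le_trans (lerD hA hB) _.
rewrite /K; move: pw0; set P := rho `^ sigma => P0.
have h1 : 0 <= expR a * P by exact: mulr_ge0.
have h2 : 0 <= expR (m * a) * P by exact: mulr_ge0.
have h3 : 0 <= Kut * P by exact: mulr_ge0.
lra.
Qed.

End SelfSimilarBounds.

Section CompactSupport.
Context {R : realType} (N : nat).
Local Notation RM := (measurableTypeR R).
Local Notation spacetime := ('rV[R]_N * R)%type.
Local Notation base := (N.-tuple RM * RM)%type.
Variables (T s : R) (K : set spacetime).
Hypothesis T0 : 0 < T.
Hypothesis s0 : s < 0.
Hypothesis sN : - N%:R < s.
Hypothesis cK : compact K.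
Hypothesis KT : K `<=` strip T.

Lemma integrable_off_compact (f : base -> R) (C : R) : 0 <= C -> measurable_fun setT f ->
  (forall z, K (spacetime_of z) -> `|f z| <= C * (1 + radius z.1 `^ s)) ->
  (forall z, ~ K (spacetime_of z) -> f z = 0) ->
  (@spacetime_measure R N).-integrable setT (EFin \o f).
Proof.
move=> C0 mf fK f0.
have [r [eta [r0 /andP[e0 eT] hK]]] := compact_in_slab T0 cK KT.
apply: (@spacetime_dominated _ _ f r T C s) => // z.
  move=> _ _; have [/fK//|/f0 ->] := pselect (K (spacetime_of z)).
  by rewrite normr0 mulr_ge0// addr_ge0// powR_ge0.
move=> h; apply: f0 => /hK [/= h1 h2]; apply: h; split; last by lra.
by apply/forallP => i; have := h1 i; rewrite mxE.
Qed.

Lemma integrable_on_compact (f : base -> R) (C : R) : 0 <= C -> measurable_fun setT f ->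
  (forall z, K (spacetime_of z) -> `|f z| <= C * (1 + radius z.1 `^ s)) ->
  (@spacetime_measure R N).-integrable (@spacetime_of R N @^-1` K) (EFin \o f).
Proof.
move=> C0 mf fK; have mK := measurable_spacetime_compact cK.
apply/integrable_mkcond => //; rewrite restrict_EFin.
apply: (@integrable_off_compact _ C) => //.
- by apply: (measurable_restrictT f mK).1; exact: measurable_funTS.
- by move=> z Kz; rewrite patchE mem_set//; exact: fK.
- by move=> z Kz; rewrite patchE memNset.
Qed.

Lemma derive_off_closed (g : spacetime -> R) v : (forall z, ~ K z -> g z = 0) ->
  forall z, ~ K z -> 'D_v g z = 0.
Proof.
move=> g0 z Kz; have clK : closed K by apply: (compact_closed _ cK); exact: norm_hausdorff.
rewrite (@near_eq_derive _ _ _ g (cst 0)); first exact: derive_cst.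
have oK : nbhs z (~` K) by apply: open_nbhs_nbhs; split => //; exact: closed_openC.
by apply: filterS oK => y; exact: g0.
Qed.

End CompactSupport.

(** * Admissibility of the self-similar function *)

Section Admissible.
Context {R : realType}.
Variables (N : nat) (m p sigma T : R) (u w : R -> R) (lA M C : R).
Local Notation RM := (measurableTypeR R).
Local Notation base := (N.-tuple RM * RM)%type.
Local Notation al := (ss_alpha m p sigma).
Local Notation be := (ss_beta m p sigma).
Hypothesis T0 : 0 < T.
Hypothesis m1 : 1 < m.
Hypothesis mp : m < p.
Hypothesis sigma2 : 0 < sigma + 2.
Hypothesis sigma0 : sigma < 0.
Hypothesis sigmaN : - N%:R < sigma.
Hypothesis L0 : 0 < ss_L m p sigma.
Hypothesis lp : log_profile (N%:R - 2) (sigma + 2) m p al be u w lA M C.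
Local Notation f := (profile_of u lA).
Local Notation U := (@self_similar R N m p sigma T f).

Lemma self_similar_gt0 z : z.2 < T -> 0 < U z.
Proof.
by move=> zT; rewrite mulr_gt0 ?profile_of_gt0// powR_gt0// subr_gt0.
Qed.

Lemma self_similarE (z : base) : 0 < radius z.1 -> z.2 < T ->
  U (spacetime_of z) = ss_u m p sigma u (radius z.1 ^+ 2) (ln (T - z.2)).
Proof.
move=> r0 zT; have t0 : 0 < T - z.2 by rewrite subr_gt0.
rewrite /self_similar /= -/(radius z.1) !powRE// profile_ofE ?mulr_gt0 ?expR_gt0//.
rewrite -expRD lnM ?posrE ?expR_gt0// expRK /ss_u /ss_log /ss_lam.
by rewrite ln_sqrt_sqr ger0_norm ?ltW// (mulNr be).
Qed.

Lemma measurable_self_similar : measurable_fun setT (U \o @spacetime_of R N).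
Proof.
have mt : measurable_fun setT (fun z : base => T - z.2).
  by apply: measurable_funB => //; exact: measurable_snd.
apply: measurable_funM.
  exact: (measurableT_comp (measurable_powR _) mt).
apply: (measurableT_comp (continuous_measurable_fun (continuous_profile lp))).
apply: measurable_funM; last exact: (measurableT_comp (measurable_powR _) mt).
exact: (measurableT_comp (@measurable_radius R N) measurable_fst).
Qed.

Lemma self_similar_bound (eta : R) z : 0 < eta -> z.2 <= T - eta ->
  U z <= eta `^ (- al) * expR lA.
Proof.
move=> e0 zT; have al0 := ss_alpha_gt0 sigma2 L0.
apply: ler_pM; rewrite ?powR_ge0//.
- by rewrite ltW// profile_of_gt0.
- have t0 : 0 < T - z.2 by lra.
  rewrite !powRE// ler_expR !mulNr lerN2 ler_pM2l// ler_ln ?posrE//; lra.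
- by rewrite /profile_of; case: ifP => // _; rewrite ler_expR (lp_ule lp).
Qed.

Lemma self_similar_admissible (Q : set ('rV[R]_N * R)) : Q `<=` strip T ->
  weak_admissible m p sigma Q U.
Proof.
move=> QT.
have bnd K : compact K -> K `<=` Q -> exists2 B : R, 0 <= B & forall z, K z -> 0 <= U z <= B.
  move=> cK /subset_trans/(_ QT) KT.
  have [r [eta [_ /andP[e0 eT] hK]]] := compact_in_slab T0 cK KT.
  exists (eta `^ (- al) * expR lA) => [|z /hK[_ /andP[_ h]]].
    by rewrite mulr_ge0 ?powR_ge0 ?expR_ge0.
  by rewrite self_similar_bound// andbT ltW// self_similar_gt0//; lra.
have m0 : 0 <= m by have := m1; lra.
have p0 : 0 <= p by have := mp; lra.
split.
- by move=> z /QT/andP[_ zT]; exact: ltW (self_similar_gt0 zT).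
- move=> K cK KQ; have [B B0 hB] := bnd K cK KQ.
  apply: (integrable_on_compact T0 sigma0 sigmaN cK (subset_trans KQ QT) B0).
    exact: measurable_self_similar.
  move=> z /hB/andP[h1 h2]; rewrite /= ger0_norm//; apply: le_trans h2 _.
  by rewrite ler_peMr// lerDl powR_ge0.
- move=> K cK KQ; have [B B0 hB] := bnd K cK KQ.
  apply: (@integrable_on_compact _ _ T sigma K T0 sigma0 sigmaN cK (subset_trans KQ QT) _ (B `^ m)).
  + exact: powR_ge0.
  + exact: (measurableT_comp (measurable_powR _) measurable_self_similar).
  + move=> z /hB/andP[h1 h2]; rewrite /= ger0_norm ?powR_ge0//.
    apply: le_trans (ge0_ler_powR m0 _ _ h2) _; rewrite ?nnegrE//.
    by rewrite ler_peMr ?powR_ge0// lerDl powR_ge0.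
- move=> K cK KQ; have [B B0 hB] := bnd K cK KQ.
  apply: (@integrable_on_compact _ _ T sigma K T0 sigma0 sigmaN cK (subset_trans KQ QT) _ (B `^ p)).
  + exact: powR_ge0.
  + apply: measurable_funM.
      exact: (measurableT_comp (@measurable_radius_powR R N sigma) measurable_fst).
    exact: (measurableT_comp (measurable_powR _) measurable_self_similar).
  + move=> z /hB/andP[h1 h2]; rewrite /= ger0_norm ?mulr_ge0 ?powR_ge0//.
    rewrite mulrC; apply: ler_pM; rewrite ?powR_ge0//.
      by apply: (ge0_ler_powR p0) => //; rewrite nnegrE.
    by rewrite -/(radius z.1) lerDr.
Qed.

End Admissible.

Lemma line_continuous (R : realType) (V : normedModType R) (g : V -> R) (z0 v : V) :
  continuous g -> continuous (fun r : R => g (z0 + r *: v)).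
Proof.
move=> cg r; apply: (@continuous_comp _ _ _ (fun r : R => z0 + r *: v) g); last exact: cg.
by apply: continuousD; [exact: cst_continuous|exact: scalel_continuous].
Qed.

(** * Vanishing of the weak form *)

Section WeakForm.
Context {R : realType}.
Variables (N : nat) (m p sigma T : R) (u w : R -> R) (lA M C : R).
Local Notation RM := (measurableTypeR R).
Local Notation mu := (@lebesgue_measure R).
Local Notation spacetime := ('rV[R]_N * R)%type.
Local Notation base := (N.-tuple RM * RM)%type.
Local Notation al := (ss_alpha m p sigma).
Local Notation be := (ss_beta m p sigma).
Hypothesis T0 : 0 < T.
Hypothesis m1 : 1 < m.
Hypothesis mp : m < p.
Hypothesis sigma2 : 0 < sigma + 2.
Hypothesis sigma0 : sigma < 0.
Hypothesis sigmaN : - N%:R < sigma.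
Hypothesis L0 : 0 < ss_L m p sigma.
Hypothesis lp : log_profile (N%:R - 2) (sigma + 2) m p al be u w lA M C.
Variable phi : spacetime -> R.
Hypothesis tphi : test_function (strip T) phi.

Let K := closure [set z | phi z != 0].
Let cK : compact K. Proof. by case: tphi. Qed.
Let KT : K `<=` strip T. Proof. by case: tphi. Qed.

Let phi_out z : ~ K z -> phi z = 0.
Proof. by move=> Kz; apply/eqP/negPn/negP => h; apply: Kz; exact: subset_closure. Qed.

Let dt_out z : ~ K z -> dt phi z = 0.
Proof. exact: (derive_off_closed cK _ phi_out). Qed.

Let dx_out i z : ~ K z -> dx i phi z = 0.
Proof. exact: (derive_off_closed cK _ phi_out). Qed.

Let dxx_out i z : ~ K z -> dx i (dx i phi) z = 0.
Proof. exact: (derive_off_closed cK _ (@dx_out i)). Qed.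

Let ex i : spacetime := (delta_mx ord0 i, 0).
Let et : spacetime := (0, 1).

Let cphi : continuous phi.
Proof. by case: tphi => /(_ [::])[]. Qed.
Let cdt : continuous (dt phi).
Proof. by case: tphi => /(_ [:: et])[]. Qed.
Let cdx i : continuous (dx i phi).
Proof. by case: tphi => /(_ [:: ex i])[]. Qed.
Let cdxx i : continuous (dx i (dx i phi)).
Proof. by case: tphi => /(_ [:: ex i; ex i])[]. Qed.

Let q (z : base) := radius z.1 ^+ 2.
Let th (z : base) := ln (T - z.2).

(* On the lines along which |x| may vanish the flux is singular, and is
   discarded unless N = 1. *)
Let off_axis (i : 'I_N) (x : N.-tuple RM) :=
  (N == 1%N) || (0 < radius x ^+ 2 - tnth x i ^+ 2).

(** The t-derivative of U phi; [Fx i] below is the x_i-derivative of U ^ m d_i phi - d_i(U ^ m)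
    phi. *)
Let Ft (z : base) := ss_u m p sigma u (q z) (th z) * dt phi (spacetime_of z)
  + ss_ut m p sigma u w (q z) (th z) * phi (spacetime_of z).

Let Fx i (z : base) := if off_axis i z.1 then
    ss_v m p sigma u (q z) (th z) * dx i (dx i phi) (spacetime_of z)
    - ss_vxx N m p sigma u w (tnth z.1 i) (q z) (th z) * phi (spacetime_of z)
  else 0.

Let cu : continuous u. Proof. by move=> t; exact: hasD_continuous (lp_u lp t). Qed.
Let cw : continuous w. Proof. by move=> t; exact: hasD_continuous (lp_w lp t). Qed.

Let mq : measurable_fun setT q.
Proof. apply: measurable_funX; exact: (measurableT_comp (@measurable_radius R N) measurable_fst). Qed.

Let mth : measurable_fun setT th.
Proof.
apply: (measurableT_comp (@measurable_ln R)).
by apply: measurable_funB => //; exact: measurable_snd.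
Qed.

Let mFt : measurable_fun setT Ft.
Proof.
apply: measurable_funD; apply: measurable_funM.
- exact: measurable_ss_u.
- exact: (measurable_spacetime_continuous cdt).
- exact: measurable_ss_ut.
- exact: (measurable_spacetime_continuous cphi).
Qed.

Let mtnth (i : 'I_N) : measurable_fun setT (fun z : base => (tnth z.1 i : R)).
Proof. exact: (measurableT_comp (@measurable_tnth _ RM N i) measurable_fst). Qed.

Let mFx i : measurable_fun setT (Fx i).
Proof.
apply: measurable_fun_ifT => //.
  apply: measurable_or => //; apply: measurable_fun_ltr => //.
  apply: measurable_funB; first exact: mq.
  exact: measurable_funX.
apply: measurable_funB; apply: measurable_funM.
- exact: measurable_ss_v.
- exact: (@measurable_spacetime_continuous R N (dx i (dx i phi)) (@cdxx i)).
- by apply: measurable_ss_vxx => // z; exact: sqr_ge0.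
- exact: (measurable_spacetime_continuous cphi).
Qed.

Let bounds : exists eta K1 : R, [/\ 0 < eta < T, 0 <= K1,
    forall z, K z -> 0 < z.2 <= T - eta &
    forall z : base, K (spacetime_of z) ->
    [/\ `|ss_u m p sigma u (q z) (th z)| <= K1, `|ss_v m p sigma u (q z) (th z)| <= K1,
      `|ss_ut m p sigma u w (q z) (th z)| <= K1 &
      forall i, `|ss_vxx N m p sigma u w (tnth z.1 i) (q z) (th z)| <= K1 * (1 + radius z.1 `^ sigma)]].
Proof.
have [r [eta [_ e0 hK]]] := compact_in_slab T0 cK KT.
have /andP[e1 e2] := e0.
have [K1 K10 h] := ss_bounds m1 mp sigma2 L0 lp e1.
exists eta, K1; split => // [z /hK[]//|z /hK[_ /andP[_ /= zT]]].
have lnle : ln eta <= th z by rewrite ler_ln ?posrE//; lra.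
have [h1 h2 h3 h4] := h _ _ (radius_ge0 z.1) lnle; split => // i; apply: h4.
by rewrite -[_ ^+ 2]ger0_norm ?sqr_ge0// normrX lerXn2r ?nnegrE ?radius_ge0//; exact: radius_ge.
Qed.

Let iFt : (@spacetime_measure R N).-integrable setT (EFin \o Ft).
Proof.
have [eta [K1 [_ K10 _ hK]]] := bounds.
have [B B0 hB] := compact_bound cK cphi; have [Bt Bt0 hBt] := compact_bound cK cdt.
apply: (@integrable_off_compact _ _ T sigma K T0 sigma0 sigmaN cK KT _ (K1 * Bt + K1 * B)).
- by rewrite addr_ge0// mulr_ge0.
- exact: mFt.
- move=> z Kz; have [h1 _ h3 _] := hK z Kz.
  apply: (@le_trans _ _ (K1 * Bt + K1 * B)).
    apply: le_trans (ler_normD _ _) _.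
    rewrite [X in X + _]normrM [X in _ + X]normrM.
    by apply: lerD; apply: ler_pM => //; [exact: hBt|exact: hB].
  by rewrite ler_peMr ?addr_ge0 ?mulr_ge0// lerDl powR_ge0.
- by move=> z Kz; rewrite /Ft dt_out// phi_out// !mulr0 addr0.
Qed.

Let iFx i : (@spacetime_measure R N).-integrable setT (EFin \o Fx i).
Proof.
have [eta [K1 [_ K10 _ hK]]] := bounds.
have [B B0 hB] := compact_bound cK cphi; have [Bx Bx0 hBx] := compact_bound cK (@cdxx i).
apply: (@integrable_off_compact _ _ T sigma K T0 sigma0 sigmaN cK KT _ (K1 * Bx + K1 * B)).
- by rewrite addr_ge0// mulr_ge0.
- exact: mFx.
- move=> z Kz; have [_ h2 _ h4] := hK z Kz.
  have pw : 0 <= radius z.1 `^ sigma by exact: powR_ge0.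
  rewrite /Fx; case: ifP => _; last by rewrite normr0 mulr_ge0// addr_ge0// mulr_ge0.
  apply: le_trans (ler_normB _ _) _; rewrite [leRHS]mulrDl [X in X + _ <= _]normrM [X in _ + X <= _]normrM; apply: lerD.
    apply: (@le_trans _ _ (K1 * Bx)); first by apply: ler_pM => //; exact: hBx.
    by rewrite ler_peMr ?mulr_ge0// lerDl.
  rewrite mulrAC; apply: ler_pM => //; exact: hB.
- by move=> z Kz; rewrite /Fx dxx_out// phi_out// !mulr0 subr0; case: ifP.
Qed.

Let integral_Ft : (\int[@spacetime_measure R N]_z (Ft z)%:E = 0)%E.
Proof.
have [eta [K1 [/andP[e0 eT] _ hK _]]] := bounds.
apply: fubini_zero1; first exact: iFt.
move=> x ix.
pose z0 : spacetime := (\row_i tnth x i, 0).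
have zE t : spacetime_of (x, t) = z0 + t *: et.
  by congr pair; rewrite /= ?scaler0 ?addr0// add0r; exact: esym (mulr1 t).
(* This endpoint lies past the support of phi but short of T, where U is singular; at t = 0, phi
   vanishes because the strip is open. *)
have b0 : 0 < T - eta / 2 by lra.
have out t : ~ (0 < t < T - eta / 2) -> ~ K (spacetime_of (x, t)).
  by move=> h /hK /= /andP[h1 h2]; apply: h; lra.
have dphi t : hasD (fun t => phi (spacetime_of (x, t))) t (dt phi (spacetime_of (x, t))).
  have := @line_hasD R N phi et z0 t; rewrite -zE => h.
  have hd : derivable phi (spacetime_of (x, t)) et by have [/(_ [::])[_ hd] _ _] := tphi; exact: hd.
  by apply: hasD_ext (h hd) => r; rewrite zE.
have cdphi t : ctsat (fun t => dt phi (spacetime_of (x, t))) t.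
  have := @line_continuous R _ _ z0 et cdt t.
  by rewrite (_ : (fun r => _) = (fun t => dt phi (spacetime_of (x, t))))//; apply/funext => r; rewrite zE.
have cph t : ctsat (fun t => phi (spacetime_of (x, t))) t.
  exact: hasD_continuous (dphi t).
pose U t := ss_u m p sigma u (radius x ^+ 2) (ln (T - t)).
pose Ut t := ss_ut m p sigma u w (radius x ^+ 2) (ln (T - t)).
have dU t : t < T -> hasD U t (Ut t) by move=> tT; exact: (hasD_ss_ut lp _ tT).
have cUt t : t < T -> ctsat Ut t.
  move=> tT; have cln : ctsat (fun t => ln (T - t)) t.
    by apply: (@ctsat_ln _ (fun t => T - t)); [rewrite subr_gt0|continuity].
  have clam : ctsat (fun t => ss_lam m p sigma (radius x ^+ 2) (ln (T - t))) t.
    by rewrite /ss_lam; continuity.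
  have cul : ctsat (fun t => u (ss_lam m p sigma (radius x ^+ 2) (ln (T - t)))) t.
    exact: (@ctsat_comp _ u (fun t => ss_lam m p sigma (radius x ^+ 2) (ln (T - t))) t (@cu _) clam).
  have cwl : ctsat (fun t => w (ss_lam m p sigma (radius x ^+ 2) (ln (T - t)))) t.
    exact: (@ctsat_comp _ w (fun t => ss_lam m p sigma (radius x ^+ 2) (ln (T - t))) t (@cw _) clam).
  by rewrite /Ut /ss_ut /ss_u /ss_log /ss_w; continuity.
have cU t : t < T -> ctsat U t by move=> tT; exact: hasD_continuous (dU t tT).
apply: (@line_integral0 _ (fun t => U t * phi (spacetime_of (x, t))) (fun t => Ft (x, t)) 0 (T - eta / 2)).
- exact: b0.
- move=> t /andP[_ tT]; have tT' : t < T by lra.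
  have h1 := dU t tT'; have h2 := dphi t; derive; by rewrite /Ft /q /th /U /Ut /=; ring.
- move=> t /andP[_ tT]; have tT' : t < T by lra.
  have h1 := cU t tT'; have h2 := cUt t tT'; have h3 := cph t; have h4 := cdphi t.
  by apply: (ctsatD (ctsatM h1 h4) (ctsatM h2 h3)).
- by have h1 := cU 0 T0; have h3 := cph 0; exact: ctsatM h1 h3.
- have tT : T - eta / 2 < T by lra.
  by have h1 := cU _ tT; have h3 := cph (T - eta / 2); exact: ctsatM h1 h3.
- by rewrite phi_out ?mulr0//; apply: out; lra.
- by rewrite phi_out ?mulr0//; apply: out; lra.
- by move=> t /out h; rewrite /Ft dt_out// phi_out// !mulr0 addr0.
- exact: ix.
Qed.

Let ctsat_ss_vxx (S h r : R) : 0 < r ^+ 2 + S ->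
  ctsat (fun r => ss_vxx N m p sigma u w r (r ^+ 2 + S) h) r.
Proof.
move=> q0.
have cq : ctsat (fun r => r ^+ 2 + S) r by continuity.
have cln := @ctsat_ln _ (fun r => r ^+ 2 + S) r q0 cq.
have clam : ctsat (fun r => ss_lam m p sigma (r ^+ 2 + S) h) r by rewrite /ss_lam; continuity.
have cul := @ctsat_comp _ u (fun r => ss_lam m p sigma (r ^+ 2 + S) h) r (@cu _) clam.
have cwl := @ctsat_comp _ w (fun r => ss_lam m p sigma (r ^+ 2 + S) h) r (@cw _) clam.
have qn0 : r ^+ 2 + S != 0 by rewrite gt_eqF.
have cV := @ctsatV _ (fun r => r ^+ 2 + S) r qn0 cq.
have cV2 : ctsat (fun r => (r ^+ 2 + S) ^- 2) r.
  by apply: (@ctsatV _ (fun r => (r ^+ 2 + S) ^+ 2)); [rewrite expf_neq0|continuity].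
have cl : ctsat (fun r => ss_log m p sigma u (r ^+ 2 + S) h) r by rewrite /ss_log; continuity.
have cv : ctsat (fun r => ss_v m p sigma u (r ^+ 2 + S) h) r by rewrite /ss_v; continuity.
have ct : ctsat (fun r => ss_ut m p sigma u w (r ^+ 2 + S) h) r.
  by rewrite /ss_ut /ss_u /ss_w; continuity.
have cr : ctsat (fun r => ss_reaction m p sigma u (r ^+ 2 + S) h) r.
  by rewrite /ss_reaction; continuity.
have cw' : ctsat (fun r => ss_w m p sigma w (r ^+ 2 + S) h) r by exact: cwl.
clear cq cln clam cul cwl cl; rewrite /ss_vxx.
apply: ctsatD; apply: ctsatM.
- by apply: ctsatM; [continuity|exact: cw'].
- by apply: ctsatD; [exact: cV|continuity].
- by apply: ctsatM; [continuity|exact: cV].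
- by apply: ctsatD; [exact: ct|apply: ctsatN; exact: cr].
Qed.

Let integral_Fx i : (\int[@spacetime_measure R N]_z (Fx i z)%:E = 0)%E.
Proof.
have [b [eta [b0 _ hK]]] := compact_in_slab T0 cK KT.
apply: fubini_zero2; first exact: iFx.
move=> t it; apply: (@tuple_line0 R N i (fun x => (Fx i (x, t))%:E) it) => x ix.
pose S := \sum_(j < N | j != i) tnth x j ^+ 2.
have S0 : 0 <= S by apply: sumr_ge0 => j _; exact: sqr_ge0.
have qE (r : R) : radius (upd x i r) ^+ 2 = r ^+ 2 + S.
  rewrite radius_sqr (bigD1 i)//= tnth_upd eqxx; congr (_ + _).
  by apply: eq_bigr => j ji; rewrite tnth_upd (negbTE ji).
(* The test is constant along the line, so each line is kept or discarded as a whole. *)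
have offE (r : R) : off_axis i (upd x i r) = (N == 1%N) || (0 < S).
  by rewrite /off_axis qE tnth_upd eqxx addrAC subrr add0r.
have [/orP off|/negbTE off] := boolP ((N == 1%N) || (0 < S)); last first.
  by apply: integral0_eq => r _; rewrite /Fx/= offE off.
have hS : 0 < S \/ -1 < sigma.
  by case: off => [/eqP N1|]; [right; move: sigmaN; rewrite N1|left].
have [v [vx [cv cvx vE dv dvx]]] := ss_flux m1 L0 lp (ln (T - t)) S0 hS.
pose z0 : spacetime := (\row_j tnth (upd x i 0) j, t).
have zE (r : R) : spacetime_of (upd x i r, t) = z0 + r *: ex i.
  congr pair; rewrite /= ?scaler0 ?addr0//.
  apply/rowP => j; rewrite !mxE/= !tnth_upd ?eqxx/=.
  by case: eqP => [_|_]; rewrite ?mulr1 ?add0r ?mulr0 ?addr0.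
have dline (g : spacetime -> R) (r : R) : (forall z, derivable g z (ex i)) ->
    hasD (fun r => g (z0 + r *: ex i)) r (dx i g (z0 + r *: ex i)).
  by move=> dg; exact: line_hasD.
have d1 (r : R) : hasD (fun r => phi (z0 + r *: ex i)) r (dx i phi (z0 + r *: ex i)).
  by apply: dline => z; have [/(_ [::])[_ hd] _ _] := tphi; exact: hd.
have d2 (r : R) : hasD (fun r => dx i phi (z0 + r *: ex i)) r (dx i (dx i phi) (z0 + r *: ex i)).
  by apply: dline => z; have [/(_ [:: ex i])[_ hd] _ _] := tphi; exact: hd.
have c0 := @line_continuous R _ _ z0 (ex i) cphi.
have c1 := @line_continuous R _ _ z0 (ex i) (@cdx i).
have c2 := @line_continuous R _ _ z0 (ex i) (@cdxx i).
have FxE (r : R) : Fx i (upd x i r, t) =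
    ss_v m p sigma u (r ^+ 2 + S) (ln (T - t)) * dx i (dx i phi) (z0 + r *: ex i) -
    ss_vxx N m p sigma u w r (r ^+ 2 + S) (ln (T - t)) * phi (z0 + r *: ex i).
  rewrite /Fx /q /th /= offE; have -> : (N == 1%N) || (0 < S) by apply/orP.
  by rewrite qE zE tnth_upd eqxx.
have q0 (r : R) : r != 0 -> 0 < r ^+ 2 + S.
  by move=> r0; rewrite ltr_wpDr// lt_neqAle eq_sym sqrf_eq0 r0 sqr_ge0.
(* On the support |r| <= b, so all terms vanish from - (b + 1) down and from b + 1 up. *)
have out (r : R) : ~ - (b + 1) < r < b + 1 -> ~ K (z0 + r *: ex i).
  move=> hr /hK[/(_ i)]; rewrite -zE /= mxE tnth_upd eqxx ler_norml => h _.
  by apply: hr; lra.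
have b1 : 0 < b + 1 by lra.
have cF (r : R) : ctsat (fun r => v r * dx i phi (z0 + r *: ex i) + - (vx r * phi (z0 + r *: ex i))) r.
  apply: ctsatD; first exact: (ctsatM (cv r) (c1 r)).
  by apply: ctsatN; exact: (ctsatM (cvx r) (c0 r)).
apply: (@singular_line_integral0 _
  (fun r => v r * dx i phi (z0 + r *: ex i) - vx r * phi (z0 + r *: ex i))
  (fun r => Fx i (upd x i r, t)) (b + 1) b1).
- exact: cF.
- move=> r r0; have h1 := dv r r0; have h2 := dvx r r0; have h3 := d1 r; have h4 := d2 r.
  by derive; rewrite FxE -vE//; ring.
- move=> r r0.
  have h1 := hasD_continuous (dv r r0); have h2 := @ctsat_ss_vxx S (ln (T - t)) r (q0 r r0).
  have h3 := c0 r; have h4 := c2 r.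
  have : ctsat (fun r => ss_v m p sigma u (r ^+ 2 + S) (ln (T - t)) * dx i (dx i phi) (z0 + r *: ex i) +
    - (ss_vxx N m p sigma u w r (r ^+ 2 + S) (ln (T - t)) * phi (z0 + r *: ex i))) r.
    apply: ctsatD; last by apply: ctsatN; exact: ctsatM h2 h3.
    apply: ctsatM; last exact: h4.
    exact: hasD_continuous (hasD_ss_v lp (ln (T - t)) (q0 r r0)).
  by rewrite (_ : (fun r => _ + _) = (fun r => Fx i (upd x i r, t)))//; apply/funext => r'; rewrite FxE.
- by move=> r /out h; rewrite FxE dx_out// dxx_out// phi_out// !mulr0 subr0.
- exact: ix.
Qed.

Lemma weak_form_eq0 : weak_form m p sigma (@self_similar R N m p sigma T (profile_of u lA)) phi = 0%E.
Proof.
rewrite /weak_form.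
transitivity (\int[@spacetime_measure R N]_z ((Ft z)%:E + \sum_(i < N) (Fx i z)%:E))%E; last first.
  rewrite integralD//; last first.
    by apply: integrable_sum => // i _; exact: iFx.
  rewrite integral_Ft add0e integral_sum//.
  by rewrite big1// => i _; exact: integral_Fx.
have [eta [K1 [/andP[e0 eT] _ hK _]]] := bounds.
have mU := measurable_self_similar T lp.
apply: ae_eq_integral => //.
- apply/measurable_EFinP; apply: measurable_funD; [apply: measurable_funD|]; apply: measurable_funM.
  + exact: mU.
  + exact: (measurable_spacetime_continuous cdt).
  + exact: (measurableT_comp (measurable_powR _) mU).
  + apply: measurable_sum => i.
    exact: (@measurable_spacetime_continuous R N (dx i (dx i phi)) (@cdxx i)).
  + apply: measurable_funM; last exact: (measurableT_comp (measurable_powR _) mU).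
    exact: (measurableT_comp (@measurable_radius_powR R N sigma) measurable_fst).
  + exact: (measurable_spacetime_continuous cphi).
- apply: emeasurable_funD; first exact/measurable_EFinP.
  by apply: emeasurable_sum => i; exact/measurable_EFinP.
(* Outside the null set where some coordinate vanishes, |x| > 0 and, for N >= 2, some coordinate
   other than x_i is nonzero; so no flux has been discarded and the integrands agree pointwise. *)
apply: filterS (@coordinates_neq0_ae R N) => z z0 _ /=.
have [Kz|Kz] := pselect (K (spacetime_of z)); last first.
  rewrite dt_out// phi_out// /laplacian (eq_bigr (fun=> 0)); last by move=> i _; rewrite dxx_out.
  rewrite big1// !mulr0 !addr0 /Ft dt_out// phi_out// !mulr0 addr0 big1 ?adde0// => i _.
  by rewrite /Fx dxx_out// phi_out// !mulr0 subr0; case: ifP.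
have zT : z.2 < T by have /andP[_] := hK _ Kz; rewrite /=; lra.
have N0 : (0 < N)%N by case: (N) sigmaN sigma0 => // h1 h2; lra.
have r0 : 0 < radius z.1 by exact: radius_gt0 (z0 (Ordinal N0)).
have off i : off_axis i z.1.
  rewrite /off_axis; case: eqVneq => //= N1.
  have /card_gt0P[j] : (0 < #|predC1 i|)%N by rewrite cardC1 card_ord; case: (N) N0 N1 => [|[]].
  rewrite inE => ji.
  rewrite radius_sqr (bigD1 i)//= addrAC subrr add0r (bigD1 j)//= ltr_pwDl//.
    by rewrite lt_neqAle eq_sym sqrf_eq0 z0 sqr_ge0.
  by apply: sumr_ge0 => k _; exact: sqr_ge0.
rewrite sumEFin -EFinD; congr EFin.
have -> : \sum_(i < N) Fx i z = ss_v m p sigma u (q z) (th z) * laplacian phi (spacetime_of z) -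
    (ss_ut m p sigma u w (q z) (th z) - ss_reaction m p sigma u (q z) (th z)) * phi (spacetime_of z).
  rewrite -(@sum_ss_vxx R N m p sigma u w N (tnth z.1))//; last 2 first.
  - by rewrite /q gt_eqF// exprn_gt0.
  - by rewrite /q radius_sqr.
  rewrite /laplacian mulr_sumr mulr_suml -sumrB; apply: eq_bigr => i _.
  by rewrite /Fx off.
rewrite (self_similarE _ _ _ _ _ r0 zT) -/(q z) -/(th z) /Ft.
have -> : ss_u m p sigma u (q z) (th z) `^ m = ss_v m p sigma u (q z) (th z).
  by rewrite powRE ?expR_gt0// expRK.
have -> : enorm (spacetime_of z).1 `^ sigma * ss_u m p sigma u (q z) (th z) `^ p =
    ss_reaction m p sigma u (q z) (th z).
  rewrite -/(radius z.1) !powRE ?expR_gt0// expRK -expRD; congr expR.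
  by rewrite /q -(ger0_norm (ltW r0)) -ln_sqrt_sqr (ger0_norm (ltW r0)); ring.
by ring.
Qed.

End WeakForm.

(** For N >= 3 this is p < p_s cleared of its denominator, with m (N - 2) added to both sides; for N
    <= 2 the left side is nonpositive and the right side positive. *)
Lemma subcritical (R : realType) (N : nat) (m p sigma : R) : (1 <= N)%N -> 1 < m -> m < p ->
  - N%:R < sigma -> (p%:E < sobolev_exponent N m sigma)%E ->
  (N%:R - 2) * (p + m) < 2 * m * (N%:R - 2 + (sigma + 2)).
Proof.
move=> N1 m1 mp sN; rewrite /sobolev_exponent; case: leqP => N3.
  move=> _; have n0 : (N%:R : R) - 2 <= 0 by rewrite subr_le0 ler_nat.
  have h1 : (N%:R - 2) * (p + m) <= 0 by rewrite mulr_le0_ge0//; lra.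
  apply: le_lt_trans h1 _; apply: mulr_gt0; lra.
have n0 : (0 : R) < N%:R - 2 by rewrite subr_gt0 ltr_nat.
by rewrite lte_fin ltr_pdivlMr//; lra.
Qed.

Theorem theorem1p3 (R : realType) (N : nat) (m p sigma T : R)
  (hN : (1 <= N)%N) (hm : 1 < m)
  (hsigma : -2 < sigma < 0) (hsigmaN : - N%:R < sigma)
  (hmp : m < p) (hps : (p%:E < sobolev_exponent N m sigma)%E)
  (hT : 0 < T) :
  exists f : R -> R,
    [/\ self_similar_solution N m p sigma T f,
        exists2 K : R, 0 < K & behavior_at_0 N m p sigma K f &
        exists2 C : R, 0 < C & behavior_at_infty m p sigma C f].
Proof.
have /andP[s2 s0] := hsigma.
have sigma2 : 0 < sigma + 2 by lra.
have L0 : 0 < ss_L m p sigma.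
  have h : 0 < (sigma + 2) * (m - 1) by rewrite mulr_gt0// subr_gt0.
  by rewrite /ss_L; lra.
have N1 : (1 : R) <= N%:R by rewrite ler1n.
have [||||||||u [w [lA [M [C [lp exp0 [l hl]]]]]]] :=
    @log_profile_exists R (N%:R - 2) (sigma + 2) m p (ss_alpha m p sigma) (ss_beta m p sigma) sigma2.
- lra.
- lra.
- lra.
- exact: hm.
- exact: hmp.
- exact: ss_alpha_gt0.
- exact: ss_beta_gt0.
- exact: subcritical.
(* A test function on [Q] is one on the whole strip, so a single computation serves both the strip
   and the punctured strip. *)
have weak Q : Q `<=` strip T -> weak_solution m p sigma Q (@self_similar R N m p sigma T (profile_of u lA)).
  move=> QT; split; first exact: (self_similar_admissible hT hm hmp sigma2 s0 hsigmaN L0 lp QT).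
  move=> phi [h1 h2 h3]; apply: (weak_form_eq0 hT hm hmp sigma2 s0 hsigmaN L0 lp).
  by split => //; exact: subset_trans QT.
exists (profile_of u lA); split.
- split; first exact: (profile_of_profile hm lp).
    by move=> _; exact: weak.
  move=> _; split; first by apply: weak => z [].
  have [h1 h2] := weak _ (@subset_refl _ (strip T)).
  by split => // phi tphi _; rewrite h2.
- exists (expR (- (p - m) * lA)); first exact: expR_gt0.
  exact: profile_of_at_0.
- exists (expR l); first exact: expR_gt0.
  exact: profile_of_at_infty.
Qed.
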